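(* Let $s>1$ and $R>0$. There is a constant $C(R)>0$ (independent of $N$ and $p$) such that for all $N\in\mathbb{N}\cup\{\infty\}$ and all $p\in[1,\infty)$, $$\|F_N\|_{L^p(\tilde\gamma_s)}\le C(R)\,p .$$
   Context: $\mathbb{T}=\mathbb{R}/2\pi\mathbb{Z}$; all functions are real valued with zero average, $u(x)=\sum_{n\neq0}\hat u(n)e^{inx}$. $|D_x|u=\sum_{n\ne0}|n|\hat u(n)e^{inx}$. $\|f\|_{H^\sigma}^2=\sum_{n\ge1}|n|^{2\sigma}|\hat f(n)|^2$; $\|\cdot\|_{L^2}$ is the usual norm of $L^2(\mathbb{T})$. $P_Nu=\sum_{|n|\le N}\hat u(n)e^{inx}$. For $N\in\mathbb{N}=\{1,2,\dots\}$, $\Phi^N_t$ is the (globally defined) flow of the truncated equation $\partial_tu+\partial_t|D_x|u+\partial_xu+\partial_xP_N((P_Nu)^2)=0$, and $F_N=F_N(u)=\frac{d}{dt}\|P_N\Phi^N_tu\|_{H^{s+1/2}}^2\big|_{t=0}$. Gaussian measure: let $\{h_n\}_{n\ge1},\{l_n\}_{n\ge1}$ be two independent sequences of independent $\mathcal{N}(0,1)$ random variables, $g_n=\frac1{\sqrt2}(h_n+il_n)$ and $g_{-n}=\overline{g_n}$ for $n\ge1$. $\gamma_s$ is the law of $\sum_{n\neq0}\frac{g_n}{|n|^{s+1/2}}e^{inx}$. Put $\mathcal{E}[u]=\big(\|u\|_{L^2}^2+4\pi\|u\|_{H^{1/2}}^2\big)^{1/2}$ and $\tilde\gamma_s(A)=\gamma_s(A\cap\{\mathcal{E}[u]\le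 R\})$. The sequence $(F_N)_{N\in\mathbb{N}}$ converges in $L^2(\gamma_s)$ for $s>\frac12$; $F_\infty=F$ denotes its limit. *)

(* Defs.v *)
From HB Require Import structures.
From mathcomp Require Import all_boot all_order all_algebra.
From mathcomp Require Import complex lra.
From mathcomp Require Import all_classical all_reals all_analysis.
From mathcomp Require Import measurable_realfun.

Set Implicit Arguments.
Unset Strict Implicit.
Unset Printing Implicit Defensive.

Import Order.TTheory GRing.Theory Num.Theory.
Import numFieldNormedType.Exports.

Local Open Scope classical_set_scope.
Local Open Scope ring_scope.
Local Open Scope complex_scope.

(* Functions on R / 2 pi Z are functions on R of which only the values on the
   period [0, 2 pi] matter; [torus] is Lebesgue measure on this period, so that
   it has mass 2 pi. *)
Definition torus (R : realType) :
    {measure set (measurableTypeR R) -> \bar R} :=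
  mrestr (@lebesgue_measure R) (measurable_itv `[0%R, 2 * pi]%R).

Definition cintegral (R : realType) (f : R -> R[i]) : R[i] :=
  (\int[torus R]_x complex.Re (f x)) +i* (\int[torus R]_x complex.Im (f x)).

Definition expi (R : realType) (n : int) (x : R) : R[i] :=
  cos (n%:~R * x) +i* sin (n%:~R * x).

Definition fourier (R : realType) (f : R -> R) (n : int) : R[i] :=
  ((2 * pi)^-1)%:C * cintegral (fun x => (f x)%:C * expi (- n) x).

(* The real part discards nothing when c (- n) is the conjugate of c n, which
   holds in all uses below. *)
Definition trig_sum (R : realType) (c : int -> R[i]) (N : nat) (x : R) : R :=
  complex.Re (\sum_(0 <= k < N.*2.+1)
    (c (k%:Z - N%:Z) * expi (k%:Z - N%:Z) x)).

Definition truncP (R : realType) (N : nat) (f : R -> R) : R -> R :=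
  trig_sum (fourier f) N.

(* |D_x| and d/dx act on the Fourier coefficients. *)
Definition absD (R : realType) (c : int -> R[i]) (n : int) : R[i] :=
  `|n|%N%:R * c n.
Definition ddx (R : realType) (c : int -> R[i]) (n : int) : R[i] :=
  'i * n%:~R * c n.

Definition sqHnorm (R : realType) (sigma : R) (f : R -> R) : \bar R :=
  (\sum_(1 <= n <oo)
     (n%:R `^ (2 * sigma) * Normc.normc (fourier f n%:Z) ^+ 2)%:E)%E.

Definition L2norm (R : realType) (f : R -> R) : \bar R :=
  'N[torus R]_(2%:E)[EFin \o f]%E.

(* Square integrable functions of zero average, not identified almost
   everywhere; every notion below only depends on the class of the function. *)
Record L20fun (R : realType) := MkL20fun {
  L20val :> LfunType (torus R) (lee1n 2);
  L20_avg : \int[torus R]_x (L20val x) = 0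
}.

Section L20_pointed.
Context (R : realType).
HB.instance Definition _ := gen_eqMixin (L20fun R).
HB.instance Definition _ := gen_choiceMixin (L20fun R).

Let zero_avg : \int[torus R]_x ((0 : LfunType (torus R) (lee1n 2)) x) = 0.
Proof. by rewrite /Rintegral integral0. Qed.
HB.instance Definition _ := isPointed.Build (L20fun R) (MkL20fun zero_avg).
End L20_pointed.

(* Open sets for the L2 seminorm, so that L20 carries its Borel sigma-algebra. *)
Definition L20open (R : realType) : set (set (L20fun R)) :=
  [set O | forall u : L20fun R, O u -> exists2 e : R, 0 < e &
     forall v : L20fun R, (L2norm (v \- u)%R < e%:E)%E -> O v].

Notation L20 R := (g_sigma_algebraType (@L20open R)).

Definition energy (R : realType) (u : R -> R) : \bar R :=
  ((L2norm u ^+ 2 + (4 * pi)%:E * sqHnorm 2^-1 u) `^ 2^-1)%E.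

Definition is_cderive (R : realType) (f : R -> R[i]) (t : R) (df : R[i]) :=
  is_derive t (1 : R) (fun x => complex.Re (f x)) (complex.Re df) /\
  is_derive t (1 : R) (fun x => complex.Im (f x)) (complex.Im df).

(* Phi is the flow of
     d_t u + d_t |D_x| u + d_x u + d_x P_N ((P_N u)^2) = 0,
   the equation being read on each Fourier coefficient: for initial data that
   are merely square integrable it holds in the sense of distributions. *)
Definition is_truncated_flow (R : realType) (N : nat)
    (Phi : R -> L20 R -> L20 R) :=
  forall u : L20 R, Phi 0 u = u /\
    forall (t : R) (n : int), exists a b : R[i],
      [/\ is_cderive (fun tau => fourier (Phi tau u) n) t a,
          is_cderive (fun tau => absD (fourier (Phi tau u)) n) t b &
          a + b + ddx (fourier (Phi t u)) n
            + ddx (fourier (truncP N (fun x => truncP N (Phi t u) x ^+ 2))) n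
          = 0].

Definition F_ (R : realType) (s : R) (Phi : nat -> R -> L20 R -> L20 R)
    (N : nat) (u : L20 R) : R :=
  derive1 (fun t => fine (sqHnorm (s + 2^-1) (truncP N (Phi N t u)))) 0.

Definition mutually_independent d (Omega : measurableType d) (R : realType)
    (P : probability Omega R) (I : choiceType) (X : I -> {RV P >-> R}) :=
  forall (J : seq I) (B : I -> set R), uniq J ->
    (forall i, measurable (B i)) ->
    P (\bigcap_(i in [set` J]) (X i @^-1` B i)) =
    (\big[*%E/1%E]_(i <- J) P (X i @^-1` B i))%E.

(* Here h k and l k are the variables of index k + 1; the coefficient of index
   0 is set to 0, so that it does not contribute to trigonometric sums. *)
Definition gauss_coef (R : realType) (h l : nat -> R) (n : int) : R[i] :=
  match n with
  | Posz 0 => 0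
  | Posz k.+1 => (Num.sqrt 2)^-1%:C * (h k +i* l k)
  | Negz k => ((Num.sqrt 2)^-1%:C * (h k +i* l k))^*
  end.

Definition random_coef (R : realType) (s : R) (h l : nat -> R) (n : int) :
    R[i] :=
  gauss_coef h l n / (`|n|%N%:R `^ (s + 2^-1))%:C.

Definition family2 (T : Type) (h l : nat -> T) (i : nat + nat) : T :=
  match i with inl k => h k | inr k => l k end.

(* gamma is the law of the random series; X is its sum in L2. *)
Definition is_gamma (R : realType) (s : R) (gamma : set (L20 R) -> \bar R) :=
  exists (d : measure_display) (Omega : measurableType d)
    (P : probability Omega R) (h l : nat -> {RV P >-> R})
    (X : {RV P >-> L20 R}),
  [/\ mutually_independent (family2 h l),
      forall k A, measurable A ->
        distribution P (h k) A = normal_prob 0 1 A /\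
        distribution P (l k) A = normal_prob 0 1 A,
      {ae P, forall w,
        (fun M => L2norm (X w \-
           trig_sum (random_coef s (fun k => h k w) (fun k => l k w)) M))
          @ \oo --> 0%E} &
      forall A, measurable A -> gamma A = distribution P X A].

Section measurability_of_energy.
Context (R : realType).
Implicit Types u v : L20fun R.

Let mL20 u : measurable_fun [set: measurableTypeR R] u.
Proof. exact: measurable_funPT. Qed.

Let L2norm_fin u : L2norm u = (fine (L2norm u))%:E.
Proof. by rewrite (finite_norm_fine (L20val u)). Qed.

Let L2norm_ge0 (f : R -> R) : (0 <= L2norm f)%E.
Proof. exact: Lnorm_ge0. Qed.

Let lipschitz_measurable (Psi : L20fun R -> R) (K : R) : 0 < K ->
  (forall u v, (`|Psi u - Psi v|%:E <= K%:E * L2norm (v \- u)%R)%E) ->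
  measurable_fun [set: L20 R] (Psi : L20 R -> R).
Proof.
move=> K0 lipP; apply: (measurability _ (RGenOpens.measurableE R)) => //.
move=> _ [_ [a [b ->] <-]].
rewrite setTI; apply: sub_sigma_algebra => u /=.
rewrite in_itv /= => /andP[au ub].
pose e := Num.min (Psi u - a) (b - Psi u).
have e0 : 0 < e by rewrite lt_min !subr_gt0 au.
exists (e / K); first by rewrite divr_gt0.
move=> v vu; have : `|Psi u - Psi v| < e.
  rewrite -lte_fin (le_lt_trans (lipP u v))// -lte_pdivlMl// muleC.
  by rewrite -EFinM.
rewrite lt_min => /andP[]; rewrite in_itv /= !ltr_norml; lra.
Qed.

Let L2norm_tri u v : (L2norm u <= L2norm v + L2norm (v \- u)%R)%E.
Proof.
have -> : L2norm u = L2norm (v \+ (\- (v \- u)))%R.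
  by congr L2norm; apply/funext => x /=; rewrite opprB addrC subrK.
have mvu : measurable_fun [set: measurableTypeR R] (v \- u)%R.
  exact: measurable_funB.
have mN : measurable_fun [set: measurableTypeR R] (\- (v \- u))%R.
  exact: measurable_funN.
apply: le_trans.
  by apply: (@eminkowski _ _ _ (torus R) _ _ 2%:E (mL20 v) mN); rewrite lee_fin ler1n.
rewrite leeD2l// /L2norm -(oppe_Lnorm (torus R) (EFin \o (v \- u)%R) 2%:E).
by rewrite le_eqVlt (@eq_Lnorm _ _ _ _ _ _ (\- (EFin \o (v \- u)%R))%E) ?eqxx.
Qed.

Let L2norm_sub u v : L2norm (v \- u)%R = L2norm (u \- v)%R.
Proof.
rewrite /L2norm -[RHS]oppe_Lnorm; congr Lnorm; apply/funext => x /=.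
by congr EFin; rewrite opprB.
Qed.

Let L2norm_measurable : measurable_fun [set: L20 R] (fun u : L20 R => L2norm u).
Proof.
rewrite (_ : (fun _ => _) = EFin \o (fun u : L20fun R => fine (L2norm u))).
  apply/measurable_EFinP; apply: (@lipschitz_measurable _ 1) => // u v.
  rewrite mul1e.
  have h1 := L2norm_tri u v; have h2 := L2norm_tri v u.
  move: h1 h2 (L2norm_ge0 (v \- u)%R); rewrite (L2norm_sub v u).
  case: (L2norm (v \- u)%R) => [c|_ _ _|]; last by [] .
  - rewrite (L2norm_fin u) (L2norm_fin v) -!EFinD !lee_fin => h1 h2 _.
    by rewrite ler_norml; apply/andP; split; lra.
  - by rewrite leey.
by apply/funext => u; rewrite /= -L2norm_fin.
Qed.

Let bounded_L2 (b : R -> R) : measurable_fun [set: measurableTypeR R] b ->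
  (forall x, `|b x| <= 1) -> b \in Lfun (torus R) 2%:E.
Proof.
move=> mb b1; rewrite inE; apply/andP; split; rewrite inE //=.
rewrite /finite_norm unlock poweR_lty//.
apply: (@le_lt_trans _ _ (\int[torus R]_x (cst 1%E x))%E).
  apply: ge0_le_integral => //.
  - move=> x _; exact: poweR_ge0.
  - apply: (@measurableT_comp _ _ _ _ _ _ (fun x : \bar R => x `^ 2)%E).
      exact: measurable_poweR.
    apply: measurableT_comp => //; exact/measurable_EFinP.
  - move=> x _ /=; rewrite lee_fin powR_mulrn ?normr_ge0 //; exact: exprn_ile1.
rewrite integral_cst// mul1e.
rewrite -[ltLHS]/(@lebesgue_measure R ([set: R] `&` `[0%R, 2 * pi]%classic)).
rewrite setTI lebesgue_measure_itv/=.
by case: ifP => _; rewrite ?ltry.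
Qed.

Let pairing_measurable (b : R -> R) :
  measurable_fun [set: measurableTypeR R] b -> (forall x, `|b x| <= 1) ->
  measurable_fun [set: L20 R] (fun u : L20 R => \int[torus R]_x (u x * b x)).
Proof.
move=> mb b1; have bL := bounded_L2 mb b1.
have ib u : (torus R).-integrable setT (EFin \o (fun x => u x * b x)).
  by apply/Lfun1_integrable; apply: Lfun2_mul_Lfun1 => //; exact: LfunP.
set Nb := L2norm b.
have Nb0 : (0 <= Nb)%E by exact: L2norm_ge0.
have Nboo : (Nb < +oo)%E.
  by move: bL; rewrite inE => /andP[_]; rewrite inE.
have NbE : Nb = (fine Nb)%:E by rewrite fineK// ge0_fin_numE.
have fNb0 : 0 <= fine Nb by rewrite fine_ge0.
apply: (@lipschitz_measurable _ (fine Nb + 1)); first lra.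
move=> u v; rewrite L2norm_sub -RintegralB//.
have ibb : (torus R).-integrable setT
    (EFin \o (fun x => u x * b x - v x * b x)).
  rewrite (_ : _ \o _ = (EFin \o (fun x => (u x * b x)%R)) \-
                        (EFin \o (fun x => (v x * b x)%R)))%E//.
  exact: integrableB.
rewrite EFin_normr_Rintegral//.
apply: le_trans (le_abse_integral _ _ _) _ => //.
  by case/integrableP: ibb.
have -> : (\int[torus R]_x `|(u x * b x - v x * b x)%R%:E|)%E =
    'N[torus R]_1[EFin \o ((u \- v) \* b)%R]%E.
  by rewrite Lnorm1; apply: eq_integral => x _ /=; rewrite mulrBl.
apply: le_trans.
  apply: (@hoelder _ _ _ (torus R) (u \- v)%R b 2 2) => //.
  by rewrite [RHS]splitr !div1r.
rewrite muleC lee_wpmul2r//; first exact: L2norm_ge0.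
by rewrite -[leLHS]/Nb NbE lee_fin lerDl.
Qed.

Let re_fourier (f : R -> R) n : complex.Re (fourier f n) =
  (2 * pi)^-1 * \int[torus R]_x (f x * cos ((- n)%:~R * x)).
Proof.
rewrite /fourier /cintegral /= mul0r subr0; congr *%R.
by apply: eq_Rintegral => x _ /=; rewrite mul0r subr0.
Qed.

Let im_fourier (f : R -> R) n : complex.Im (fourier f n) =
  (2 * pi)^-1 * \int[torus R]_x (f x * sin ((- n)%:~R * x)).
Proof.
rewrite /fourier /cintegral /= mul0r addr0; congr *%R.
by apply: eq_Rintegral => x _ /=; rewrite mul0r addr0.
Qed.

Let sqHnorm_measurable (sigma : R) :
  measurable_fun [set: L20 R] (fun u : L20 R => sqHnorm sigma u).
Proof.
rewrite /sqHnorm; under eq_fun do rewrite eseries_cond.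
apply: (@ge0_emeasurable_sum _ _ _ _ (fun n (u : L20 R) =>
   ((n%:R `^ (2 * sigma)) * Normc.normc (fourier u n%:Z) ^+ 2)%:E)
   (fun n => true && (1 <= n)%N)).
  by move=> n u _ _; rewrite lee_fin mulr_ge0// ?powR_ge0// sqr_ge0.
move=> n _; apply/measurable_EFinP; apply: measurable_funM => //.
have mlin (m : R) : measurable_fun [set: measurableTypeR R] (fun x : R => m * x).
  exact: measurable_funM.
rewrite (_ : (fun _ => _) = (fun u : L20 R =>
    complex.Re (fourier u n) ^+ 2 + complex.Im (fourier u n) ^+ 2)).
  apply: measurable_funD; apply: measurable_funX.
  - under eq_fun do rewrite re_fourier.
    apply: measurable_funM => //; apply: pairing_measurable.
      apply: measurableT_comp (mlin _).
      by apply: continuous_measurable_fun; exact: continuous_cos.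
    by move=> x; rewrite ler_norml cos_geN1 cos_le1.
  - under eq_fun do rewrite im_fourier.
    apply: measurable_funM => //; apply: pairing_measurable.
      apply: measurableT_comp (mlin _).
      by apply: continuous_measurable_fun; exact: continuous_sin.
    by move=> x; rewrite ler_norml sin_geN1 sin_le1.
apply/funext => u; case: (fourier u n) => a b /=.
by rewrite sqr_sqrtr// addr_ge0// sqr_ge0.
Qed.

Lemma measurable_energy_le (r : R) :
  measurable [set u : L20 R | (energy u <= r%:E)%E].
Proof.
have mE : measurable_fun [set: L20 R] (fun u : L20 R => energy u).
  rewrite /energy.
  apply: (@measurableT_comp _ _ _ _ _ _ (fun x : \bar R => x `^ 2^-1)%E).
    exact: measurable_poweR.
  apply: emeasurable_funD.
    under eq_fun do rewrite expe2.
    exact: emeasurable_funM.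
  exact: measurable_funeM.
by have := emeasurable_fun_infty_c measurableT mE r%:E; rewrite setTI.
Qed.

End measurability_of_energy.

Definition tilde_gamma (R : realType) (gamma : {measure set (L20 R) -> \bar R})
    (r : R) : {measure set (L20 R) -> \bar R} :=
  mrestr gamma (measurable_energy_le r).

(* Main.v *)
From HB Require Import structures.
From mathcomp Require Import all_boot all_order all_algebra.
From mathcomp Require Import complex ring lra zify.
From mathcomp Require Import all_classical all_reals all_analysis.
From mathcomp Require Import measurable_realfun.
Require Import Defs.

Set Implicit Arguments.
Unset Strict Implicit.
Unset Printing Implicit Defensive.

Import Order.TTheory GRing.Theory Num.Theory.
Import numFieldNormedType.Exports.

Local Open Scope classical_set_scope.
Local Open Scope ring_scope.

(* Write u_n for the Fourier coefficients. The equation gives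
     F_N(u) = 2 sum_(a + b <= N) psi(a, b) Im (u_a u_b conj(u_(a+b))),
   where cancellation in the symbol yields
     |psi(a, b)| <= C min(a, b) (a + b)^(2s).
   Under gamma the real and imaginary parts of the u_n are, after
   normalisation, independent standard Gaussian variables. It suffices to bound
   the moments of order 2m on the energy ball by (C m^2)^m. The frequencies up to
   m are bounded pathwise, using the energy, by C sum_(n <= m) n^(2s+1) |u_n|^2,
   a chi-square variable with 2m degrees of freedom. The contribution of the
   higher frequencies is a martingale, in which the last variable enters
   linearly with a quadratic form in the previous ones as coefficient; Gaussian
   moment bounds propagate along it one variable at a time. *)

(** * Moments of the standard normal law *)

(** For a cubic form in Gaussian variables, hypercontractivity alone gives L^p norms of order
    p^(3/2), so the linear growth has to come from the energy ball. Restriction to the ball,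
    however, destroys independence. The ball therefore enters only through a pathwise inequality,
    and it is dropped, even powers being nonnegative, before any Gaussian variable is integrated.
    The recursion along the remaining variables has unbounded length, so no multiplicative constant
    may be lost at a step: the one-variable estimate keeps the coefficient 1 in front of the part
    already accumulated, and squared L^(2m) norms then add up like variances. Bounds that do lose a
    constant are applied only a fixed number of times. *)

Section standard_normal.
Context (R : realType).
Local Notation mu := (@lebesgue_measure R).
Local Notation N01 := (@normal_prob R 0 1).

(** The Radon-Nikodym derivative of the normal law is known only almost everywhere; it agrees there
    with the explicit density because both have the same integral over every measurable set. *)
Lemma ge0_integral_normal_prob (f : R -> \bar R) :
  measurable_fun [set: R] f -> (forall x, 0 <= f x)%E ->
  (\int[N01]_x f x = \int[mu]_x (f x * (normal_pdf 0 1 x)%:E))%E.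
Proof.
move=> mf f0; have dom := normal_prob_dominates (0:R) 1.
rewrite -(Radon_Nikodym_SigmaFinite.change_of_variables dom)//.
apply: ae_eq_integral => //.
- apply: emeasurable_funM => //; apply: (measurable_int mu).
  exact: Radon_Nikodym_SigmaFinite.f_integrable.
- apply: emeasurable_funM => //; apply/measurable_EFinP.
  exact: measurable_normal_pdf.
- apply: ae_eqe_mul2l; apply: integral_ae_eq => //.
  + exact: Radon_Nikodym_SigmaFinite.f_integrable.
  + apply/measurable_EFinP; exact: measurable_normal_pdf.
  + by move=> E _ mE; rewrite -Radon_Nikodym_SigmaFinite.f_integral.
Qed.

(** Multiplied by the standard density, the integrand becomes [Num.sqrt 2] times the density of the
    centred normal law of variance 2. *)
Lemma integral_normal_prob_expR :
  (\int[N01]_x (expR (x ^+ 2 / 4))%:E = (Num.sqrt 2)%:E)%E.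
Proof.
have mf : measurable_fun [set: R] (fun x : R => (expR (x ^+ 2 / 4))%:E).
  by apply/measurable_EFinP; apply: measurableT_comp => //; apply: measurable_funM.
rewrite ge0_integral_normal_prob//.
have s2 : Num.sqrt 2 != 0 :> R by rewrite gt_eqF// sqrtr_gt0.
rewrite (_ : (fun _ => _) = fun x => ((Num.sqrt 2)%:E *
  (normal_pdf 0 (Num.sqrt 2) x)%:E)%E); last first.
  apply/funext => x; rewrite !normal_pdfE ?oner_neq0// -!EFinM; congr EFin.
  rewrite /normal_peak /normal_fun subr0 expr1n sqr_sqrtr//.
  rewrite mul1r -[2 * pi *+ 2]mulrnAr sqrtrM// invfM.
  rewrite [RHS]mulrA (mulrA (Num.sqrt 2)) mulfV// mul1r mulrCA -expRD.
  by congr (_ * expR _); field.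
rewrite ge0_integralZl//; first by rewrite integral_normal_pdf mule1.
- by apply/measurable_EFinP; exact: measurable_normal_pdf.
- by move=> x _; rewrite lee_fin normal_pdf_ge0.
Qed.

Lemma lebesgue_measure_oppr (A : set R) : measurable A ->
  mu (-%R @^-1` A) = mu A.
Proof.
move=> mA; have mopp : measurable_fun [set: R] (-%R : R -> R).
  exact: oppr_measurable.
pose nu := pushforward mu (-%R : R -> measurableTypeR R).
rewrite [RHS](@lebesgue_measure_unique _ nu)// => _ [[a b] _ <-].
transitivity (mu `[- b, - a[%classic).
  rewrite !lebesgue_measure_itv/= !lte_fin ltrN2; case: ifP => // _.
  by rewrite -!EFinB; congr EFin; ring.
congr (mu _); apply/seteqP; split => x /=; rewrite !in_itv/=; lra.
Qed.

Lemma integral_normal_prob_sym (f : R -> \bar R) :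
  measurable_fun [set: R] f -> (forall x, 0 <= f x)%E ->
  (\int[N01]_x f (- x)%R = \int[N01]_x f x)%E.
Proof.
move=> mf f0.
have mopp : measurable_fun [set: R] (-%R : R -> R) by exact: oppr_measurable.
rewrite !ge0_integral_normal_prob//; last exact: (@measurableT_comp _ _ _ _ _ _ f).
pose h x := (f x * (normal_pdf 0 1 x)%:E)%E.
transitivity (\int[mu]_x h (- x)%R)%E.
  apply: eq_integral => x _ /=; rewrite /h !normal_pdfE ?oner_neq0//.
  by rewrite /normal_fun !subr0 sqrrN.
transitivity (\int[pushforward mu (-%R : R -> measurableTypeR R)]_x h x)%E; last first.
  by apply: eq_measure_integral => A mA _; exact: lebesgue_measure_oppr.
rewrite ge0_integral_pushforward//.
- apply: emeasurable_funM => //; apply/measurable_EFinP.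
  exact: measurable_normal_pdf.
- by move=> x _; rewrite mule_ge0// lee_fin normal_pdf_ge0.
Qed.

(** Integrate y^j <= j! e^y with y = x^2 / 4. The factor j! is what [bin_double_fact] absorbs. *)
Lemma integral_normal_prob_even_moment (j : nat) :
  (\int[N01]_x (x ^+ j.*2)%:E <= (Num.sqrt 2 * 4 ^+ j * j`!%:R)%:E)%E.
Proof.
rewrite (_ : Num.sqrt 2 * 4 ^+ j * j`!%:R = (4 ^+ j * j`!%:R) * Num.sqrt 2); last first.
  by rewrite mulrC mulrA mulrC; ring.
have k0 : 0 <= 4 ^+ j * j`!%:R :> R by rewrite mulr_ge0// exprn_ge0.
have mE : measurable_fun [set: R] (fun x : R => (expR (x ^+ 2 / 4))%:E).
  by apply/measurable_EFinP; apply: measurableT_comp => //; apply: measurable_funM.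
have E0 (x : R) : (0 <= (expR (x ^+ 2 / 4))%:E)%E by rewrite lee_fin expR_ge0.
rewrite EFinM -integral_normal_prob_expR -ge0_integralZl_EFin//.
apply: ge0_le_integral => //.
- by move=> x _; rewrite lee_fin -muln2 exprM exprn_even_ge0.
- by apply/measurable_EFinP; exact: measurable_funX.
- exact: measurable_funeM.
move=> x _; rewrite -EFinM lee_fin -ler_pdivrMl; last first.
  by rewrite mulr_gt0// ?exprn_gt0// ltr0n fact_gt0.
rewrite -muln2 mulnC exprM invfM mulrAC -exprVn -exprMn mulrC.
rewrite [_ * x ^+ 2]mulrC; case: j {k0} => [|j].
  by rewrite expr0 fact0 invr1 mulr1 -[leLHS]expR0 ler_expR divr_ge0// sqr_ge0.
have x0 : 0 <= (x : R) ^+ 2 / 4 by rewrite divr_ge0// sqr_ge0.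
by rewrite mulrC (le_trans _ (expR_ge1Dxn j x0))// lerDr.
Qed.

End standard_normal.

(** On the left is a coefficient of an even part of a 2m-th power together with the j! of a Gaussian
    moment, on the right a coefficient of an m-th power. Induction on j compares the ratios of
    consecutive terms, which reduces to (2m - 2j - 1) (j + 1) <= 2m (2j + 1). *)
Lemma bin_double_fact (m j : nat) :
  ('C(m.*2, j.*2) * j`! <= 'C(m, j) * m.*2 ^ j)%N.
Proof.
elim: j => [|j IH]; first by rewrite !bin0 fact0 expn0.
case: (ltnP j m) => [jm|mj]; last by rewrite bin_small// ltn_double.
rewrite -(@leq_pmul2r (j.*2.+1 * j.*2.+2))//.
have h1 := mul_bin_left m.*2 j.*2.
have h2 := mul_bin_left m.*2 j.*2.+1.
have h3 := mul_bin_left m j.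
have h4 : ((m.*2 - j.*2.+1) * j.+1 <= m.*2 * j.*2.+1)%N.
  by rewrite leq_mul ?leq_subr// ltnS -addnn leq_addr.
have h5 : ('C(m.*2, j.*2.+2) * (j.*2.+1 * j.*2.+2) =
    'C(m.*2, j.*2) * (2 * (m - j) * (m.*2 - j.*2.+1)))%N.
  transitivity (j.*2.+1 * (j.*2.+2 * 'C(m.*2, j.*2.+2)))%N; first by ring.
  by rewrite h2 mulnCA h1 -doubleB -[(m - j).*2]mul2n; ring.
rewrite doubleS factS.
have -> : ('C(m.*2, j.*2.+2) * (j.+1 * j`!) * (j.*2.+1 * j.*2.+2) =
  'C(m.*2, j.*2) * j`! * (2 * (m - j) * (m.*2 - j.*2.+1) * j.+1))%N.
  by rewrite mulnAC h5; ring.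
apply: (@leq_trans ('C(m, j) * m.*2 ^ j * (2 * (m - j) * (m.*2 - j.*2.+1) * j.+1))).
  by rewrite leq_mul2r IH orbT.
rewrite expnS.
have -> : ('C(m, j.+1) * (m.*2 * m.*2 ^ j) * (j.*2.+1 * j.*2.+2) =
  (j.+1 * 'C(m, j.+1)) * (2 * (m.*2 * j.*2.+1) * m.*2 ^ j))%N.
  by rewrite -doubleS -[j.+1.*2]mul2n; ring.
rewrite h3.
have -> : ('C(m, j) * m.*2 ^ j * (2 * (m - j) * (m.*2 - j.*2.+1) * j.+1) =
  (m - j) * 'C(m, j) * (2 * ((m.*2 - j.*2.+1) * j.+1) * m.*2 ^ j))%N by ring.
by rewrite leq_mul2l leq_mul2r leq_mul2l h4 !orbT.
Qed.

Lemma big_ord_evenodd (V : nmodType) (f : nat -> V) (n : nat) :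
  \sum_(i < n.*2.+1) f i =
  \sum_(j < n.+1) f j.*2 + \sum_(j < n) f j.*2.+1.
Proof.
elim: n => [|n IH]; first by rewrite !big_ord_recr !big_ord0/= !addr0.
rewrite doubleS big_ord_recr big_ord_recr/= IH.
rewrite [in RHS]big_ord_recr/= [\sum_(j < n.+1) f j.*2.+1]big_ord_recr/=.
by rewrite -addrA [X in _ + X = _]addrC addrACA.
Qed.

Lemma exprD_double_sym (R : comRingType) (x y : R) (m : nat) :
  (x + y) ^+ m.*2 + (x - y) ^+ m.*2 =
  (\sum_(j < m.+1) ((x ^+ 2) ^+ (m - j) * (y ^+ 2) ^+ j) *+ 'C(m.*2, j.*2)) *+ 2.
Proof.
rewrite exprDn exprBn -big_split/=.
rewrite (big_ord_evenodd (fun i => (x ^+ (m.*2 - i) * y ^+ i) *+ 'C(m.*2, i) +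
  (-1) ^+ i * x ^+ (m.*2 - i) * y ^+ i *+ 'C(m.*2, i))).
rewrite [X in _ + X]big1 ?addr0 => [|j _]; last first.
  by rewrite -signr_odd /= odd_double expr1 mulN1r mulNr mulNrn subrr.
rewrite -sumrMnl; apply: eq_bigr => j _.
rewrite -signr_odd odd_double expr0 mul1r -mulr2n.
by rewrite -!exprM mulnBr !mul2n.
Qed.

(** In the inductive step the gap between (a x + b y) (a x^n + b y^n) and the right-hand side is a b
    (x - y) (x^n - y^n), whose last two factors have the same sign. *)
Lemma convexX (R : realDomainType) (x y a b : R) (n : nat) :
  0 <= x -> 0 <= y -> 0 <= a -> 0 <= b -> a + b = 1 ->
  (a * x + b * y) ^+ n <= a * x ^+ n + b * y ^+ n.
Proof.
move=> x0 y0 a0 b0 ab; elim: n => [|n IH]; first by rewrite !expr0 !mulr1 ab.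
rewrite exprS; apply: le_trans.
  by apply: ler_wpM2l IH; rewrite addr_ge0// mulr_ge0.
have h : 0 <= a * b * ((x - y) * (x ^+ n - y ^+ n)).
  apply: mulr_ge0; first exact: mulr_ge0.
  have [xy|/ltW xy] := leP x y.
    by rewrite mulr_le0 ?subr_le0// lerXn2r.
  by rewrite mulr_ge0 ?subr_ge0// lerXn2r.
rewrite -subr_ge0; apply: le_trans h _; rewrite le_eqVlt; apply/orP; left.
have -> : b = 1 - a by lra.
by apply/eqP; rewrite !exprS; ring.
Qed.

(** The factor [Num.sqrt 2] is absorbed into the power of 8, so that the bound is exactly 1 at j =
    0; a larger value there would be multiplied at every step of the martingale recursion. *)
Lemma integral_normal_prob_even_moment8 (R : realType) (j : nat) :
  (\int[@normal_prob R 0 1]_x (x ^+ j.*2)%:E <= (8 ^+ j * j`!%:R)%:E)%E.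
Proof.
case: j => [|j].
  rewrite mul1r (eq_integral (cst 1%E))//; last first.
  by rewrite integral_cst//= mul1e probability_setT.
apply: le_trans (integral_normal_prob_even_moment _ _) _.
rewrite lee_fin ler_wpM2r//.
have -> : 8 = 2 * 4 :> R by ring.
rewrite exprMn ler_wpM2r ?exprn_ge0//.
apply: (@le_trans _ _ (2 ^+ 1)); last by rewrite ler_weXn2l// ler1n.
rewrite expr1 -[leRHS]ger0_norm// -sqrtr_sqr ler_wsqrtr//; lra.
Qed.

(** Averaging over y and -y removes the odd powers; in the even ones [bin_double_fact] turns 8^j j!
    C(2m, 2j) into at most C(m, j) (16 m)^j, the coefficients of the m-th power on the right. The
    coefficient 1 of S^2 is what allows iteration. *)
Lemma normal_prob_moment_affine (R : realType) (S B : R) (m : nat) :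
  (\int[@normal_prob R 0 1]_y ((S + y * B) ^+ m.*2)%:E <=
   ((S ^+ 2 + (16 * m%:R) * B ^+ 2) ^+ m)%:E)%E.
Proof.
set nu := normal_prob 0 1.
have mlin : measurable_fun [set: R] (fun y : R => S + y * B).
  by apply: measurable_funD => //; apply: measurable_funM.
have even_ge0 (z : R) : 0 <= z ^+ m.*2 by rewrite -mul2n exprM exprn_ge0// sqr_ge0.
have mf : measurable_fun [set: R] (fun y : R => (2^-1 * (S + y * B) ^+ m.*2)%:E).
  apply/measurable_EFinP; apply: measurable_funM => //.
  exact: measurable_funX.
have mfN : measurable_fun [set: R] (fun y : R => (2^-1 * (S + (- y) * B) ^+ m.*2)%:E).
  by apply: (@measurableT_comp _ _ _ _ _ _ _ _ _ mf); exact: oppr_measurable.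
have -> : (\int[nu]_y ((S + y * B) ^+ m.*2)%:E =
   \int[nu]_y (2^-1 * (S + y * B) ^+ m.*2)%:E +
   \int[nu]_y (2^-1 * (S + (- y)%R * B) ^+ m.*2)%:E)%E.
  rewrite (integral_normal_prob_sym mf); last first.
    by move=> x; rewrite lee_fin mulr_ge0.
  rewrite -ge0_integralD//; last 2 first.
  - by move=> x _; rewrite lee_fin mulr_ge0.
  - by move=> x _; rewrite lee_fin mulr_ge0.
  by apply: eq_integral => y _; rewrite -EFinD; congr EFin; field.
rewrite -ge0_integralD//; last 2 first.
- by move=> x _; rewrite lee_fin mulr_ge0.
- by move=> x _; rewrite lee_fin mulr_ge0.
pose t (j : 'I_m.+1) (y : R) :=
  ((S ^+ 2) ^+ (m - j) * ((y * B) ^+ 2) ^+ j) *+ 'C(m.*2, j.*2).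
have -> : (\int[nu]_y ((2^-1 * (S + y * B) ^+ m.*2)%:E +
    (2^-1 * (S + (- y)%R * B) ^+ m.*2)%:E) =
    \int[nu]_y \sum_(j < m.+1) (t j y)%:E)%E.
  apply: eq_integral => y _; rewrite -EFinD sumEFin; congr EFin.
  rewrite mulNr -mulrDr exprD_double_sym -[X in _ * X]mulr_natl mulrA mulVf ?mul1r//.
rewrite ge0_integral_sum//; last 2 first.
- move=> j; apply/measurable_EFinP.
  rewrite (_ : t j = (fun y : R =>
    ((S ^+ 2) ^+ (m - j) * (((y * B) ^+ 2) ^+ j)) * 'C(m.*2, j.*2)%:R)); last first.
    by apply/funext => y; rewrite /t mulr_natr.
  apply: measurable_funM => //; apply: measurable_funM => //.
  by apply: measurable_funX; apply: measurable_funX; apply: measurable_funM.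
- move=> j y _; rewrite lee_fin mulrn_wge0// mulr_ge0//.
  + by rewrite exprn_ge0// sqr_ge0.
  + by rewrite exprn_ge0// sqr_ge0.
rewrite exprDn -sumEFin; apply: lee_sum => j _.
pose c := (S ^+ 2) ^+ (m - j) * (B ^+ 2) ^+ j * 'C(m.*2, j.*2)%:R.
have c0 : 0 <= c by rewrite !mulr_ge0// exprn_ge0// sqr_ge0.
have tE (y : R) : t j y = c * y ^+ j.*2.
  have h : (y * B) ^+ 2 = y ^+ 2 * B ^+ 2 by ring.
  by rewrite /t /c -mulr_natr -[j.*2]mul2n (exprM y) h (exprMn j (y ^+ 2)); ring.
have -> : (\int[nu]_y (t j y)%:E = \int[nu]_y (c%:E * (y ^+ j.*2)%:E))%E.
  by apply: eq_integral => y _; rewrite -EFinM tE.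
have my : measurable_fun [set: R] (fun y : R => (y ^+ j.*2)%:E).
  by apply/measurable_EFinP; exact: measurable_funX.
have y0 (y : R) : (0 <= (y ^+ j.*2)%:E)%E.
  by rewrite lee_fin -mul2n exprM exprn_ge0// sqr_ge0.
rewrite ge0_integralZl_EFin//.
apply: le_trans.
  by apply: lee_wpmul2l; [rewrite lee_fin|exact: integral_normal_prob_even_moment8].
rewrite -EFinM lee_fin -[leRHS]mulr_natr (exprMn j (16 * m%:R)) /c.
have := bin_double_fact m j; rewrite -(ler_nat R) !natrM natrX => h.
pose d := (S ^+ 2) ^+ (m - j) * (B ^+ 2) ^+ j * 8 ^+ j.
rewrite [leLHS](_ : _ = d * ('C(m.*2, j.*2)%:R * j`!%:R)); last by rewrite /d; ring.
rewrite [leRHS](_ : _ = d * ('C(m, j)%:R * m.*2%:R ^+ j)); last first.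
  have -> : 16 * m%:R = 8 * m.*2%:R :> R by rewrite -mul2n natrM; ring.
  by rewrite (exprMn j 8) /d; ring.
by rewrite ler_wpM2l// /d !mulr_ge0// exprn_ge0// sqr_ge0.
Qed.

(** * Martingale recursion for Gaussian moments *)

Lemma mul_weighted_divK (F : fieldType) (t s b c x y : F) :
  t != 0 -> s != 0 -> b != 0 ->
  x + c * y = t * ((s / t) * (x / s) + (c * b / t) * (y / b)).
Proof. by move=> t0 s0 b0; field; rewrite t0 s0 b0. Qed.

Section filtration.
Context d (T : measurableType d) (R : realType) (P : probability T R).
Variable Y : nat -> T -> R.
Hypothesis mY : forall k, measurable_fun [set: T] (Y k).

(** These are finite rectangles rather than a sigma-algebra: a pi-system on which independence can
    be read off directly, and which generates the sigma-algebra of the first k variables. *)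
Definition past (k : nat) : set (set T) :=
  [set A | exists2 B : nat -> set R, (forall i, measurable (B i)) &
     A = \bigcap_(i in `I_k) (Y i @^-1` B i)].

Definition adapted (k : nat) (W : T -> R) :=
  measurable_fun [set: g_sigma_algebraType (past k)]
    (W : g_sigma_algebraType (past k) -> R).

Lemma pastI k : setI_closed (past k).
Proof.
move=> _ _ [B mB ->] [C mC ->]; exists (fun i => B i `&` C i).
  by move=> i; exact: measurableI.
by rewrite -bigcapI; apply: eq_bigcapr => i _; rewrite preimage_setI.
Qed.

Lemma pastT k : past k setT.
Proof.
exists (fun _ => setT) => //.
by rewrite bigcapT// => i _; rewrite preimage_setT.
Qed.

Lemma past_measurable k : past k `<=` @measurable _ T.
Proof.
move=> _ [B mB ->]; apply: fin_bigcap_measurable; first exact: finite_II.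
by move=> i _; rewrite -[_ @^-1` _]setTI; exact: mY.
Qed.

Lemma past_leq k k' : (k <= k')%N -> past k `<=` past k'.
Proof.
move=> kk' _ [B mB ->].
exists (fun i => if (i < k)%N then B i else setT); first by move=> i; case: ifP.
apply/seteqP; split=> w /= h i ik.
  by case: ifP => //= ?; exact: h.
by have /= := h i (leq_trans ik kk'); rewrite ik.
Qed.

Lemma adapted_leq k k' W : (k <= k')%N -> adapted k W -> adapted k' W.
Proof.
move=> kk' aW _ B mB; have := aW measurableT B mB.
rewrite !setTI; exact: (sub_sigma_algebra2 (past_leq kk')).
Qed.

Lemma adapted_gen i k : (i < k)%N -> adapted k (Y i).
Proof.
move=> ik _ B mB; apply: sub_sigma_algebra; rewrite setTI.
exists (fun j => if j == i then B else setT); first by move=> j; case: ifP.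
apply/seteqP; split => w /=.
  by move=> Bw j _; case: eqP => // ->.
by move=> /(_ i ik)/=; rewrite eqxx.
Qed.

Lemma adapted_measurable k W : adapted k W -> measurable_fun [set: T] W.
Proof.
move=> aW _ B mB; have := aW measurableT B mB.
apply: smallest_sub => //; last exact: past_measurable.
exact: sigma_algebra_measurable.
Qed.

Lemma adapted_cst k (c : R) : adapted k (cst c).
Proof. exact: measurable_cst. Qed.

Lemma adaptedD k V W : adapted k V -> adapted k W -> adapted k (V \+ W).
Proof. exact: measurable_funD. Qed.

Lemma adaptedM k V W : adapted k V -> adapted k W -> adapted k (V \* W).
Proof. exact: measurable_funM. Qed.

Lemma adapted_sum (I : Type) (s : seq I) (Q : pred I) k (W : I -> T -> R) :
  (forall i, Q i -> adapted k (W i)) ->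
  adapted k (fun w => \sum_(i <- s | Q i) W i w).
Proof.
move=> aW; elim: s => [|i s IH].
  rewrite (_ : (fun _ => _) = cst 0); first exact: adapted_cst.
  by apply/funext => w; rewrite big_nil.
rewrite (_ : (fun _ => _) = if Q i
  then W i \+ (fun w => \sum_(j <- s | Q j) W j w)
  else (fun w => \sum_(j <- s | Q j) W j w)).
  by case: ifP => [/aW aWi|_]; [exact: adaptedD|].
by apply/funext => w; rewrite big_cons; case: ifP.
Qed.

Hypothesis indepY : forall n (B : nat -> set R), (forall i, measurable (B i)) ->
  P (\bigcap_(i in `I_n) (Y i @^-1` B i)) = (\prod_(i < n) P (Y i @^-1` B i))%E.
Hypothesis lawY : forall k (B : set R), measurable B ->
  P (Y k @^-1` B) = normal_prob 0 1 B.

(** As functions of A, both sides are finite measures that agree on the pi-system [past k], hence on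
    the sigma-algebra it generates. *)
Lemma past_indep k (A : set T) (B : set R) : <<s past k >> A -> measurable B ->
  P (A `&` (Y k @^-1` B)) = (P A * normal_prob 0 1 B)%E.
Proof.
move=> sA mB.
have mYB : measurable (Y k @^-1` B) by rewrite -[_ @^-1` _]setTI; exact: mY.
pose c := fine (P (Y k @^-1` B)).
have cE : c%:E = P (Y k @^-1` B) by rewrite /c fineK// fin_num_measure.
have c0 : 0 <= c by rewrite fine_ge0.
pose m2 := mscale (NngNum c0) P.
rewrite -(lawY k mB) -cE muleC.
transitivity (m2 A); last by [].
apply: (g_sigma_algebra_measure_unique (past k) _ (fun=> setT) _ _ (mrestr P mYB) m2) => //.
- exact: past_measurable.
- by move=> _; exact: pastT.
- by rewrite bigcup_const//; exists 0%N.
- exact: pastI.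
- move=> _ [C mC ->]; rewrite /mrestr -[RHS]/(c%:E * P _)%E cE.
  pose D i := if (i < k)%N then C i else B.
  have mD i : measurable (D i) by rewrite /D; case: ifP.
  have := indepY k.+1 mD; rewrite big_ord_recr/= {3}/D ltnn.
  rewrite (eq_bigr (fun i : 'I_k => P (Y i @^-1` C i))); last first.
    by move=> i _; rewrite /D ltn_ord.
  rewrite -indepY// muleC => <-; congr (P _).
  apply/seteqP; split => w /=.
    move=> [h1 h2] i /=; rewrite ltnS leq_eqVlt => /predU1P[->|ik].
      by rewrite /D ltnn.
    by have := h1 _ ik; rewrite /D/= ik.
  move=> h; split; last by have := h k (ltnSn k); rewrite /D ltnn.
  by move=> i /= ik; have := h i (ltnW ik); rewrite /D ik.
- move=> i; rewrite -[ltLHS]/(P ([set: T] `&` _)) setTI.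
  by rewrite ltey_eq fin_num_measure.
Qed.

Lemma measurable_id_past k :
  measurable_fun [set: T] (id : T -> g_sigma_algebraType (past k)).
Proof.
move=> _ B mB; rewrite setTI preimage_id.
apply: smallest_sub mB; last exact: past_measurable.
exact: sigma_algebra_measurable.
Qed.

Lemma measurable_past_integral k
    (f : g_sigma_algebraType (past k) * measurableTypeR R -> \bar R) :
  measurable_fun [set: (g_sigma_algebraType (past k) * measurableTypeR R)%type] f ->
  (forall z, 0 <= f z)%E ->
  measurable_fun [set: T] (fun w => \int[@normal_prob R 0 1]_y f (w, y))%E.
Proof.
move=> mf f0; pose nu : probability (measurableTypeR R) R := @normal_prob R 0 1.
have h : measurable_fun setT (fubini_F nu f).
  exact: measurable_fun_fubini_tonelli_F.
exact: (measurableT_comp h (@measurable_id_past k)).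
Qed.

(** The identity map, from T to T with the coarser sigma-algebra of the past, is a random variable
    [X]. By [past_indep] the joint law of [X] and [Y k] is a product, so Tonelli's theorem
    integrates the new variable on its own; this stands in for a conditional expectation. *)
Lemma integral_past_next k (f : g_sigma_algebraType (past k) * measurableTypeR R -> \bar R) :
  measurable_fun [set: (g_sigma_algebraType (past k) * measurableTypeR R)%type] f ->
  (forall z, 0 <= f z)%E ->
  (\int[P]_w f (w, Y k w) = \int[P]_w \int[normal_prob 0 1]_y f (w, y))%E.
Proof.
move=> mf f0; pose Tk := g_sigma_algebraType (past k).
have mid := @measurable_id_past k; rewrite -/Tk in mid.
have mphi : measurable_fun [set: T] (fun w => (w, Y k w) : Tk * measurableTypeR R).
  have mYk : measurable_fun [set: T] (Y k : T -> measurableTypeR R) by exact: mY.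
  exact: (measurable_fun_pair mid mYk).
pose X : {mfun T >-> Tk} := HB.pack (id : T -> Tk)
  (isMeasurableFun.Build _ _ _ _ (id : T -> Tk) mid).
pose Z : {mfun T >-> (Tk * measurableTypeR R)%type} := HB.pack (fun w => (w, Y k w) : Tk * measurableTypeR R)
  (isMeasurableFun.Build _ _ _ _ (fun w => (w, Y k w) : Tk * measurableTypeR R) mphi).
transitivity (\int[distribution P Z]_z f z)%E.
  by rewrite ge0_integral_distribution.
pose nu : probability (measurableTypeR R) R := @normal_prob R 0 1.
transitivity (\int[(distribution P X) \x nu]_z f z)%E.
  apply: (@eq_measure_integral _ _ _ _ ((distribution P X) \x nu)%E) => A mA _; apply/esym.
  apply: product_measure_unique => // B C mB mC.
  exact: (past_indep mB mC).
rewrite fubini_tonelli1// ge0_integral_distribution//.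
- exact: measurable_fun_fubini_tonelli_F.
- by move=> y; exact: integral_ge0.
Qed.

(** With the past frozen, [S] and [B] are constants and [normal_prob_moment_affine] applies to the
    variable [Y k] alone. *)
Lemma moment_step k m (S B : T -> R) (sigma beta : R) :
  0 < sigma -> 0 < beta -> adapted k S -> adapted k B ->
  (\int[P]_w (S w ^+ m.*2)%:E <= (sigma ^+ m)%:E)%E ->
  (\int[P]_w (B w ^+ m.*2)%:E <= (beta ^+ m)%:E)%E ->
  (\int[P]_w ((S w + Y k w * B w) ^+ m.*2)%:E <=
   ((sigma + 16 * m%:R * beta) ^+ m)%:E)%E.
Proof.
move=> s0 b0 aS aB hS hB; pose Tk := g_sigma_algebraType (past k).
have even_ge0 (z : R) : 0 <= z ^+ m.*2.
  by rewrite -mul2n exprM exprn_ge0// sqr_ge0.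
pose f (z : Tk * measurableTypeR R) := ((S z.1 + z.2 * B z.1) ^+ m.*2)%:E.
have mf : measurable_fun [set: (Tk * measurableTypeR R)%type] f.
  apply/measurable_EFinP; apply: measurable_funX; apply: measurable_funD.
    exact: (measurableT_comp aS).
  by apply: measurable_funM => //; exact: (measurableT_comp aB).
rewrite (integral_past_next mf); last by move=> z; rewrite lee_fin.
have mS := adapted_measurable aS; have mB := adapted_measurable aB.
set c := 16 * m%:R; have c0 : 0 <= c by rewrite mulr_ge0.
set t := sigma + c * beta; have t0 : 0 < t by rewrite ltr_wpDr ?mulr_ge0// ltW.
(* Convexity of x^m with the weights sigma / t and c * beta / t replaces
   Minkowski's inequality. *)
pose a := t ^+ m * (sigma / t) / sigma ^+ m.
pose b := t ^+ m * (c * beta / t) / beta ^+ m.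
have a0 : 0 <= a by rewrite /a !mulr_ge0 ?invr_ge0 ?exprn_ge0// ltW.
have b0' : 0 <= b by rewrite /b !mulr_ge0 ?invr_ge0 ?exprn_ge0// ltW.
have mSE : measurable_fun [set: T] (fun w => (S w ^+ m.*2)%:E).
  by apply/measurable_EFinP; exact: measurable_funX.
have mBE : measurable_fun [set: T] (fun w => (B w ^+ m.*2)%:E).
  by apply/measurable_EFinP; exact: measurable_funX.
apply: (@le_trans _ _ (\int[P]_w (a%:E * (S w ^+ m.*2)%:E + b%:E * (B w ^+ m.*2)%:E))%E).
  apply: ge0_le_integral => //.
  - by move=> w _; apply: integral_ge0 => y _; rewrite lee_fin.
  - by apply: (measurable_past_integral mf) => z; rewrite lee_fin.
  - by apply: emeasurable_funD; exact: measurable_funeM.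
  move=> w _; apply: (le_trans (normal_prob_moment_affine (S w) (B w) m)).
  rewrite -!EFinM -EFinD lee_fin -/c.
  have -> : S w ^+ 2 + c * B w ^+ 2 =
     t * ((sigma / t) * (S w ^+ 2 / sigma) + (c * beta / t) * (B w ^+ 2 / beta)).
    by apply: mul_weighted_divK; rewrite gt_eqF//.
  rewrite exprMn -!mul2n !exprM.
  apply: (@le_trans _ _ (t ^+ m * (sigma / t * (S w ^+ 2 / sigma) ^+ m +
     (c * beta / t) * (B w ^+ 2 / beta) ^+ m))).
    apply: ler_wpM2l; first by rewrite exprn_ge0// ltW.
    have s0' := ltW s0; have b0'' := ltW b0; have t0' := ltW t0.
    apply: convexX.
    - by rewrite divr_ge0 ?sqr_ge0.
    - by rewrite divr_ge0 ?sqr_ge0.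
    - by rewrite divr_ge0.
    - by rewrite divr_ge0 ?mulr_ge0.
    - by rewrite -mulrDl divff// gt_eqF.
  rewrite !expr_div_n /a /b le_eqVlt; apply/orP; left; apply/eqP; ring.
rewrite ge0_integralD//; last 4 first.
- by move=> w _; rewrite mule_ge0 ?lee_fin.
- exact: measurable_funeM.
- by move=> w _; rewrite mule_ge0 ?lee_fin.
- exact: measurable_funeM.
rewrite !ge0_integralZl_EFin//; try by move=> w _; rewrite lee_fin.
apply: (@le_trans _ _ (a%:E * (sigma ^+ m)%:E + b%:E * (beta ^+ m)%:E)%E).
  by apply: leeD; apply: lee_wpmul2l; rewrite ?lee_fin.
rewrite -!EFinM -EFinD lee_fin /a /b !divfK ?gt_eqF ?exprn_gt0//.
by rewrite -mulrDr -mulrDl mulfV ?gt_eqF// mulr1.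
Qed.

End filtration.

(** * Moment bounds for linear and quadratic expressions along the filtration *)

Section moments.
Context d (T : measurableType d) (R : realType) (P : probability T R).
Variable Y : nat -> T -> R.
Hypothesis mY : forall k, measurable_fun [set: T] (Y k).
Hypothesis indepY : forall n (B : nat -> set R), (forall i, measurable (B i)) ->
  P (\bigcap_(i in `I_n) (Y i @^-1` B i)) = (\prod_(i < n) P (Y i @^-1` B i))%E.
Hypothesis lawY : forall k (B : set R), measurable B ->
  P (Y k @^-1` B) = normal_prob 0 1 B.
Local Notation adapted := (adapted Y).

(* The constant c bounds the square of the L^(2m) norm. *)
Definition moment_le (m : nat) (W : T -> R) (c : R) :=
  (\int[P]_w (W w ^+ m.*2)%:E <= (c ^+ m)%:E)%E.

Lemma exprn_double_ge0 (z : R) m : 0 <= z ^+ m.*2.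
Proof. by rewrite -mul2n exprM exprn_ge0// sqr_ge0. Qed.

Lemma measurable_expr_double (W : T -> R) m : measurable_fun [set: T] W ->
  measurable_fun [set: T] (fun w => (W w ^+ m.*2)%:E).
Proof. by move=> mW; apply/measurable_EFinP; exact: measurable_funX. Qed.

Lemma moment_le_cst0 m c : 0 <= c -> moment_le m (cst 0) c.
Proof.
move=> c0; rewrite /moment_le -[leLHS]/(\int[P]_w (cst ((0 : R) ^+ m.*2)%:E w))%E.
rewrite integral_cst//= probability_setT mule1 lee_fin.
case: m => [|m]; first by rewrite !expr0.
by rewrite expr0n exprn_ge0.
Qed.

Lemma moment_le_leq m W c c' : 0 <= c -> c <= c' -> moment_le m W c ->
  moment_le m W c'.
Proof.
move=> c0 cc' h; apply: (le_trans h); rewrite lee_fin lerXn2r// nnegrE//.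
exact: le_trans cc'.
Qed.

Lemma moment_leZ m W a c : measurable_fun [set: T] W -> moment_le m W c ->
  moment_le m (fun w => a * W w) (a ^+ 2 * c).
Proof.
move=> mW h; rewrite /moment_le.
under eq_integral do rewrite exprMn EFinM.
rewrite ge0_integralZl_EFin ?exprn_double_ge0//; last 2 first.
- by move=> w _; rewrite lee_fin exprn_double_ge0.
- exact: measurable_expr_double.
rewrite exprMn -exprM mul2n EFinM.
by apply: lee_wpmul2l => //; rewrite lee_fin exprn_double_ge0.
Qed.

(** The 4 comes from bounding (x + y)^2 by the mean of (2x)^2 and (2y)^2 before convexity is used.
    No independence is required, but a constant is lost. *)
Lemma moment_leD m V W a b : measurable_fun [set: T] V ->
  measurable_fun [set: T] W -> 0 <= a -> 0 <= b ->
  moment_le m V a -> moment_le m W b ->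
  moment_le m (fun w => V w + W w) (4 * (a + b)).
Proof.
move=> mV mW a0 b0 hV hW.
pose h : R := 2^-1.
have key (x y : R) :
    (x + y) ^+ m.*2 <= 4 ^+ m * (h * x ^+ m.*2 + h * y ^+ m.*2).
  have e (z : R) : 4 ^+ m * z ^+ m.*2 = ((2 * z) ^+ 2) ^+ m.
    by rewrite -[in LHS]mul2n exprM -exprMn; congr (_ ^+ m); ring.
  rewrite mulrDr !(mulrCA _ h) !e.
  apply: (@le_trans _ _ ((h * (2 * x) ^+ 2 + h * (2 * y) ^+ 2) ^+ m)); last first.
    by apply: convexX; rewrite ?sqr_ge0 ?invr_ge0//; rewrite /h; field.
  rewrite -mul2n exprM; apply: lerXn2r.
  - by rewrite nnegrE sqr_ge0.
  - by rewrite nnegrE addr_ge0// mulr_ge0 ?invr_ge0 ?sqr_ge0.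
  - by rewrite /h; have := sqr_ge0 (x - y); rewrite !expr2; lra.
have h0 : 0 <= h by rewrite invr_ge0.
apply: (@le_trans _ _ (\int[P]_w ((4 ^+ m * h)%:E * (V w ^+ m.*2)%:E +
    (4 ^+ m * h)%:E * (W w ^+ m.*2)%:E))%E).
  apply: ge0_le_integral => //.
  - by move=> w _; rewrite lee_fin exprn_double_ge0.
  - by apply: measurable_expr_double; exact: measurable_funD.
  - by apply: emeasurable_funD; apply: measurable_funeM; exact: measurable_expr_double.
  - by move=> w _; rewrite -!EFinM -EFinD lee_fin; have := key (V w) (W w); lra.
have c0 : 0 <= 4 ^+ m * h by rewrite mulr_ge0// exprn_ge0.
rewrite ge0_integralD//; last 4 first.
- by move=> w _; rewrite mule_ge0// lee_fin// exprn_double_ge0.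
- by apply: measurable_funeM; exact: measurable_expr_double.
- by move=> w _; rewrite mule_ge0// lee_fin// exprn_double_ge0.
- by apply: measurable_funeM; exact: measurable_expr_double.
rewrite !ge0_integralZl_EFin//; try by [move=> w _; rewrite lee_fin exprn_double_ge0|exact: measurable_expr_double].
apply: (@le_trans _ _ ((4 ^+ m * h)%:E * (a ^+ m)%:E + (4 ^+ m * h)%:E * (b ^+ m)%:E)%E).
  by apply: leeD; apply: lee_wpmul2l; rewrite ?lee_fin.
rewrite -!EFinM -EFinD lee_fin exprMn -mulrDr -mulrA ler_wpM2l ?exprn_ge0//.
apply: (@le_trans _ _ (h * ((a + b) ^+ m + (a + b) ^+ m))).
  by rewrite ler_wpM2l// lerD// lerXn2r ?nnegrE ?addr_ge0// ?lerDl ?lerDr.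
by rewrite /h; lra.
Qed.

Lemma integral_gauss k (f : R -> \bar R) : measurable_fun [set: R] f ->
  (forall x, 0 <= f x)%E ->
  (\int[P]_w f (Y k w) = \int[normal_prob 0 1]_y f y)%E.
Proof.
move=> mf f0.
have := @integral_past_next _ _ _ P Y mY indepY lawY k (fun z => f z.2).
move=> -> //; last exact: (measurableT_comp (mf : measurable_fun [set: measurableTypeR R] f)).
by rewrite -[RHS]mule1 -(@probability_setT _ _ _ P) -integral_cst.
Qed.

Lemma moment_le_gauss k m : moment_le m (Y k) (8 * m%:R).
Proof.
rewrite /moment_le (@integral_gauss k (fun y => (y ^+ m.*2)%:E)); last 2 first.
- by apply/measurable_EFinP; exact: measurable_funX.
- by move=> x; rewrite lee_fin exprn_double_ge0.
apply: le_trans (integral_normal_prob_even_moment8 _ _) _.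
rewrite lee_fin exprMn ler_wpM2l ?exprn_ge0// -natrX ler_nat.
elim: m => [//|m IH]; rewrite factS expnS leq_mul// (leq_trans IH)//.
by case: m {IH} => // m; rewrite leq_exp2r.
Qed.

(** The moment of order 2m of a square is the moment of order 4m of the variable, so
    [moment_le_gauss] is taken at 2m, where 8 * 2m = 16m. *)
Lemma moment_le_gauss_sq k m : moment_le m (fun w => Y k w ^+ 2) (16 ^+ 2 * m%:R ^+ 2).
Proof.
have := moment_le_gauss k m.*2; rewrite /moment_le.
under [in X in _ -> X]eq_integral do rewrite -exprM mul2n.
move=> /le_trans; apply; rewrite lee_fin -[in X in X <= _]mul2n [leLHS]exprM.
by rewrite mul2n -mul2n natrM; rewrite (_ : (_ * _) ^+ 2 = 16 ^+ 2 * m%:R ^+ 2 :> R)//; ring.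
Qed.

(** Iterates [moment_step], [f] listing the variables in the order in which they are revealed. The
    empty sum is 0, yet the recursion starts from some [s0] > 0 because [moment_step] divides by the
    bound already reached. *)
Lemma moment_le_sum m n (f : nat -> nat) (B : nat -> T -> R) (beta : nat -> R)
    (s0 : R) :
  0 < s0 -> {homo f : i j / (i < j)%N} ->
  (forall t, (t < n)%N -> adapted (f t) (B t)) -> (forall t, 0 < beta t) ->
  (forall t, (t < n)%N -> moment_le m (B t) (beta t)) ->
  adapted (f n) (fun w => \sum_(t < n) Y (f t) w * B t w) /\
  moment_le m (fun w => \sum_(t < n) Y (f t) w * B t w)
    (s0 + 16 * m%:R * \sum_(t < n) beta t).
Proof.
move=> s00 fi aB b0 hB.
suff H q : (q <= n)%N -> adapted (f q) (fun w => \sum_(t < q) Y (f t) w * B t w) /\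
  moment_le m (fun w => \sum_(t < q) Y (f t) w * B t w)
    (s0 + 16 * m%:R * \sum_(t < q) beta t) by exact: H.
elim: q => [_|q IH qn].
  rewrite (_ : (fun _ => _) = cst 0); last by apply/funext => w; rewrite big_ord0.
  split; first exact: adapted_cst.
  by rewrite big_ord0 mulr0 addr0; apply: moment_le_cst0; exact: ltW.
have [aS hS] := IH (ltnW qn).
rewrite (_ : (fun _ => _) = (fun w => \sum_(t < q) Y (f t) w * B t w + Y (f q) w * B q w)); last first.
  by apply/funext => w; rewrite big_ord_recr.
have fq : (f q < f q.+1)%N by exact: fi.
split.
  apply: adaptedD; first exact: adapted_leq (ltnW fq) aS.
  apply: adaptedM; first exact: adapted_gen.
  by apply: adapted_leq (ltnW fq) _; exact: aB.
rewrite big_ord_recr/= mulrDr addrA.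
apply: moment_step => //; last exact: hB; last exact: aB.
by rewrite ltr_wpDr// mulr_ge0// sumr_ge0// => t _; exact: ltW.
Qed.

(** Each product is a martingale increment whose later variable is [Y (f t)]; the order of the two
    variables matters only where the coefficient is nonzero. The weights [e] dominate the q^2 and
    are strictly positive, as the recursion demands even for vanishing coefficients. *)
Lemma moment_le_pairs m n (f h : nat -> nat) (q e : nat -> R) (D : R) :
  (0 < m)%N -> {homo f : i j / (i < j)%N} ->
  (forall t, (t < n)%N -> q t != 0 -> (h t < f t)%N) ->
  (forall t, 0 < e t) -> (forall t, (t < n)%N -> q t ^+ 2 <= e t) ->
  \sum_(t < n) e t <= D -> 0 < D ->
  moment_le m (fun w => \sum_(t < n) q t * (Y (f t) w * Y (h t) w))
    (16 ^+ 2 * m%:R ^+ 2 * D).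
Proof.
move=> m0 fi hf e0 qe eD D0.
have m1 : 1 <= m%:R :> R by rewrite ler1n.
have mR0 : 0 < m%:R :> R by rewrite ltr0n.
pose B t w := q t * Y (h t) w.
have hB t : (t < n)%N -> moment_le m (B t) (e t * (8 * m%:R)).
  move=> tn; apply: (@moment_le_leq _ _ (q t ^+ 2 * (8 * m%:R))).
  - by rewrite mulr_ge0 ?sqr_ge0// mulr_ge0.
  - by rewrite ler_wpM2r ?mulr_ge0// qe.
  - exact: moment_leZ (moment_le_gauss _ _).
have aB t : (t < n)%N -> adapted (f t) (B t).
  move=> tn; have [q0|q0] := eqVneq (q t) 0.
    rewrite (_ : B t = cst 0); first exact: adapted_cst.
    by apply/funext => w; rewrite /B q0 mul0r.
  apply: adaptedM; first exact: adapted_cst.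
  by apply: adapted_gen; exact: hf.
(* The starting value takes half of the target 256 m^2 D; the increments take the other half, 16 m *
   8 m * D. *)
have s00 : 0 < 128 * m%:R ^+ 2 * D by rewrite !mulr_gt0// exprn_gt0.
have := @moment_le_sum m n f B (fun t => e t * (8 * m%:R)) _ s00 fi aB.
move=> /(_ _ hB)[]; first by move=> t; rewrite !mulr_gt0.
move=> _; rewrite -mulr_suml.
rewrite (_ : (fun w => \sum_(t < n) Y (f t) w * B t w) =
  fun w => \sum_(t < n) q t * (Y (f t) w * Y (h t) w)); last first.
  by apply/funext => w; apply: eq_bigr => t _; rewrite /B mulrCA.
apply: moment_le_leq.
  rewrite addr_ge0 ?(ltW s00)// !mulr_ge0// sumr_ge0// => t _; exact: ltW.
have : m%:R ^+ 2 * \sum_(t < n) e t <= m%:R ^+ 2 * D.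
  by rewrite ler_wpM2l// sqr_ge0.
rewrite !expr2; lra.
Qed.

Lemma sum_ord_rev (V : nmodType) n (G : nat -> V) :
  \sum_(i < n) G i = \sum_(i < n) G (n - i.+1)%N.
Proof. by rewrite (reindex_inj rev_ord_inj). Qed.

(* Y i.*2 and Y i.*2.+1 stand for the real and imaginary parts of the
   frequency i + 1, so that i and k - (i + 1) index frequencies adding up
   to k + 1, and quadI and quadJ are the imaginary and real parts of the
   quadratic convolution. *)
Definition quadI (Psi : nat -> nat -> R) k w := \sum_(i < k) Psi i (k - i.+1)%N *
  (Y i.*2 w * Y (k - i.+1).*2.+1 w + Y i.*2.+1 w * Y (k - i.+1).*2 w).

Definition quadJ (Psi : nat -> nat -> R) k w := \sum_(i < k) Psi i (k - i.+1)%N *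
  (Y i.*2 w * Y (k - i.+1).*2 w - Y i.*2.+1 w * Y (k - i.+1).*2.+1 w).

Lemma adapted_quadI Psi k : adapted k.*2 (quadI Psi k).
Proof.
apply: adapted_sum => i _; apply: adaptedM; first exact: adapted_cst.
have := ltn_ord i => ik.
by apply: adaptedD; apply: adaptedM; apply: adapted_gen; lia.
Qed.

Lemma adapted_quadJ Psi k : adapted k.*2 (quadJ Psi k).
Proof.
apply: adapted_sum => i _; apply: adaptedM; first exact: adapted_cst.
have := ltn_ord i => ik.
apply: adaptedD; first by apply: adaptedM; apply: adapted_gen; lia.
apply: (measurableT_comp (@oppr_measurable _ setT)).
by apply: adaptedM; apply: adapted_gen; lia.
Qed.

Lemma measurable_lin2 k (c : 'I_k -> R) (f h : 'I_k -> nat) :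
  measurable_fun [set: T] (fun w => \sum_(t < k) c t * (Y (f t) w * Y (h t) w)).
Proof.
apply: measurable_sum => t; apply: measurable_funM => //.
exact: measurable_funM.
Qed.

(** * Moments of the quadratic convolutions *)

Section quadratic_forms.
Variables (Psi : nat -> nat -> R) (e : nat -> R) (g : nat -> R) (Z : R).
Hypothesis Psi_sym : forall i j, Psi i j = Psi j i.
Hypothesis e_gt0 : forall i, 0 < e i.
Hypothesis g_gt0 : forall i, 0 < g i.
Hypothesis Z_gt0 : 0 < Z.
Hypothesis sum_e : forall n, \sum_(i < n) e i <= Z.
Hypothesis Psi_le : forall i j, (i <= j)%N -> Psi i j ^+ 2 <= e i * g (i + j).+1.

(** The constant of [moment_le_pairs] with D = 4 g(k) Z, where 4 is the square of the 2 that
    accounts for both orders of a pair of frequencies. *)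
Definition quad_bound m k : R := 16 ^+ 2 * m%:R ^+ 2 * (4 * g k * Z).

Lemma quad_bound_ge0 m k : 0 <= quad_bound m k.
Proof. by rewrite /quad_bound !mulr_ge0// ?exprn_ge0// ltW. Qed.

(** The convolution meets each pair of frequencies twice. Only the occurrence with the larger
    frequency at t is kept, with doubled coefficient, so that the later variable increases with t.
    The relation [b] decides whether the diagonal is included, and p and q choose real or imaginary
    parts. *)
Lemma moment_le_half m k (p q : nat) (b : rel nat) : (0 < m)%N ->
  (forall t, b (k - t.+1)%N t -> (t < k)%N ->
     (k - t.+1 <= t)%N && ((k - t.+1).*2 + p < t.*2 + q)%N) ->
  moment_le m (fun w => \sum_(t < k)
    (if b (k - t.+1)%N t then 2 * Psi t (k - t.+1) else 0) *
      (Y (t.*2 + q)%N w * Y ((k - t.+1).*2 + p)%N w))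
    (quad_bound m k).
Proof.
move=> m0 hb.
apply: (moment_le_pairs (f := fun t => (t.*2 + q)%N) (h := fun t => ((k - t.+1).*2 + p)%N)
  (q := fun t => if b (k - t.+1)%N t then 2 * Psi t (k - t.+1) else 0)
  (e := fun t => 4 * g k * e (k - t.+1)%N)) => //.
- by move=> i j ij; rewrite ltn_add2r ltn_double.
- by move=> t tk /=; case: ifP => [bt _|]; [case/andP: (hb _ bt tk)|rewrite eqxx].
- by move=> t; rewrite !mulr_gt0.
- move=> t tk; case: ifP => [bt|_]; last by rewrite expr0n/= !mulr_ge0// ltW.
  have /andP[h1 _] := hb _ bt tk.
  have := Psi_le h1; rewrite Psi_sym (_ : (k - t.+1 + t).+1 = k)%N; last by lia.
  by rewrite exprMn; lra.
- rewrite -mulr_sumr -(sum_ord_rev k e) ler_wpM2l// mulr_ge0//; exact: ltW.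
- by rewrite !mulr_gt0.
Qed.

(** Each product pairs a real with an imaginary part, so its two variables differ even when the
    frequencies coincide. The diagonal is given to the half in which the imaginary part is the later
    variable. *)
Lemma moment_le_quadI m k : (0 < m)%N ->
  moment_le m (quadI Psi k) (8 * quad_bound m k).
Proof.
move=> m0.
rewrite [X in moment_le _ _ X](_ : _ = 4 * (quad_bound m k + quad_bound m k)); last by ring.
have b1 t : (k - t.+1 <= t)%N -> (t < k)%N ->
  (k - t.+1 <= t)%N && ((k - t.+1).*2 + 0 < t.*2 + 1)%N by lia.
have b2 t : (k - t.+1 < t)%N -> (t < k)%N ->
  (k - t.+1 <= t)%N && ((k - t.+1).*2 + 1 < t.*2 + 0)%N by lia.
have h1 := @moment_le_half m k 0 1 (fun i j => (i <= j)%N) m0 b1.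
have h2 := @moment_le_half m k 1 0 (fun i j => (i < j)%N) m0 b2.
have c0 := quad_bound_ge0 m k.
have := moment_leD _ _ c0 c0 h1 h2.
move=> /(_ (measurable_lin2 _ _ _) (measurable_lin2 _ _ _)).
rewrite (_ : (fun w => _ + _) = quadI Psi k)//.
apply/funext => w; rewrite /quadI.
under [RHS]eq_bigr do rewrite mulrDr.
rewrite big_split/=.
rewrite [X in _ = X + _](sum_ord_rev k (fun i => Psi i (k - i.+1) * (Y i.*2 w * Y (k - i.+1).*2.+1 w))).
rewrite [X in _ + X = _](_ : _ = \sum_(t < k) (if (t < k - t.+1)%N
  then 2 * Psi t (k - t.+1) * (Y t.*2.+1 w * Y (k - t.+1).*2 w) else 0)); last first.
  rewrite (reindex_inj rev_ord_inj)/=.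
  apply: eq_bigr => i _; have ik := ltn_ord i.
  rewrite (_ : k - (k - i.+1).+1 = i)%N; last by lia.
  by case: ifP => _; rewrite ?mul0r// addn0 addn1 Psi_sym (mulrC (Y _ _)).
rewrite -!big_split/=; apply: eq_bigr => i _; have ik := ltn_ord i.
rewrite (_ : k - (k - i.+1).+1 = i)%N; last by lia.
rewrite addn1 addn0 (Psi_sym (k - i.+1)) (mulrC (Y (k - i.+1).*2 w)).
rewrite ltnNge; case: (k - i.+1 <= i)%N => /=; ring.
Qed.

(** Here the diagonal is the square of a single variable, which is not a martingale increment. There
    is at most one such term, and it is estimated directly by a moment of order 4m. *)
Lemma moment_le_quadJ_part m k p : (0 < m)%N ->
  moment_le m (fun w => \sum_(i < k) Psi i (k - i.+1) *
    (Y (i.*2 + p)%N w * Y ((k - i.+1).*2 + p)%N w))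
    (8 * quad_bound m k).
Proof.
move=> m0; have c0 := quad_bound_ge0 m k.
rewrite [X in moment_le _ _ X](_ : _ = 4 * (quad_bound m k + quad_bound m k)); last by ring.
have b1 t : (k - t.+1 < t)%N -> (t < k)%N ->
  (k - t.+1 <= t)%N && ((k - t.+1).*2 + p < t.*2 + p)%N by lia.
have h1 := @moment_le_half m k p p (fun i j => (i < j)%N) m0 b1.
pose c (t : nat) := if t == (k - t.+1)%N then Psi t (k - t.+1) else 0.
have h2 : moment_le m (fun w => \sum_(t < k) c t *
     (Y (t.*2 + p)%N w * Y ((k - t.+1).*2 + p)%N w)) (quad_bound m k).
  (* A diagonal term t = k - (t + 1) exists only when k = 2t + 1. *)
  have [ok|ek] := boolP (odd k); last first.
    rewrite (_ : (fun _ => _) = cst 0); first exact: moment_le_cst0.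
    apply/funext => w; apply: big1 => i _; rewrite /c; case: eqP; rewrite ?mul0r//.
    by move: (ltn_ord i); lia.
  have kk : (k./2 < k)%N by lia.
  have ke : (k - k./2.+1)%N = k./2 by lia.
  rewrite (_ : (fun _ => _) = fun w => Psi k./2 k./2 * (Y (k./2.*2 + p)%N w) ^+ 2).
    have me : measurable_fun [set: T] (fun w => Y (k./2.*2 + p)%N w ^+ 2).
      exact: measurable_funX.
    apply: moment_le_leq (moment_leZ _ me (moment_le_gauss_sq _ _)).
      by rewrite mulr_ge0 ?sqr_ge0// mulr_ge0 ?sqr_ge0.
    have := Psi_le (leqnn k./2); rewrite (_ : (k./2 + k./2).+1 = k); last by lia.
    have eZ : e k./2 <= Z.
      apply: le_trans (sum_e k./2.+1); rewrite big_ord_recr/= lerDr.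
      by rewrite sumr_ge0// => i _; exact: ltW.
    move=> h; have h' : Psi k./2 k./2 ^+ 2 <= Z * g k.
      by apply: (le_trans h); rewrite ler_wpM2r// ltW.
    have m2 : 0 <= m%:R ^+ 2 :> R by exact: sqr_ge0.
    apply: (@le_trans _ _ (Z * g k * (16 ^+ 2 * m%:R ^+ 2))).
      by rewrite ler_wpM2r// mulr_ge0.
    have : 0 <= 16 ^+ 2 * (Z * g k * m%:R ^+ 2) by rewrite !mulr_ge0// ltW.
    by rewrite /quad_bound; lra.
  apply/funext => w; rewrite (bigD1 (Ordinal kk))//= [X in _ + X]big1 ?addr0.
    by rewrite /c ke eqxx.
  move=> i; rewrite -val_eqE/= => /eqP ik; rewrite /c.
  case: eqP => [h|_]; last by rewrite mul0r.
  by have := ltn_ord i; lia.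
have := moment_leD _ _ c0 c0 h1 h2.
move=> /(_ (measurable_lin2 _ _ _) (measurable_lin2 _ _ _)).
rewrite (_ : (fun w => _ + _) = (fun w => \sum_(i < k) Psi i (k - i.+1) *
    (Y (i.*2 + p)%N w * Y ((k - i.+1).*2 + p)%N w)))//.
apply/funext => w.
pose G i := Psi i (k - i.+1) * (Y (i.*2 + p)%N w * Y ((k - i.+1).*2 + p)%N w).
pose G1 i := if (k - i.+1 < i)%N then G i else 0.
pose G2 i := if (i < k - i.+1)%N then G i else 0.
have G12 : \sum_(i < k) G1 i = \sum_(i < k) G2 i.
  rewrite (sum_ord_rev k G1); apply: eq_bigr => i _; have ik := ltn_ord i.
  rewrite /G1 /G2 /G (_ : k - (k - i.+1).+1 = i)%N; last by lia.
  by case: ifP => // _; rewrite Psi_sym (mulrC (Y _ _)).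
rewrite [X in X + _](_ : _ = \sum_(i < k) G1 i + \sum_(i < k) G2 i); last first.
  rewrite -G12 -big_split/=; apply: eq_bigr => i _; rewrite /G1 /G.
  by case: ifP => _; ring.
rewrite -!big_split/=; apply: eq_bigr => i _; rewrite /G1 /G2 /c -/(G i).
by case: ltngtP => _; rewrite ?mul0r ?addr0 ?add0r// /G.
Qed.

Lemma moment_le_quadJ m k : (0 < m)%N ->
  moment_le m (quadJ Psi k) (64 * quad_bound m k).
Proof.
move=> m0; have c0 : 0 <= 8 * quad_bound m k by rewrite mulr_ge0// quad_bound_ge0.
rewrite [X in moment_le _ _ X](_ : _ = 4 * (8 * quad_bound m k +
  (-1) ^+ 2 * (8 * quad_bound m k))); last by ring.
have h0 := @moment_le_quadJ_part m k 0 m0.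
have h1 := moment_leZ (-1) (measurable_lin2 _ _ _) (@moment_le_quadJ_part m k 1 m0).
have c0' : 0 <= (-1) ^+ 2 * (8 * quad_bound m k) by rewrite sqrrN expr1n mul1r.
have := moment_leD _ _ c0 c0' h0 h1.
move=> /(_ (measurable_lin2 _ _ _) _).
rewrite (_ : (fun w => _ + _) = quadJ Psi k).
  by apply; apply: measurable_funM => //; exact: measurable_lin2.
apply/funext => w; rewrite /quadJ mulN1r -sumrN -big_split/=.
by apply: eq_bigr => i _; rewrite !addn0 !addn1 mulrBr.
Qed.

End quadratic_forms.

End moments.

(** * Moments of the cubic form *)

Section cubic_moments.
Context d (T : measurableType d) (R : realType) (P : probability T R).
Variable Y : nat -> T -> R.
Hypothesis mY : forall k, measurable_fun [set: T] (Y k).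
Hypothesis indepY : forall n (B : nat -> set R), (forall i, measurable (B i)) ->
  P (\bigcap_(i in `I_n) (Y i @^-1` B i)) = (\prod_(i < n) P (Y i @^-1` B i))%E.
Hypothesis lawY : forall k (B : set R), measurable B ->
  P (Y k @^-1` B) = normal_prob 0 1 B.
Local Notation adapted := (adapted Y).

Lemma expr_le_fact_expR (x : R) n : 0 <= x -> x ^+ n <= n`!%:R * expR x.
Proof.
move=> x0; rewrite mulrC -ler_pdivrMr ?ltr0n ?fact_gt0//.
case: n => [|n]; first by rewrite expr0 fact0 divr1 -[leLHS]expR0 ler_expR.
by rewrite (le_trans _ (expR_ge1Dxn n x0))// lerDr.
Qed.

Definition sumsq n (w : T) : R := \sum_(t < n) Y t w ^+ 2.

Lemma sumsq_ge0 n w : 0 <= sumsq n w.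
Proof. by apply: sumr_ge0 => t _; exact: sqr_ge0. Qed.

Lemma sumsq_leq n n' w : (n <= n')%N -> sumsq n w <= sumsq n' w.
Proof.
move=> /subnK <-; elim: (n' - n)%N => [//|q IH]; apply: (le_trans IH).
by rewrite addSn /sumsq big_ord_recr/= lerDl sqr_ge0.
Qed.

Lemma adapted_sumsq n : adapted n (sumsq n).
Proof.
apply: adapted_sum => t _.
rewrite (_ : (fun _ => _) = Y t \* Y t); last by apply/funext => w; rewrite /= expr2.
by apply: adaptedM; exact: adapted_gen.
Qed.

Lemma measurable_sumsq n : measurable_fun [set: T] (sumsq n).
Proof. exact: adapted_measurable (@adapted_sumsq n). Qed.

Lemma measurable_expR_sumsq n :
  measurable_fun [set: T] (fun w => (expR (sumsq n w / 4))%:E).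
Proof.
apply/measurable_EFinP; apply: measurableT_comp => //.
by apply: measurable_funM => //; exact: measurable_sumsq.
Qed.

(** One variable is integrated at a time, each contributing the factor [Num.sqrt 2]. *)
Lemma integral_expR_sumsq n :
  (\int[P]_w (expR (sumsq n w / 4))%:E <= (Num.sqrt 2 ^+ n)%:E)%E.
Proof.
elim: n => [|n IH].
  rewrite (eq_integral (cst 1%E)); last first.
    by move=> w _; rewrite /sumsq big_ord0 mul0r expR0.
  by rewrite integral_cst//= mul1e probability_setT.
pose f (z : g_sigma_algebraType (past Y n) * measurableTypeR R) : \bar R :=
  ((expR (sumsq n z.1 / 4))%:E * (expR (z.2 ^+ 2 / 4))%:E)%E.
rewrite (eq_integral (fun w => f (w, Y n w))); last first.
  by move=> w _; rewrite /f -EFinM -expRD /sumsq big_ord_recr/= -mulrDl.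
rewrite (integral_past_next mY indepY lawY); last 2 first.
- apply: emeasurable_funM; apply/measurable_EFinP; apply: measurableT_comp => //.
  + apply: measurable_funM => //; exact: (measurableT_comp (@adapted_sumsq n)).
  + by apply: measurable_funM => //; exact: measurable_funX.
- by move=> z; rewrite mule_ge0// lee_fin expR_ge0.
have mexp : measurable_fun [set: R] (fun y : R => (expR (y ^+ 2 / 4))%:E).
  apply/measurable_EFinP; apply: measurableT_comp => //.
  by apply: measurable_funM => //; exact: measurable_funX.
rewrite (eq_integral (fun w => (Num.sqrt 2)%:E * (expR (sumsq n w / 4))%:E)%E); last first.
  move=> w _; rewrite /f/= ge0_integralZl_EFin ?expR_ge0//.
  by rewrite integral_normal_prob_expR muleC.
rewrite ge0_integralZl_EFin ?sqrtr_ge0//; last exact: measurable_expR_sumsq.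
by rewrite exprS EFinM lee_wpmul2l// lee_fin sqrtr_ge0.
Qed.

(** With Q the sum of squares, Q^(2m) <= 4^(2m) (2m)! e^(Q/4), and the exponential has mean at most
    2^m. As the number of variables equals the order 2m of the moment, this factor 2^m is
    harmless. *)
Lemma moment_le_sumsq m : moment_le P m (sumsq m.*2) (2 * (8 * m%:R) ^+ 2).
Proof.
pose c : R := 4 ^+ m.*2 * (m.*2)`!%:R.
have c0 : 0 <= c by rewrite mulr_ge0// exprn_ge0.
apply: (@le_trans _ _ (\int[P]_w (c%:E * (expR (sumsq m.*2 w / 4))%:E))%E).
  apply: ge0_le_integral => //.
  - by move=> w _; rewrite lee_fin exprn_double_ge0.
  - by apply: measurable_expr_double; exact: measurable_sumsq.
  - by apply: measurable_funeM; exact: measurable_expR_sumsq.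
  move=> w _; rewrite -EFinM lee_fin /c -mulrA -ler_pdivrMl ?exprn_gt0//.
  rewrite mulrC -expr_div_n; apply: expr_le_fact_expR.
  by rewrite divr_ge0// sumsq_ge0.
rewrite ge0_integralZl_EFin//; last exact: measurable_expR_sumsq.
apply: le_trans (lee_wpmul2l _ (integral_expR_sumsq _)) _; first by rewrite lee_fin.
rewrite -EFinM lee_fin /c.
have -> : Num.sqrt 2 ^+ m.*2 = 2 ^+ m :> R by rewrite -mul2n exprM sqr_sqrtr.
rewrite (exprMn m 2) mulrC ler_wpM2l ?exprn_ge0//.
rewrite -exprM mul2n.
have -> : 8 * m%:R = 4 * m.*2%:R :> R by rewrite -mul2n natrM; ring.
rewrite exprMn ler_wpM2l ?exprn_ge0// -natrX ler_nat.
elim: m.*2 => [//|n IH]; rewrite factS expnS leq_mul// (leq_trans IH)//.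
by case: n {IH} => // n; rewrite leq_exp2r.
Qed.

(** Induction needs the telescoping form, with 1 / (K + L) added on the left. *)
Lemma sum_inv_sqr_le (K L : nat) : (0 < K)%N ->
  \sum_(k < L) ((K + k).+1%:R ^+ 2)^-1 <= K%:R^-1 :> R.
Proof.
move=> K0; have : \sum_(k < L) ((K + k).+1%:R ^+ 2)^-1 + (K + L)%:R^-1 <= K%:R^-1 :> R.
  elim: L => [|L IH]; first by rewrite big_ord0 add0r addn0.
  apply: le_trans IH; rewrite big_ord_recr/= -addrA lerD2l addnS.
  have x0 : 0 < (K + L)%:R :> R by rewrite ltr0n; lia.
  rewrite -natr1; move: (K + L)%:R x0 => x x0.
  have x1 : 0 < x + 1 by rewrite ltr_wpDr.
  have -> : x^-1 = (x + 1)^-1 + (x * (x + 1))^-1.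
    by field; rewrite !lt0r_neq0.
  rewrite addrC lerD2l lef_pV2 ?posrE ?mulr_gt0 ?exprn_gt0//.
  by rewrite expr2; nra.
by apply: le_trans; rewrite lerDl.
Qed.

Variables (Psi : nat -> nat -> R) (e g c : nat -> R) (Z A : R).
Hypothesis Psi_sym : forall i j, Psi i j = Psi j i.
Hypothesis e_gt0 : forall i, 0 < e i.
Hypothesis g_gt0 : forall i, 0 < g i.
Hypothesis Z_gt0 : 0 < Z.
Hypothesis A_gt0 : 0 < A.
Hypothesis sum_e : forall n, \sum_(i < n) e i <= Z.
Hypothesis Psi_le : forall i j, (i <= j)%N -> Psi i j ^+ 2 <= e i * g (i + j).+1.
Hypothesis cg : forall k, c k ^+ 2 * g k <= A / k.+1%:R ^+ 2.

(** The bracket is Im ((J + i I) (x - i y)) = x I - y J, that is, the convolution multiplied by the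
    conjugate of the frequency k + 1, where x and y are [Y k.*2] and [Y k.*2.+1]. *)
Definition cubic N w :=
  \sum_(k < N) 2 * c k * (Y k.*2 w * quadI Y Psi k w - Y k.*2.+1 w * quadJ Y Psi k w).

(** The factor 4 is the square of the 2 in [cubic], 64 is the loss in [moment_le_quadJ], the
    following factors are those of [quad_bound], and A bounds c^2 g up to the decay in the
    frequency. *)
Definition cubic_cst : R := 4 * 64 * (16 ^+ 2 * (4 * Z * A)).

Lemma cubic_cst_gt0 : 0 < cubic_cst.
Proof. by rewrite /cubic_cst !mulr_gt0. Qed.

(** The coefficient of the single variable [Y t] when [cubic] is read as a martingale: even t are
    real parts, odd t imaginary parts. *)
Let inc t w := if odd t then (- (2 * c t./2)) * quadJ Y Psi t./2 w
               else 2 * c t./2 * quadI Y Psi t./2 w.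

Let adapted_inc t : adapted t (inc t).
Proof.
have t2 : (t./2.*2 <= t)%N by lia.
have aI : adapted t (quadI Y Psi t./2).
  by apply: (adapted_leq t2); exact: adapted_quadI.
have aJ : adapted t (quadJ Y Psi t./2).
  by apply: (adapted_leq t2); exact: adapted_quadJ.
rewrite /inc; case ot : (odd t).
- by apply: (adaptedM _ aJ); exact: adapted_cst.
- by apply: (adaptedM _ aI); exact: adapted_cst.
Qed.

Let measurable_quadI k : measurable_fun [set: T] (quadI Y Psi k).
Proof. by apply: (adapted_measurable mY (k := k.*2)); exact: adapted_quadI. Qed.

Let measurable_quadJ k : measurable_fun [set: T] (quadJ Y Psi k).
Proof. by apply: (adapted_measurable mY (k := k.*2)); exact: adapted_quadJ. Qed.

Let moment_le_inc m t : (0 < m)%N ->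
  moment_le P m (inc t) (m%:R ^+ 2 * cubic_cst / (t./2.+1%:R ^+ 2)).
Proof.
move=> m0.
have key C : (0 <= C <= 64) -> (2 * c t./2) ^+ 2 * (C * quad_bound g Z m t./2) <=
    m%:R ^+ 2 * cubic_cst / (t./2.+1%:R ^+ 2).
  move=> /andP[C0 C64].
  have -> : (2 * c t./2) ^+ 2 * (C * quad_bound g Z m t./2) =
    (4 * (16 ^+ 2 * (4 * Z)) * m%:R ^+ 2) * (C * (c t./2 ^+ 2 * g t./2)).
    by rewrite /quad_bound; ring.
  have -> : m%:R ^+ 2 * cubic_cst / (t./2.+1%:R ^+ 2) =
    (4 * (16 ^+ 2 * (4 * Z)) * m%:R ^+ 2) * (64 * (A / t./2.+1%:R ^+ 2)).
    by rewrite /cubic_cst; ring.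
  apply: ler_wpM2l; first by rewrite !mulr_ge0 ?exprn_ge0// ltW.
  by apply: ler_pM => //; rewrite mulr_ge0 ?sqr_ge0 ?(ltW (g_gt0 _)).
have q0 C : 0 <= C -> 0 <= (2 * c t./2) ^+ 2 * (C * quad_bound g Z m t./2).
  by move=> C0; rewrite mulr_ge0 ?sqr_ge0// mulr_ge0// quad_bound_ge0.
rewrite /inc; case ot : (odd t).
- apply: (@moment_le_leq _ _ _ _ _ _ ((- (2 * c t./2)) ^+ 2 * (64 * quad_bound g Z m t./2))).
  + by rewrite sqrrN q0.
  + by rewrite sqrrN key// lexx ler0n.
  + apply: moment_leZ; last exact: (moment_le_quadJ mY indepY lawY Psi_sym).
    exact: measurable_quadJ.
- apply: (@moment_le_leq _ _ _ _ _ _ ((2 * c t./2) ^+ 2 * (8 * quad_bound g Z m t./2))).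
  + by rewrite q0.
  + by rewrite key// ler0n ler_nat.
  + apply: moment_leZ; last exact: (moment_le_quadI mY indepY lawY Psi_sym).
    exact: measurable_quadI.
Qed.

Lemma cubic_sub_sum K L w :
  cubic (K + L) w - cubic K w = \sum_(t < L.*2) Y (K.*2 + t)%N w * inc (K.*2 + t)%N w.
Proof.
elim: L => [|L IH]; first by rewrite addn0 subrr big_ord0.
rewrite doubleS !big_ord_recr/= -IH addnS /cubic big_ord_recr/=.
have -> : (K.*2 + L.*2.+1 = (K + L).*2.+1)%N by lia.
rewrite -doubleD /inc /= odd_double/= doubleK uphalf_double.
by rewrite -[RHS]addrA addrAC; congr (_ + _); ring.
Qed.

Lemma measurable_cubic N : measurable_fun [set: T] (cubic N).
Proof.
apply: measurable_sum => k; apply: measurable_funM => //.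
by apply: measurable_funB; apply: measurable_funM.
Qed.

(** 33 = 1 + 16 * 2: the positive starting value, and the factor 16 m of the recursion applied to
    two variables per frequency, with the tail of the sum of n^-2 beyond m at most 1 / m. *)
Lemma moment_le_cubic_sub m L : (0 < m)%N ->
  moment_le P m (fun w => cubic (m + L) w - cubic m w) (33 * cubic_cst * m%:R ^+ 2).
Proof.
move=> m0; have mR0 : 0 < m%:R :> R by rewrite ltr0n.
have D0 := cubic_cst_gt0.
pose beta t := m%:R ^+ 2 * cubic_cst / ((m.*2 + t)./2.+1%:R ^+ 2).
have s00 : 0 < cubic_cst * m%:R ^+ 2 by rewrite mulr_gt0// exprn_gt0.
have fi : {homo (fun t => m.*2 + t)%N : i j / (i < j)%N}.
  by move=> i j ij; rewrite ltn_add2l.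
have bt t : 0 < beta t.
  by rewrite /beta !mulr_gt0 ?invr_gt0 ?exprn_gt0// ltr0n.
have [_] := @moment_le_sum _ _ _ P Y mY indepY lawY m L.*2 _
  (fun t => inc (m.*2 + t)%N) beta _ s00 fi (fun t _ => @adapted_inc _) bt
  (fun t _ => moment_le_inc _ m0).
rewrite (_ : (fun w => \sum_(t < _) _) = fun w => cubic (m + L) w - cubic m w); last first.
  by apply/funext => w; rewrite cubic_sub_sum.
have b0 : 0 <= \sum_(t < L.*2) beta t by apply: sumr_ge0 => t _; exact: ltW.
apply: moment_le_leq.
  by rewrite addr_ge0 ?(ltW s00)// !mulr_ge0.
suff h : \sum_(t < L.*2) beta t <= 2 * (m%:R * cubic_cst).
  have : m%:R * \sum_(t < L.*2) beta t <= m%:R * (2 * (m%:R * cubic_cst)).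
    by rewrite ler_wpM2l.
  by rewrite expr2; lra.
have -> : \sum_(t < L.*2) beta t =
   2 * (m%:R ^+ 2 * cubic_cst * \sum_(k < L) ((m + k).+1%:R ^+ 2)^-1).
  rewrite !mulr_sumr; elim: L {b0} => [|L IH]; first by rewrite !big_ord0.
  rewrite doubleS !big_ord_recr/= IH -addrA; congr (_ + _).
  rewrite /beta addnS -doubleD/= uphalf_double doubleK; ring.
rewrite ler_wpM2l//.
apply: (@le_trans _ _ (m%:R ^+ 2 * cubic_cst * m%:R^-1)).
  apply: ler_wpM2l; first by rewrite mulr_ge0 ?sqr_ge0 ?(ltW D0).
  exact: sum_inv_sqr_le.
rewrite le_eqVlt; apply/orP; left; apply/eqP; field; exact: lt0r_neq0.
Qed.

(* The moment order m is also the cut-off frequency: below it the pathwise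
   bound involves a chi-square variable with 2m degrees of freedom, whose 2m-th
   moment is (C m)^(2m); above it the martingale increments contribute
   m^3 sum_(n > m) n^-2 = O(m^2). *)
Lemma integral_cubic_le (E : set T) (L : R) m N : (0 < m)%N -> measurable E ->
  0 <= L -> (forall M w, E w -> `|cubic M w| <= L * sumsq M.*2 w) ->
  (\int[P]_(w in E) (cubic N w ^+ m.*2)%:E <=
    (((4 * (2 * (8 * L) ^+ 2 + 33 * cubic_cst)) * m%:R ^+ 2) ^+ m)%:E)%E.
Proof.
move=> m0 mE L0 cubicL.
(* Natural subtraction makes [D] vanish when N <= m; the pathwise bound then covers the whole
   form. *)
pose D w := cubic (m + (N - m)) w - cubic m w.
have mD : measurable_fun [set: T] D by apply: measurable_funB; exact: measurable_cubic.
have mnD : measurable_fun [set: T] (fun w => `|D w|) by exact: measurableT_comp.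
have mQ : measurable_fun [set: T] (fun w => L * sumsq m.*2 w).
  by apply: measurable_funM => //; exact: measurable_sumsq.
have key w : E w -> `|cubic N w| <= L * sumsq m.*2 w + `|D w|.
  move=> Ew; have [Nm|mN] := leqP N m.
    apply: (@le_trans _ _ (L * sumsq N.*2 w)); first exact: cubicL.
    by rewrite ler_wpDr// ler_wpM2l// sumsq_leq// leq_double.
  rewrite -[in leLHS](subnKC (ltnW mN)) -[X in `|X|](subrK (cubic m w)) addrC.
  by apply: (le_trans (ler_normD _ _)); rewrite lerD2r; exact: cubicL.
have hD : moment_le P m (fun w => `|D w|) (33 * cubic_cst * m%:R ^+ 2).
  have := moment_le_cubic_sub (N - m) m0; rewrite /moment_le.
  congr (_ <= _)%E; apply: eq_integral => w _.
  by rewrite -normrX ger0_norm// exprn_double_ge0.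
have hQ := moment_leZ L (@measurable_sumsq m.*2) (moment_le_sumsq m).
have C0 : 0 <= 33 * cubic_cst * m%:R ^+ 2.
  by rewrite !mulr_ge0 ?sqr_ge0// ltW// cubic_cst_gt0.
have C0' : 0 <= L ^+ 2 * (2 * (8 * m%:R) ^+ 2) by rewrite !mulr_ge0 ?sqr_ge0.
have := moment_leD mQ mnD C0' C0 hQ hD.
have -> : 4 * (L ^+ 2 * (2 * (8 * m%:R) ^+ 2) + 33 * cubic_cst * m%:R ^+ 2) =
  4 * (2 * (8 * L) ^+ 2 + 33 * cubic_cst) * m%:R ^+ 2 by ring.
apply: le_trans.
apply: (@le_trans _ _ (\int[P]_(w in E) ((L * sumsq m.*2 w + `|D w|) ^+ m.*2)%:E)%E).
  apply: ge0_le_integral => //.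
  - by move=> w _; rewrite lee_fin exprn_double_ge0.
  - by apply: measurable_funTS; apply: measurable_expr_double; exact: measurable_cubic.
  - by apply: measurable_funTS; apply: measurable_expr_double; exact: measurable_funD.
  move=> w Ew; rewrite lee_fin.
  have -> : cubic N w ^+ m.*2 = `|cubic N w| ^+ m.*2.
    by rewrite -normrX ger0_norm// exprn_double_ge0.
  by rewrite lerXn2r ?nnegrE ?key// (le_trans _ (key _ Ew)).
(* The restriction to [E] is released only here, after the pathwise bound has been used, so that the
   Gaussian estimates apply on the whole space. *)
apply: ge0_subset_integral => //.
- by apply: measurable_expr_double; exact: measurable_funD.
- by move=> w _; rewrite lee_fin exprn_double_ge0.
Qed.

End cubic_moments.

(** * The coefficients of the cubic form *)

Section weights.
Context (R : realType).
Implicit Types (s x t : R) (a b n : nat).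

(** Since t <= 1, the real exponent may be raised to the integer k, for which this is Bernoulli's
    inequality. *)
Lemma powR_ge_linear t (q : R) k : 0 < t <= 1 -> q <= k%:R ->
  1 - k%:R * (1 - t) <= t `^ q.
Proof.
move=> /andP[t0 t1] qk; apply: (@le_trans _ _ (t `^ k%:R)); last first.
  by apply: ger_powR => //; rewrite t0 t1.
rewrite powR_mulrn; last exact: ltW.
elim: k {qk} => [|k IH]; first by rewrite expr0 mul0r subr0.
rewrite exprS -natr1.
apply: (@le_trans _ _ (t * (1 - k%:R * (1 - t)))); last first.
  by rewrite ler_wpM2l// ltW.
have : 0 <= k%:R * (1 - t) ^+ 2 by rewrite mulr_ge0 ?sqr_ge0.
by rewrite expr2; nra.
Qed.

(** A telescoping integral comparison: the added term n^(-d) / d is the tail integral. The step (x +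
    1)^(-d) (1 + d / (x + 1)) <= x^(-d) follows from e^y >= 1 + y and ln (x + 1) - ln x >= 1 / (x +
    1). *)
Lemma sum_powR_le (d : R) n : 0 < d ->
  \sum_(i < n) i.+1%:R `^ (- (1 + d)) <= 1 + d^-1.
Proof.
move=> d0.
suff H : \sum_(i < n.+1) i.+1%:R `^ (- (1 + d)) + d^-1 * n.+1%:R `^ (- d) <= 1 + d^-1.
  apply: le_trans H; rewrite big_ord_recr/= -addrA lerDl.
  by rewrite addr_ge0 ?powR_ge0// mulr_ge0 ?powR_ge0// invr_ge0 ltW.
elim: n => [|n IH].
  by rewrite big_ord_recr big_ord0/= add0r !powR1 mulr1.
apply: le_trans IH; rewrite big_ord_recr/= -addrA lerD2l.
set x : R := n.+1%:R; have x0 : 0 < x by rewrite ltr0n.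
have -> : n.+2%:R = x + 1 by rewrite natr1.
have x1 : 0 < x + 1 by lra.
rewrite -ler_pdivrMl ?invr_gt0// invrK.
have dN : d != 0 by rewrite gt_eqF.
rewrite mulrDr mulVKf//.
have -> : (x + 1) `^ (- (1 + d)) = (x + 1) `^ (- d) / (x + 1).
  rewrite (_ : - (1 + d) = - d + -1); last by ring.
  rewrite powRD; last by rewrite (gt_eqF x1) implybT.
  by rewrite powR_inv1// ltW.
have -> : x `^ (- d) = (x + 1) `^ (- d) * expR (d * (ln (x + 1) - ln x)).
  by rewrite /powR (gt_eqF x0) (gt_eqF x1) -expRD; congr expR; ring.
rewrite mulrCA -[X in _ + X]mulr1 -mulrDr ler_wpM2l ?powR_ge0//.
apply: le_trans (expR_ge1Dx _); rewrite addrC lerD2l ler_wpM2l ?(ltW d0)//.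
rewrite -lerN2 opprB -ln_div ?posrE//.
have -> : x / (x + 1) = 1 + - (x + 1)^-1 by field; exact: lt0r_neq0.
by apply: le_ln1Dx; rewrite ltrN2 invf_lt1//; lra.
Qed.

(* The factor n / (1 + n) comes from solving
   (1 + n) d_t u_n + i n (u_n + (u^2)_n) = 0 for d_t u_n. *)
Definition phi s n : R := n%:R `^ (2 * (s + 2^-1)) * (n%:R / (1 + n%:R)).

Definition psi s a b : R := phi s (a + b) - phi s a - phi s b.

Lemma psiC s a b : psi s a b = psi s b a.
Proof. by rewrite /psi addnC; ring. Qed.

Lemma powR_exp_split s x : 0 < x -> x `^ (2 * (s + 2^-1)) = x * x `^ (2 * s).
Proof.
move=> x0; rewrite (_ : 2 * (s + 2^-1) = 1 + 2 * s); last by field.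
rewrite powRD; last by rewrite (gt_eqF x0) implybT.
by rewrite powRr1// ltW.
Qed.

Definition psi_cst s : R := (Num.truncn (2 * (s + 2^-1))).+2%:R.

(** The difference phi(a + b) - phi(b) gains a factor a / (a + b) over its terms, while phi(a) is
    itself at most a (a + b)^(2s). *)
Lemma psi_le s a b : 0 < s -> (0 < a)%N -> (a <= b)%N ->
  `|psi s a b| <= psi_cst s * (a%:R * (a + b)%:R `^ (2 * s)).
Proof.
move=> s0 a0 ab.
set q := 2 * (s + 2^-1); have q0 : 0 < q by rewrite /q; lra.
pose k := (Num.truncn q).+1.
have qk : q <= k%:R by apply: ltW; rewrite /k; apply: truncnS_gt.
have b0 : (0 < b)%N by exact: leq_trans ab.
set x : R := a%:R; set y : R := b%:R; set z : R := (a + b)%:R.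
have zE : z = x + y by rewrite /z natrD.
have x0 : 0 < x by rewrite ltr0n.
have y0 : 0 < y by rewrite ltr0n.
have z0 : 0 < z by rewrite zE addr_gt0.
set P := z `^ (2 * s); have P0 : 0 < P by rewrite powR_gt0.
have phi_ge0 n : 0 <= phi s n.
  by rewrite /phi mulr_ge0 ?powR_ge0// divr_ge0// addr_ge0.
have mono (u v : R) : 0 < u -> u <= v -> u `^ (2 * s) <= v `^ (2 * s).
  by move=> u0 uv; apply: ge0_ler_powR; rewrite ?nnegrE; lra.
have phia : phi s a <= x * P.
  rewrite /phi -/q -/x powR_exp_split//.
  apply: (@le_trans _ _ (x * x `^ (2 * s))).
    rewrite ler_piMr ?mulr_ge0 ?powR_ge0 ?(ltW x0)//.
    by rewrite ler_pdivrMr; lra.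
  by rewrite ler_wpM2l ?(ltW x0)// /P mono// zE; lra.
have yz : y / z = 1 - x / z.
  by rewrite -[1](divff (lt0r_neq0 z0)) -mulrBl; congr (_ / _); rewrite zE; ring.
have yz01 : 0 < y / z <= 1.
  by rewrite divr_gt0//= ler_pdivrMr// mul1r zE; lra.
have h1 : z `^ q - y `^ q <= k%:R * (x * P).
  have -> : y `^ q = z `^ q * (y / z) `^ q.
    by rewrite -powRM ?(ltW z0)// ?divr_ge0 ?(ltW y0) ?(ltW z0)// mulrC divfK// gt_eqF.
  have := powR_ge_linear yz01 qk; rewrite yz.
  rewrite (_ : 1 - (1 - x / z) = x / z); last by ring.
  move=> h; rewrite -[X in X - _]mulr1 -mulrBr /q powR_exp_split// -/P.
  apply: (@le_trans _ _ (z * P * (k%:R * (x / z)))).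
    by rewrite ler_wpM2l ?mulr_ge0 ?(ltW z0) ?(ltW P0)//; lra.
  have -> : z * P * (k%:R * (x / z)) = k%:R * (x * P) * (z / z) by ring.
  by rewrite divff ?mulr1// lt0r_neq0.
have h1' : 0 <= z `^ q - y `^ q.
  rewrite subr_ge0; apply: ge0_ler_powR; rewrite ?nnegrE; lra.
have hz : z / (1 + z) <= 1 by rewrite ler_pdivrMr; lra.
have hz0 : 0 <= z / (1 + z) by rewrite divr_ge0; lra.
have h2 : y `^ q * (z / (1 + z) - y / (1 + y)) <= x * P.
  have -> : z / (1 + z) - y / (1 + y) = x / ((1 + z) * (1 + y)).
    by rewrite zE; field; rewrite !lt0r_neq0//; lra.
  rewrite /q powR_exp_split//.
  apply: (@le_trans _ _ (y * P * (x / ((1 + z) * (1 + y))))).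
    rewrite ler_wpM2r ?divr_ge0 ?mulr_ge0//; try lra.
    by rewrite ler_wpM2l ?(ltW y0)// /P mono// zE; lra.
  rewrite mulrA ler_pdivrMr; last by rewrite mulr_gt0; lra.
  have xP : 0 < x * P by rewrite mulr_gt0.
  have : y * (x * P) <= (1 + z) * (1 + y) * (x * P).
    rewrite ler_wpM2r ?(ltW xP)//; nra.
  by lra.
have h2' : 0 <= y `^ q * (z / (1 + z) - y / (1 + y)).
  rewrite mulr_ge0 ?powR_ge0// subr_ge0 ler_pdivrMr; last lra.
  by rewrite mulrAC ler_pdivlMr; [nra|lra].
(* The first two summands are nonnegative, bounded by k and 1 times a (a + b)^(2s); the third is
   bounded by 1 times it and has the opposite sign, whence the constant k + 1. *)
have -> : psi s a b = (z `^ q - y `^ q) * (z / (1 + z)) +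
   y `^ q * (z / (1 + z) - y / (1 + y)) - phi s a.
  by rewrite /psi /phi -/x -/y -/z -/q; ring.
have h3 : (z `^ q - y `^ q) * (z / (1 + z)) <= k%:R * (x * P).
  by apply: le_trans h1; rewrite ler_piMr.
have h3' : 0 <= (z `^ q - y `^ q) * (z / (1 + z)) by rewrite mulr_ge0.
have -> : psi_cst s = k%:R + 1 by rewrite /psi_cst -/q natr1.
have := phi_ge0 a; have xP : 0 < x * P by rewrite mulr_gt0.
have kxP : 0 <= k%:R * (x * P) by rewrite mulr_ge0// ltW.
by move=> ?; rewrite ler_norml; apply/andP; split; lra.
Qed.

End weights.

Section coefficients.
Context (R : realType) (s : R).
Hypothesis s1 : 1 < s.

(* cc k is the standard deviation of the real and imaginary parts of the
   frequency k + 1; in the bound Psi^2 <= ee * gg, the factor ee of the smaller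
   frequency is summable because s > 1, and cc^2 compensates gg. *)
Definition cc (k : nat) : R := (Num.sqrt 2)^-1 / k.+1%:R `^ (s + 2^-1).
Definition Psi (i j : nat) : R := psi s i.+1 j.+1 * cc i * cc j.
Definition gg (k : nat) : R := k.+1%:R `^ (2 * s - 1).
(** In [ee_cst] and [low_cst] the powers of 2 are the price of [powR_half_le]; the divisors 4 and 2
    come from the factors 1 / [Num.sqrt 2] in the standard deviations. *)
Definition ee_cst : R := psi_cst s ^+ 2 * 2 `^ (2 * s + 1) / 4.
Definition ee (i : nat) : R := ee_cst * i.+1%:R `^ (1 - 2 * s).
Definition low_cst : R := psi_cst s * 2 `^ (s + 2^-1) / 2.

Lemma psi_cst_gt0 : 0 < psi_cst s.
Proof. by rewrite /psi_cst ltr0n. Qed.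

Lemma ee_cst_gt0 : 0 < ee_cst.
Proof. by rewrite /ee_cst divr_gt0// mulr_gt0 ?powR_gt0// exprn_gt0// psi_cst_gt0. Qed.

Lemma low_cst_gt0 : 0 < low_cst.
Proof. by rewrite /low_cst divr_gt0// mulr_gt0 ?powR_gt0// psi_cst_gt0. Qed.

Lemma cc_gt0 k : 0 < cc k.
Proof. by rewrite /cc divr_gt0 ?powR_gt0// invr_gt0 sqrtr_gt0. Qed.

Lemma ee_gt0 i : 0 < ee i.
Proof. by rewrite /ee mulr_gt0 ?powR_gt0// ee_cst_gt0. Qed.

Lemma gg_gt0 k : 0 < gg k.
Proof. by rewrite /gg powR_gt0. Qed.

Lemma Psi_sym i j : Psi i j = Psi j i.
Proof. by rewrite /Psi psiC mulrAC. Qed.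

Lemma sum_ee n : \sum_(i < n) ee i <= ee_cst * (1 + (2 * s - 2)^-1).
Proof.
rewrite /ee -mulr_sumr ler_wpM2l ?(ltW ee_cst_gt0)//.
have d0 : 0 < 2 * s - 2 by have := s1; lra.
apply: le_trans (sum_powR_le n d0); rewrite le_eqVlt; apply/orP; left; apply/eqP.
by apply: eq_bigr => i _; congr powR; ring.
Qed.

Lemma powRDpos (x a b : R) : 0 < x -> x `^ (a + b) = x `^ a * x `^ b.
Proof. by move=> x0; rewrite powRD// (gt_eqF x0) implybT. Qed.

Lemma sqr_cc k : cc k ^+ 2 = 2^-1 * k.+1%:R `^ (- (2 * s + 1)).
Proof.
rewrite /cc expr_div_n exprVn sqr_sqrtr//; congr (_ * _).
rewrite powRN; congr (_^-1).
by rewrite -powR_mulrn ?powR_ge0// -powRrM; congr powR; field.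
Qed.

Lemma sqr_cc_gg k : cc k ^+ 2 * gg k <= 2^-1 / k.+1%:R ^+ 2.
Proof.
rewrite sqr_cc /gg -mulrA -powRDpos ?ltr0n// (_ : - (2 * s + 1) + (2 * s - 1) = - 2%:R); last by ring.
by rewrite powR_invn.
Qed.

(* The larger of two frequencies is at least half their sum, which turns the
   decay in j into decay in the sum. *)
Lemma powR_half_le (i j : nat) (x : R) : 0 <= x -> (i <= j)%N ->
  j.+1%:R `^ (- x) <= 2 `^ x * (i + j).+2%:R `^ (- x).
Proof.
move=> x0 ij.
have -> : 2 `^ x * (i + j).+2%:R `^ (- x) = ((i + j).+2%:R / 2) `^ (- x).
  rewrite powRM ?invr_ge0// mulrC; congr (_ * _).
  by rewrite -(@powR_inv1 _ 2)// -powRrM mulN1r opprK.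
rewrite !powRN lef_pV2 ?posrE ?powR_gt0 ?divr_gt0//.
apply: ge0_ler_powR => //; rewrite ?nnegrE ?divr_ge0//.
by rewrite ler_pdivrMr// -natrM ler_nat; lia.
Qed.

(** With a = i + 1 and n = i + j + 2, the square of psi is O(a^2 n^(4s)) and the two variances are
    O(a^(-2s-1)) and O(n^(-2s-1)); the product is O(a^(1-2s) n^(2s-1)). *)
Lemma Psi_le i j : (i <= j)%N -> Psi i j ^+ 2 <= ee i * gg (i + j).+1.
Proof.
move=> ij; have s1' := s1; rewrite /Psi (exprMn 2 (psi s i.+1 j.+1 * cc i)).
rewrite (exprMn 2 (psi s i.+1 j.+1)) !sqr_cc.
set a : R := i.+1%:R; set n : R := (i + j).+2%:R.
have a0 : 0 < a by rewrite ltr0n.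
have n0 : 0 < n by rewrite ltr0n.
have h1 : psi s i.+1 j.+1 ^+ 2 <= psi_cst s ^+ 2 * (a ^+ 2 * n `^ (4 * s)).
  rewrite -[leLHS](real_normK (num_real _)).
  have := @psi_le R s i.+1 j.+1.
  rewrite (_ : i.+1 + j.+1 = (i + j).+2)%N ?addSn ?addnS// -/a -/n => h.
  have -> : psi_cst s ^+ 2 * (a ^+ 2 * n `^ (4 * s)) =
      (psi_cst s * (a * n `^ (2 * s))) ^+ 2.
    rewrite !exprMn; congr (_ * (_ * _)).
    by rewrite -powR_mulrn ?powR_ge0// -powRrM; congr powR; ring.
  rewrite lerXn2r ?nnegrE//.
  - by rewrite mulr_ge0 ?(ltW psi_cst_gt0)// mulr_ge0 ?powR_ge0// ltW.
  - by apply: h => //; lra.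
have h2 := @powR_half_le i j (2 * s + 1) _ ij; rewrite -/n in h2.
have {}h2 := h2 ltac:(lra).
have -> : ee i * gg (i + j).+1 = psi_cst s ^+ 2 * (a ^+ 2 * n `^ (4 * s)) *
   (2^-1 * a `^ (- (2 * s + 1))) *
   (2^-1 * (2 `^ (2 * s + 1) * n `^ (- (2 * s + 1)))).
  rewrite /ee /gg /ee_cst -/a -/n.
  have -> : a `^ (1 - 2 * s) = a ^+ 2 * a `^ (- (2 * s + 1)).
    rewrite -(powR_mulrn 2 (ltW a0)) -powRDpos//; congr powR; ring.
  have -> : n `^ (2 * s - 1) = n `^ (4 * s) * n `^ (- (2 * s + 1)).
    rewrite -powRDpos//; congr powR; ring.
  by field.
apply: ler_pM.
- by rewrite mulr_ge0 ?sqr_ge0 ?mulr_ge0 ?powR_ge0 ?invr_ge0.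
- by rewrite mulr_ge0 ?powR_ge0 ?invr_ge0.
- by rewrite ler_wpM2r ?mulr_ge0 ?powR_ge0 ?invr_ge0.
- by rewrite ler_wpM2l ?invr_ge0.
Qed.

(** The pathwise counterpart of [Psi_le]. The standard deviations of the two larger frequencies beat
    n^(2s) by a factor 1 / n, which will compensate the linear growth in [sum_v]. *)
Lemma cc_Psi_le i j : (i <= j)%N ->
  cc (i + j).+1 * `|Psi i j| <= low_cst * (i.+1%:R * cc i / (i + j).+2%:R).
Proof.
move=> ij; have s1' := s1; rewrite /Psi (normrM (psi s i.+1 j.+1 * cc i)) (normrM (psi s i.+1 j.+1)).
rewrite (gtr0_norm (cc_gt0 i)) (gtr0_norm (cc_gt0 j)).
set a : R := i.+1%:R; set n : R := (i + j).+2%:R.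
have a0 : 0 < a by rewrite ltr0n.
have n0 : 0 < n by rewrite ltr0n.
have h1 : `|psi s i.+1 j.+1| <= psi_cst s * (a * n `^ (2 * s)).
  have := @psi_le R s i.+1 j.+1.
  by rewrite (_ : i.+1 + j.+1 = (i + j).+2)%N ?addSn ?addnS// -/a -/n; apply => //; lra.
have h2 := @powR_half_le i j (s + 2^-1) ltac:(lra) ij; rewrite -/n in h2.
have h3 : cc (i + j).+1 * cc j <= 2^-1 * (2 `^ (s + 2^-1) * n `^ (- (2 * s + 1))).
  rewrite /cc -/n -!powRN.
  have -> : (Num.sqrt 2)^-1 * n `^ (- (s + 2^-1)) *
    ((Num.sqrt 2)^-1 * j.+1%:R `^ (- (s + 2^-1))) =
    ((Num.sqrt 2) ^+ 2)^-1 * (n `^ (- (s + 2^-1)) * j.+1%:R `^ (- (s + 2^-1))).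
    by rewrite -exprVn; ring.
  rewrite sqr_sqrtr// ler_wpM2l ?invr_ge0//.
  have -> : n `^ (- (2 * s + 1)) = n `^ (- (s + 2^-1)) * n `^ (- (s + 2^-1)).
    by rewrite -powRDpos//; congr powR; field.
  by rewrite mulrCA ler_wpM2l ?powR_ge0.
have -> : low_cst * (a * cc i / n) = psi_cst s * (a * n `^ (2 * s)) * cc i *
    (2^-1 * (2 `^ (s + 2^-1) * n `^ (- (2 * s + 1)))).
  rewrite /low_cst; have -> : n^-1 = n `^ (2 * s) * n `^ (- (2 * s + 1)).
    rewrite -powRDpos// (_ : 2 * s + - (2 * s + 1) = -1); last by ring.
    by rewrite powR_inv1// ltW.
  by ring.
have -> : cc (i + j).+1 * (`|psi s i.+1 j.+1| * cc i * cc j) =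
  (`|psi s i.+1 j.+1| * cc i) * (cc (i + j).+1 * cc j) by ring.
have ci := ltW (cc_gt0 i); have cj := ltW (cc_gt0 j).
have ck := ltW (cc_gt0 (i + j).+1).
by apply: ler_pM; rewrite ?mulr_ge0// ler_wpM2r.
Qed.

End coefficients.

(** * Low frequencies *)

Lemma sum_triangle (V : nmodType) (F : nat -> nat -> V) (N : nat) :
  \sum_(k < N) \sum_(i < k) F i (k - i.+1)%N =
  \sum_(i < N) \sum_(j < N | ((i + j).+1 < N)%N) F i j.
Proof.
have -> : \sum_(k < N) \sum_(i < k) F i (k - i.+1)%N =
   \sum_(k < N) \sum_(i < N | (i < k)%N) F i (k - i.+1)%N.
  apply: eq_bigr => k _.
  by rewrite (big_ord_widen N (fun i => F i (k - i.+1)%N)) ?(ltnW (ltn_ord k)).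
rewrite (exchange_big_dep xpredT)//=; apply: eq_bigr => i _.
have iN := ltn_ord i.
transitivity (\sum_(j < N - i.+1) F i j); last first.
  rewrite (big_ord_widen N (F i)) ?leq_subr//; apply: eq_bigl => j; lia.
rewrite -(big_mkord (fun k => (i < k)%N) (fun k => F i (k - i.+1)%N)).
rewrite (big_cat_nat (n := i.+1))//= big_nat_cond big1 ?add0r; last first.
  by move=> k /andP[/andP[_ ki]]; rewrite ltnNge -ltnS ki.
rewrite -{1}[i.+1]add0n big_addn big_mkord; apply: eq_big => [j|j _].
  by rewrite addnS ltnS leq_addl.
by rewrite addnK.
Qed.

Section low_frequencies.
Context d (T : measurableType d) (R : realType) (Y : nat -> T -> R) (s rho : R) (w : T).
Hypothesis s1 : 1 < s.
Hypothesis rho0 : 0 <= rho.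

Let G (k : nat) : R := Num.sqrt (Y k.*2 w ^+ 2 + Y k.*2.+1 w ^+ 2).
Let sqrG k : G k ^+ 2 = Y k.*2 w ^+ 2 + Y k.*2.+1 w ^+ 2.
Proof. by rewrite sqr_sqrtr// addr_ge0 ?sqr_ge0. Qed.
Let G0 k : 0 <= G k. Proof. exact: sqrtr_ge0. Qed.

Hypothesis energyY : forall n,
  \sum_(i < n) i.+1%:R * (cc s i * G i) ^+ 2 <= rho ^+ 2.

Let v (i : nat) : R := i.+1%:R * (cc s i * G i).
Let v0 i : 0 <= v i.
Proof. by rewrite /v !mulr_ge0// ltW// cc_gt0. Qed.

(** Weighted Cauchy-Schwarz inequality. Adding the index i requires 2 B b_i <= C + A b_i^2, which
    says that the sum of the a_j (b_j - b_i)^2 is nonnegative. *)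
Lemma sqr_sum_le (I : Type) (r : seq I) (a b : I -> R) :
  (forall i, 0 <= a i) -> (forall i, 0 <= b i) ->
  (\sum_(i <- r) a i * b i) ^+ 2 <= (\sum_(i <- r) a i) * \sum_(i <- r) a i * b i ^+ 2.
Proof.
move=> a0 b0; elim: r => [|i r IH]; first by rewrite !big_nil expr0n mul0r.
rewrite !big_cons; move: IH.
set A := \sum_(j <- r) a j; set B := \sum_(j <- r) a j * b j.
set C := \sum_(j <- r) a j * b j ^+ 2 => IH.
have A0 : 0 <= A by exact: sumr_ge0.
have C0 : 0 <= C by apply: sumr_ge0 => j _; rewrite mulr_ge0 ?sqr_ge0.
have B0 : 0 <= B by apply: sumr_ge0 => j _; rewrite mulr_ge0.
have h : 2 * B * b i <= C + A * b i ^+ 2.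
  have : 0 <= \sum_(j <- r) a j * (b j - b i) ^+ 2.
    by apply: sumr_ge0 => j _; rewrite mulr_ge0 ?sqr_ge0.
  rewrite (_ : \sum_(j <- r) _ = C - 2 * B * b i + A * b i ^+ 2); first by lra.
  rewrite /A /B /C !mulr_suml mulr_sumr mulr_suml -sumrB -big_split/=.
  by apply: eq_bigr => j _; ring.
have := ler_wpM2l (a0 i) h; rewrite !expr2 in IH *; nra.
Qed.

Lemma sum_natS_le n : \sum_(i < n) i.+1%:R <= n%:R ^+ 2 :> R.
Proof.
elim: n => [|n IH]; first by rewrite big_ord0 sqr_ge0.
rewrite big_ord_recr/= -natr1.
have : 0 <= n%:R :> R by []. move: IH; rewrite !expr2; nra.
Qed.

(** Cauchy-Schwarz with the frequencies as weights: [v] is n |u_n|, and the energy bounds the sum of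
    n |u_n|^2 by rho^2. *)
Let sum_v n : \sum_(i < n) v i <= n%:R * rho.
Proof.
rewrite -(@ler_pXn2r _ 2)// ?nnegrE ?mulr_ge0 ?sumr_ge0//.
apply: le_trans (sqr_sum_le _ _ _) _ => //.
  by move=> i; rewrite mulr_ge0// ltW// cc_gt0.
by rewrite exprMn ler_pM ?sumr_ge0 ?sum_natS_le// => i _; rewrite mulr_ge0 ?sqr_ge0.
Qed.

Let H (i j : nat) : R := cc s (i + j).+1 * `|Psi s i j| * (G i * G j * G (i + j).+1).

Let HC i j : H i j = H j i.
Proof. by rewrite /H Psi_sym addnC; ring. Qed.

Let H0 i j : 0 <= H i j.
Proof. by rewrite /H !mulr_ge0// ltW// cc_gt0. Qed.

(** The two larger frequencies are separated by 2 x y <= x^2 + y^2; the smallest one stays inside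
    [v], where the energy controls it. *)
Let H_le i j : (i <= j)%N -> 2 * H i j <=
  low_cst s * (v i / (i + j).+2%:R * (G j ^+ 2 + G (i + j).+1 ^+ 2)).
Proof.
move=> ij; have h := cc_Psi_le s1 ij.
have hG : 2 * (G j * G (i + j).+1) <= G j ^+ 2 + G (i + j).+1 ^+ 2.
  by have := sqr_ge0 (G j - G (i + j).+1); rewrite !expr2; lra.
have -> : 2 * H i j = cc s (i + j).+1 * `|Psi s i j| * G i * (2 * (G j * G (i + j).+1)).
  by rewrite /H; ring.
have -> : low_cst s * (v i / (i + j).+2%:R * (G j ^+ 2 + G (i + j).+1 ^+ 2)) =
  low_cst s * (i.+1%:R * cc s i / (i + j).+2%:R) * G i * (G j ^+ 2 + G (i + j).+1 ^+ 2).
  by rewrite /v; ring.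
have c0 := ltW (cc_gt0 s (i + j).+1).
apply: ler_pM => //; rewrite ?mulr_ge0//.
by rewrite ler_wpM2r.
Qed.

Lemma sum_triangle_le (F : nat -> nat -> R) (N : nat) :
  (forall i j, 0 <= F i j) ->
  \sum_(k < N) \sum_(i < k) F i (k - i.+1)%N <=
  \sum_(j < N) \sum_(i < N) F i j.
Proof.
move=> F0; rewrite sum_triangle (exchange_big_dep xpredT)//=; apply: ler_sum => j _.
by rewrite [leLHS]big_mkcond/=; apply: ler_sum => i _; case: ifP.
Qed.

(** The left-hand side is |Im (z w conj(t))|; the difference of the squares of the two sides is the
    square of the real part. *)
Lemma normr_im_mul3_le (p p' q q' x y : R) :
  `|x * (p * q' + p' * q) - y * (p * q - p' * q')| <=
  Num.sqrt (p ^+ 2 + p' ^+ 2) * Num.sqrt (q ^+ 2 + q' ^+ 2) * Num.sqrt (x ^+ 2 + y ^+ 2).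
Proof.
have h (a b : R) : 0 <= a ^+ 2 + b ^+ 2 by rewrite addr_ge0 ?sqr_ge0.
rewrite -(@ler_pXn2r _ 2)// ?nnegrE ?mulr_ge0 ?sqrtr_ge0//.
rewrite !(exprMn 2) !sqr_sqrtr// real_normK ?num_real//.
rewrite -subr_ge0 (_ : _ - _ = (x * (p * q - p' * q') + y * (p * q' + p' * q)) ^+ 2).
  exact: sqr_ge0.
ring.
Qed.

(** After restriction to i <= j, [H_le] leaves two sums, in which the squared modulus of the
    frequency j or k is multiplied by a sum of [v] over smaller frequencies, divided by a number at
    least as large as their count. [sum_v] bounds this multiplier by rho. The 4 is 2 for the
    restriction to i <= j times 2 for the two sums. *)
Lemma normr_cubic_le N :
  `|cubic Y (Psi s) (cc s) N w| <= 4 * low_cst s * rho * sumsq Y N.*2 w.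
Proof.
have sumsqE : sumsq Y N.*2 w = \sum_(k < N) G k ^+ 2.
  rewrite /sumsq; elim: N => [|n IH]; first by rewrite !big_ord0.
  by rewrite doubleS !big_ord_recr/= IH sqrG addrA.
have L0 := low_cst_gt0 s.
have step1 : `|cubic Y (Psi s) (cc s) N w| <=
    \sum_(k < N) \sum_(i < k) 2 * H i (k - i.+1)%N.
  rewrite /cubic; apply: le_trans (ler_norm_sum _ _ _) _; apply: ler_sum => k _.
  rewrite /quadI /quadJ !mulr_sumr -sumrB mulr_sumr.
  apply: le_trans (ler_norm_sum _ _ _) _; apply: ler_sum => i _.
  set j := (k - i.+1)%N.
  have kE : (i + j).+1 = k by rewrite /j; have := ltn_ord i; lia.
  rewrite [X in `|X|](_ : _ = (2 * cc s k * Psi s i j) *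
    (Y k.*2 w * (Y i.*2 w * Y j.*2.+1 w + Y i.*2.+1 w * Y j.*2 w) -
     Y k.*2.+1 w * (Y i.*2 w * Y j.*2 w - Y i.*2.+1 w * Y j.*2.+1 w))); last by ring.
  rewrite normrM (normrM (2 * cc s k)) (@ger0_norm _ (2 * cc s k)); last first.
    by rewrite mulr_ge0// ltW// cc_gt0.
  rewrite /H kE [leRHS](_ : _ = 2 * cc s k * `|Psi s i j| * (G i * G j * G k)); last by ring.
  apply: ler_wpM2l; last exact: normr_im_mul3_le.
  by rewrite !mulr_ge0// ltW// cc_gt0.
pose H1 i j := if (i <= j)%N then 2 * H i j else 0.
have step2 : \sum_(k < N) \sum_(i < k) 2 * H i (k - i.+1)%N <=
    2 * \sum_(k < N) \sum_(i < k) H1 i (k - i.+1)%N.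
  rewrite mulr_sumr; apply: ler_sum => k _.
  rewrite mulrDl !mul1r [X in _ <= X + _](reindex_inj rev_ord_inj)/= -big_split/=.
  apply: ler_sum => i _; have ik := ltn_ord i.
  rewrite (_ : k - (k - i.+1).+1 = i)%N; last by lia.
  rewrite /H1 (HC (k - i.+1)); case: (leqP i (k - i.+1)) => h.
    by rewrite lerDr; case: ifP => // _; rewrite mulr_ge0.
  by rewrite (ltnW h) addr0.
pose F1 i j := if (i <= j)%N then v i / (i + j).+2%:R * G j ^+ 2 else 0.
have step3 : \sum_(k < N) \sum_(i < k) H1 i (k - i.+1)%N <=
   low_cst s * (\sum_(k < N) \sum_(i < k) F1 i (k - i.+1)%N +
     \sum_(k < N) \sum_(i < k) v i / k.+1%:R * G k ^+ 2).
  rewrite -big_split mulr_sumr/=; apply: ler_sum => k _.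
  rewrite -big_split mulr_sumr/=; apply: ler_sum => i _.
  have kE : (i + (k - i.+1)).+1 = k by have := ltn_ord i; lia.
  rewrite /H1 /F1; case: ifP => h.
    by apply: (le_trans (H_le h)); rewrite kE -mulrDr.
  by rewrite add0r !mulr_ge0 ?sqr_ge0 ?invr_ge0// ltW.
have step4 : \sum_(k < N) \sum_(i < k) v i / k.+1%:R * G k ^+ 2 <=
    rho * sumsq Y N.*2 w.
  rewrite sumsqE mulr_sumr; apply: ler_sum => k _.
  rewrite -mulr_suml -mulr_suml ler_wpM2r ?sqr_ge0//.
  rewrite ler_pdivrMr ?ltr0n// mulrC; apply: (le_trans (sum_v k)).
  by rewrite ler_wpM2r// ler_nat.
(* Here j is fixed and i <= j varies; the denominator i + j + 2 is lowered to j + 1, the number of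
   admissible i. *)
have step5 : \sum_(k < N) \sum_(i < k) F1 i (k - i.+1)%N <= rho * sumsq Y N.*2 w.
  apply: le_trans (sum_triangle_le _ _) _.
    by move=> i j; rewrite /F1; case: ifP => // _; rewrite !mulr_ge0 ?sqr_ge0 ?invr_ge0.
  rewrite sumsqE mulr_sumr; apply: ler_sum => j _.
  apply: (@le_trans _ _ (\sum_(i < j.+1) v i / j.+1%:R * G j ^+ 2)).
    rewrite (big_ord_widen N (fun i => v i / j.+1%:R * G j ^+ 2))// big_mkcond/=.
    rewrite [leRHS]big_mkcond/=; apply: ler_sum => i _; rewrite /F1 ltnS.
    case: ifP => // ij; rewrite ler_wpM2r ?sqr_ge0// ler_wpM2l//.
    by rewrite lef_pV2 ?posrE ?ltr0n// ler_nat; lia.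
  rewrite -mulr_suml -mulr_suml ler_wpM2r ?sqr_ge0//.
  by rewrite ler_pdivrMr ?ltr0n// mulrC; exact: sum_v.
apply: (le_trans step1); apply: (le_trans step2).
have := ler_wpM2l (ltW L0) (lerD step5 step4).
have := step3; lra.
Qed.

End low_frequencies.

(** * Fourier coefficients on the torus *)

Section torus_integrals.
Context (R : realType).
Local Notation mu := (@lebesgue_measure R).

Lemma torus_setT : torus R [set: measurableTypeR R] = (2 * pi)%:E.
Proof.
rewrite -[LHS]/(mu ([set: R] `&` `[0%R, 2 * pi]%classic)) setTI lebesgue_measure_itv/=.
by rewrite lte_fin mulr_gt0 ?pi_gt0// sube0.
Qed.

Lemma torus_integrable_bounded (f : R -> R) (M : R) :
  measurable_fun [set: measurableTypeR R] f -> (forall x, `|f x| <= M) ->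
  (torus R).-integrable [set: measurableTypeR R] (EFin \o f).
Proof.
move=> mf fM; apply: measurable_bounded_integrable => //.
  by apply: (@le_lt_trans _ _ (2 * pi)%:E); rewrite ?ltry// -torus_setT.
exists M; split; first exact: num_real.
by move=> y My x _ /=; rewrite (le_trans (fM x))// ltW.
Qed.

Lemma Rintegral_torus (f : R -> R) : (torus R).-integrable [set: measurableTypeR R] (EFin \o f) ->
  \int[torus R]_x f x = \int[mu]_(x in `[0, 2 * pi]) f x.
Proof.
move=> itf; rewrite /Rintegral; congr fine.
have mD : measurable (`[0, 2 * pi]%classic : set (measurableTypeR R)).
  exact: measurable_itv.
rewrite (@negligible_integral _ _ _ (torus R) setT (~` `[0, 2 * pi]%classic))//; last 2 first.
- exact: measurableC.
- by rewrite -[LHS]/(mu (~` `[0, 2 * pi]%classic `&` `[0, 2 * pi]%classic)) setICl measure0.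
rewrite setTD setCK; apply: eq_measure_integral => A mA AD.
by rewrite -[LHS]/(mu (A `&` `[0, 2 * pi]%classic)) setIidl.
Qed.

Lemma measurable_cos_lin (a : R) :
  measurable_fun [set: measurableTypeR R] (fun x : R => cos (a * x)).
Proof.
apply: measurableT_comp; last exact: measurable_funM.
by apply: continuous_measurable_fun; exact: continuous_cos.
Qed.

Lemma measurable_sin_lin (a : R) :
  measurable_fun [set: measurableTypeR R] (fun x : R => sin (a * x)).
Proof.
apply: measurableT_comp; last exact: measurable_funM.
by apply: continuous_measurable_fun; exact: continuous_sin.
Qed.

Lemma cos_int_2pi (m : int) : cos (m%:~R * (2 * pi)) = 1 :> R.
Proof.
have nat (n : nat) : cos (n%:R * (2 * pi)) = 1 :> R.
  rewrite (_ : _ * _ = 0 + (pi *+ 2) *+ n); last by rewrite add0r mulr2n -mulr_natl; ring.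
  by rewrite (periodicn (@cosD2pi R)) cos0.
by case: m => n; [exact: nat|rewrite NegzE mulrNz mulNr cosN; exact: nat].
Qed.

Lemma sin_int_2pi (m : int) : sin (m%:~R * (2 * pi)) = 0 :> R.
Proof.
have nat (n : nat) : sin (n%:R * (2 * pi)) = 0 :> R.
  rewrite (_ : _ * _ = 0 + (pi *+ 2) *+ n); last by rewrite add0r mulr2n -mulr_natl; ring.
  by rewrite (periodicn (@sinD2pi R)) sin0.
by case: m => n; [exact: nat|rewrite NegzE mulrNz mulNr sinN nat oppr0].
Qed.

Lemma Rintegral_torus_deriv (f F : R -> R) :
  continuous f -> (forall x, is_derive x (1 : R) F (f x)) ->
  (torus R).-integrable [set: measurableTypeR R] (EFin \o f) ->
  \int[torus R]_x f x = F (2 * pi) - F 0.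
Proof.
move=> cf dF itf; rewrite Rintegral_torus// /Rintegral.
have cF : continuous F.
  move=> x; apply: differentiable_continuous; apply/derivable1_diffP.
  exact: ex_derive.
rewrite (@continuous_FTC2 _ _ F)//=.
- by rewrite mulr_gt0 ?pi_gt0.
- by apply: continuous_subspaceT => x; exact: cf.
- split.
  + by move=> x _; exact: ex_derive.
  + by apply: cvg_at_right_filter; exact: cF.
  + by apply: cvg_at_left_filter; exact: cF.
- by move=> x _; rewrite derive1E; exact: derive_val.
Qed.

Lemma torus_integrable_cos (a : R) :
  (torus R).-integrable [set: measurableTypeR R] (EFin \o (fun x : R => cos (a * x))).
Proof.
apply: (@torus_integrable_bounded _ 1); first exact: measurable_cos_lin.
by move=> x; rewrite ler_norml cos_geN1 cos_le1.
Qed.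

Lemma torus_integrable_sin (a : R) :
  (torus R).-integrable [set: measurableTypeR R] (EFin \o (fun x : R => sin (a * x))).
Proof.
apply: (@torus_integrable_bounded _ 1); first exact: measurable_sin_lin.
by move=> x; rewrite ler_norml sin_geN1 sin_le1.
Qed.

Lemma Rintegral_torus_cos (m : int) :
  \int[torus R]_x cos (m%:~R * x) = if m == 0 then 2 * pi else 0.
Proof.
case: eqVneq => [->|m0].
  rewrite (_ : \int[torus R]_x _ = \int[torus R]_x (1 : R)); last first.
    by apply: eq_Rintegral => x _; rewrite mul0r cos0.
  by rewrite Rintegral_cst// torus_setT mul1r.
have mR : (m%:~R : R) != 0 by rewrite intr_eq0.
have cf : continuous (fun x : R => cos (m%:~R * x)).
  move=> x; apply: continuous_comp; last exact: continuous_cos.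
  exact: mulrl_continuous.
have dF (x : R) : is_derive x (1 : R) (fun x => sin (m%:~R * x) / m%:~R) (cos (m%:~R * x)).
  apply: is_derive_eq.
  by rewrite /GRing.scale/= !mulr0 add0r mulr1 mulrCA mulVf// mulr1.
rewrite (Rintegral_torus_deriv cf dF (@torus_integrable_cos _)).
by rewrite mulr0 sin0 sin_int_2pi !mul0r subrr.
Qed.

Lemma Rintegral_torus_sin (m : int) : \int[torus R]_x sin (m%:~R * x) = 0.
Proof.
have [->|m0] := eqVneq m 0.
  rewrite (_ : \int[torus R]_x _ = \int[torus R]_x (0 : R)); last first.
    by apply: eq_Rintegral => x _; rewrite mul0r sin0.
  by rewrite Rintegral_cst// mul0r.
have mR : (m%:~R : R) != 0 by rewrite intr_eq0.
have cf : continuous (fun x : R => sin (m%:~R * x)).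
  move=> x; apply: continuous_comp; last exact: continuous_sin.
  exact: mulrl_continuous.
have dF (x : R) : is_derive x (1 : R) (fun x => - cos (m%:~R * x) / m%:~R) (sin (m%:~R * x)).
  apply: is_derive_eq.
  by rewrite /GRing.scale/= !mulr0 add0r mulr1 mulNr opprK mulrCA mulVf// mulr1.
rewrite (Rintegral_torus_deriv cf dF (@torus_integrable_sin _)).
by rewrite mulr0 cos0 cos_int_2pi subrr.
Qed.

End torus_integrals.

Section fourier_coefficients.
Context (R : realType).
Local Open Scope complex_scope.

Lemma complex_eqP (z w : R[i]) :
  complex.Re z = complex.Re w -> complex.Im z = complex.Im w -> z = w.
Proof. by case: z => a b; case: w => c d /= -> ->. Qed.

Lemma ReD (z w : R[i]) : complex.Re (z + w) = complex.Re z + complex.Re w.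
Proof. by case: z => a b; case: w. Qed.
Lemma ImD (z w : R[i]) : complex.Im (z + w) = complex.Im z + complex.Im w.
Proof. by case: z => a b; case: w. Qed.
Lemma ReM (z w : R[i]) : complex.Re (z * w) =
  complex.Re z * complex.Re w - complex.Im z * complex.Im w.
Proof. by case: z => a b; case: w. Qed.
Lemma ImM (z w : R[i]) : complex.Im (z * w) =
  complex.Re z * complex.Im w + complex.Im z * complex.Re w.
Proof. by case: z => a b; case: w. Qed.

Definition cintegrable (f : R -> R[i]) :=
  (torus R).-integrable [set: measurableTypeR R] (EFin \o (@complex.Re R \o f)) /\
  (torus R).-integrable [set: measurableTypeR R] (EFin \o (@complex.Im R \o f)).

Lemma integrableD_EFin (f g : R -> R) :
  (torus R).-integrable [set: measurableTypeR R] (EFin \o f) ->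
  (torus R).-integrable [set: measurableTypeR R] (EFin \o g) ->
  (torus R).-integrable [set: measurableTypeR R] (EFin \o (fun x => f x + g x)).
Proof. by move=> hf hg; have := integrableD measurableT hf hg. Qed.

Lemma integrableZ_EFin (a : R) (f : R -> R) :
  (torus R).-integrable [set: measurableTypeR R] (EFin \o f) ->
  (torus R).-integrable [set: measurableTypeR R] (EFin \o (fun x => a * f x)).
Proof. by move=> hf; have := integrableZl measurableT a hf. Qed.

Lemma cintegrableD f g : cintegrable f -> cintegrable g ->
  cintegrable (fun x => f x + g x).
Proof.
move=> [f1 f2] [g1 g2]; split.
  rewrite (_ : _ \o (fun x => _ + _) = fun x => complex.Re (f x) + complex.Re (g x)).
    exact: integrableD_EFin.
  by apply/funext => x /=; rewrite ReD.
rewrite (_ : _ \o (fun x => _ + _) = fun x => complex.Im (f x) + complex.Im (g x)).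
  exact: integrableD_EFin.
by apply/funext => x /=; rewrite ImD.
Qed.

Lemma cintegrableZ (a : R[i]) f : cintegrable f -> cintegrable (fun x => a * f x).
Proof.
move=> [f1 f2]; split.
  rewrite (_ : _ \o (fun x => _ * _) = fun x => complex.Re a * complex.Re (f x)
     + (- complex.Im a) * complex.Im (f x)).
    by apply: integrableD_EFin; exact: integrableZ_EFin.
  by apply/funext => x /=; rewrite ReM mulNr.
rewrite (_ : _ \o (fun x => _ * _) = fun x => complex.Re a * complex.Im (f x)
     + complex.Im a * complex.Re (f x)).
  by apply: integrableD_EFin; exact: integrableZ_EFin.
by apply/funext => x /=; rewrite ImM.
Qed.

Lemma cintegralD f g : cintegrable f -> cintegrable g ->
  cintegral (fun x => f x + g x) = cintegral f + cintegral g.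
Proof.
move=> [f1 f2] [g1 g2]; apply: complex_eqP; rewrite ?ReD ?ImD /=.
  by rewrite -RintegralD//; apply: eq_Rintegral => x _; rewrite ReD.
by rewrite -RintegralD//; apply: eq_Rintegral => x _; rewrite ImD.
Qed.

Lemma cintegralZ (a : R[i]) f : cintegrable f ->
  cintegral (fun x => a * f x) = a * cintegral f.
Proof.
move=> [f1 f2]; apply: complex_eqP; rewrite ?ReM ?ImM /=.
  rewrite -!RintegralZl// -RintegralB//; last 2 first.
  - exact: integrableZ_EFin.
  - exact: integrableZ_EFin.
  by apply: eq_Rintegral => x _; rewrite ReM.
rewrite -!RintegralZl// -RintegralD//; last 2 first.
- exact: integrableZ_EFin.
- exact: integrableZ_EFin.
by apply: eq_Rintegral => x _; rewrite ImM.
Qed.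

Lemma cintegrable_expi m : cintegrable (@expi R m).
Proof. by split; [exact: torus_integrable_cos|exact: torus_integrable_sin]. Qed.

Lemma cintegral_expi (m : int) :
  cintegral (@expi R m) = if m == 0 then (2 * pi)%:C else 0.
Proof.
rewrite /cintegral /expi/= Rintegral_torus_cos Rintegral_torus_sin.
by case: ifP.
Qed.

(** The index type is arbitrary so that the square of a trigonometric sum, indexed by pairs, is
    covered as well. *)
Lemma cintegral_trig_poly (I : Type) (r : seq I) (c : I -> R[i]) (m : I -> int) :
  cintegrable (fun x => \sum_(i <- r) c i * expi (m i) x) /\
  cintegral (fun x => \sum_(i <- r) c i * expi (m i) x) =
  (2 * pi)%:C * \sum_(i <- r | m i == 0) c i.
Proof.
elim: r => [|i r [IH1 IH2]].
  rewrite (_ : (fun _ => _) = fun x => 0 * @expi R 0 x); last first.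
    by apply/funext => x; rewrite big_nil mul0r.
  split; first by apply: cintegrableZ; exact: cintegrable_expi.
  rewrite big_nil mulr0 cintegralZ ?mul0r//; exact: cintegrable_expi.
rewrite (_ : (fun _ => _) = fun x => c i * @expi R (m i) x +
   \sum_(j <- r) c j * expi (m j) x); last first.
  by apply/funext => x; rewrite big_cons.
have h : cintegrable (fun x => c i * @expi R (m i) x).
  by apply: cintegrableZ; exact: cintegrable_expi.
split; first exact: cintegrableD.
rewrite cintegralD// IH2 cintegralZ; last exact: cintegrable_expi.
rewrite cintegral_expi big_cons; case: ifP => _; last by rewrite mulr0 add0r.
by rewrite [RHS]mulrDr [c i * _]mulrC.
Qed.

Lemma expiD m n (x : R) : expi m x * expi n x = expi (m + n) x.
Proof.
by apply: complex_eqP; rewrite ?ReM ?ImM /expi /= intrD mulrDl ?cosD ?sinD// addrC.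
Qed.

Lemma conjc_expi m (x : R) : conjc (expi m x) = expi (- m) x.
Proof. by rewrite /expi /= mulrNz mulNr cosN sinN. Qed.

Lemma torus_integrableM (f b : R -> R) :
  (torus R).-integrable [set: measurableTypeR R] (EFin \o f) ->
  measurable_fun [set: measurableTypeR R] b -> (forall x, `|b x| <= 1) ->
  (torus R).-integrable [set: measurableTypeR R] (EFin \o (fun x => f x * b x)).
Proof.
move=> itf mb b1; apply: (le_integrable _ _ _ itf) => //.
  apply/measurable_EFinP; apply: measurable_funM => //.
  by apply/measurable_EFinP; case/integrableP: itf.
by move=> x _ /=; rewrite lee_fin normrM ler_piMr.
Qed.

Lemma normr_cos_le1 (x : R) : `|cos x| <= 1.
Proof. by rewrite ler_norml cos_geN1 cos_le1. Qed.

Lemma normr_sin_le1 (x : R) : `|sin x| <= 1.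
Proof. by rewrite ler_norml sin_geN1 sin_le1. Qed.

Lemma Re_fourier (f : R -> R) n : complex.Re (fourier f n) =
  (2 * pi)^-1 * \int[torus R]_x (f x * cos (n%:~R * x)).
Proof.
rewrite /fourier ReM /cintegral/= mul0r subr0; congr (_ * _).
by apply: eq_Rintegral => x _; rewrite mul0r subr0 mulrNz mulNr cosN.
Qed.

Lemma Im_fourier (f : R -> R) n :
  (torus R).-integrable [set: measurableTypeR R] (EFin \o f) ->
  complex.Im (fourier f n) =
  - (2 * pi)^-1 * \int[torus R]_x (f x * sin (n%:~R * x)).
Proof.
move=> itf; rewrite /fourier ImM /cintegral/= mul0r addr0 mulNr -mulrN; congr (_ * _).
rewrite -mulN1r -RintegralZl//; last first.
  apply: torus_integrableM => //; first exact: measurable_sin_lin.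
  by move=> x; exact: normr_sin_le1.
by apply: eq_Rintegral => x _; rewrite mul0r addr0 mulrNz mulNr sinN; ring.
Qed.

Lemma fourierN (f : R -> R) n :
  (torus R).-integrable [set: measurableTypeR R] (EFin \o f) ->
  fourier f (- n) = conjc (fourier f n).
Proof.
move=> itf; have Rec (z : R[i]) : complex.Re (conjc z) = complex.Re z by case: z.
have Imc (z : R[i]) : complex.Im (conjc z) = - complex.Im z by case: z.
apply: complex_eqP; rewrite ?Rec ?Imc.
  rewrite !Re_fourier; congr (_ * _); apply: eq_Rintegral => x _.
  by rewrite mulrNz mulNr cosN.
rewrite !Im_fourier// -mulrN; congr (_ * _); rewrite -mulN1r -RintegralZl//; last first.
  apply: torus_integrableM => //; first exact: measurable_sin_lin.
  by move=> x; exact: normr_sin_le1.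
by apply: eq_Rintegral => x _; rewrite mulrNz mulNr sinN; ring.
Qed.

Definition conj_sym (c : int -> R[i]) := forall n, c (- n) = conjc (c n).

(** Reversing the index exchanges the frequencies n and -n, so the sum is its own conjugate. *)
Lemma trig_sumE (c : int -> R[i]) N (x : R) : conj_sym c ->
  (trig_sum c N x)%:C = \sum_(k < N.*2.+1)
    c (k%:Z - N%:Z) * expi (k%:Z - N%:Z) x.
Proof.
move=> cs; rewrite /trig_sum big_mkord.
set z := \sum_(k < _) _; have zc : conjc z = z.
  rewrite /z rmorph_sum (reindex_inj rev_ord_inj); apply: eq_bigr => k _.
  have e : - ((N.*2.+1 - k.+1)%N%:Z - N%:Z) = k%:Z - N%:Z by have := ltn_ord k; lia.
  by rewrite rmorphM -[LHS]/(conjc (c _) * conjc (expi _ _)) conjc_expi -cs e.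
by case: z zc => a b [] /= h; apply: complex_eqP => //=; lra.
Qed.

Lemma sum_ord_shift_eq (V : nmodType) (N : nat) (n : int) (F : int -> V) :
  \sum_(k < N.*2.+1 | k%:Z - N%:Z - n == 0) F (k%:Z - N%:Z) =
  if (`|n| <= N)%N then F n else 0.
Proof.
case: ifP => h.
  have hk : (absz (n + N%:Z)%R < N.*2.+1)%N by lia.
  rewrite (big_pred1 (Ordinal hk))/=; first by congr F; lia.
  by move=> k /=; rewrite -val_eqE/=; lia.
by apply: big1 => k hk; have := ltn_ord k; lia.
Qed.

Lemma twopiVK : ((2 * pi)^-1)%:C * (2 * pi)%:C = 1 :> R[i].
Proof.
by apply: complex_eqP => /=; rewrite ?mulr0 ?mul0r ?addr0// subr0 mulVf// mulf_neq0// gt_eqF// pi_gt0.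
Qed.

Lemma fourier_trig_sum (c : int -> R[i]) N (n : int) : conj_sym c ->
  fourier (trig_sum c N) n = if (`|n| <= N)%N then c n else 0.
Proof.
move=> cs; rewrite -(sum_ord_shift_eq N n c) /fourier.
have [_] := cintegral_trig_poly (index_enum 'I_N.*2.+1)
  (fun k => c (k%:Z - N%:Z)) (fun k => k%:Z - N%:Z - n).
rewrite (_ : (fun x => \sum_(i <- _) _) =
   (fun x => (trig_sum c N x)%:C * expi (- n) x)); last first.
  apply/funext => x; rewrite trig_sumE// mulr_suml; apply: eq_bigr => k _.
  by rewrite -mulrA expiD.
by move=> ->; rewrite mulrA twopiVK mul1r.
Qed.

Lemma fourier_trig_sum_sqr (c : int -> R[i]) N (n : int) : conj_sym c ->
  fourier (fun x => trig_sum c N x ^+ 2) n =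
  \sum_(k < N.*2.+1) if (absz (n - (k%:Z - N%:Z))%R <= N)%N
     then c (k%:Z - N%:Z) * c (n - (k%:Z - N%:Z)) else 0.
Proof.
move=> cs; rewrite /fourier.
have [_] := cintegral_trig_poly (index_enum ('I_N.*2.+1 * 'I_N.*2.+1)%type)
  (fun p => c (p.1%:Z - N%:Z) * c (p.2%:Z - N%:Z))
  (fun p => p.1%:Z - N%:Z + (p.2%:Z - N%:Z) - n).
rewrite (_ : (fun x => \sum_(i <- _) _) =
   (fun x => (trig_sum c N x ^+ 2)%:C * expi (- n) x)); last first.
  apply/funext => x; rewrite rmorphXn/= trig_sumE// expr2 big_distrlr/= pair_bigA/= mulr_suml.
  apply: eq_bigr => p _; rewrite mulrACA expiD.
  by rewrite -[RHS]mulrA expiD.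
move=> ->; rewrite mulrA twopiVK mul1r.
rewrite -(pair_big_dep xpredT
  (fun (k l : 'I_N.*2.+1) => k%:Z - N%:Z + (l%:Z - N%:Z) - n == 0)
  (fun k l => c (k%:Z - N%:Z) * c (l%:Z - N%:Z)))/=.
apply: eq_bigr => k _.
rewrite -(sum_ord_shift_eq N (n - (k%:Z - N%:Z)) (fun m => c (k%:Z - N%:Z) * c m)).
by apply: eq_bigl => l; lia.
Qed.

End fourier_coefficients.

(** * Fourier coefficients as Lipschitz functionals of the L2 class *)

Section square_integrable.
Context (R : realType).
Local Open Scope complex_scope.

Lemma Lfun2_cst1 : (cst 1 : R -> R) \in Lfun (torus R) 2%:E.
Proof.
rewrite inE; apply/andP; split; rewrite inE//=.
rewrite /finite_norm (_ : EFin \o (cst 1 : R -> R) = cst 1%E)// Lnorm_cst1.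
by rewrite torus_setT poweR_lty// ltry.
Qed.

Lemma Lfun2_integrable (f : R -> R) : f \in Lfun (torus R) 2%:E ->
  (torus R).-integrable [set: measurableTypeR R] (EFin \o f).
Proof.
move=> f2; apply/Lfun1_integrable.
rewrite (_ : f = f \* cst 1)%R; last by apply/funext => x /=; rewrite mulr1.
exact: Lfun2_mul_Lfun1 f2 Lfun2_cst1.
Qed.

Definition L1L2_cst : R := fine (L2norm (cst 1 : R -> R)).

Lemma L1L2_cst_ge0 : 0 <= L1L2_cst.
Proof. by rewrite fine_ge0// Lnorm_ge0. Qed.

Lemma normr_pairing_le (f b : R -> R) : f \in Lfun (torus R) 2%:E ->
  measurable_fun [set: measurableTypeR R] b -> (forall x, `|b x| <= 1) ->
  (`|\int[torus R]_x (f x * b x)|%:E <= L1L2_cst%:E * L2norm f)%E.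
Proof.
move=> f2 mb b1; have itf := Lfun2_integrable f2.
have mf : measurable_fun [set: measurableTypeR R] f.
  by apply/measurable_EFinP; case/integrableP: itf.
have itfb := torus_integrableM itf mb b1.
rewrite EFin_normr_Rintegral//.
apply: le_trans (le_abse_integral _ _ _) _ => //; first by case/integrableP: itfb.
apply: (@le_trans _ _ ('N[torus R]_1[EFin \o (f \* cst 1%R)%R])%E).
  rewrite Lnorm1; apply: ge0_le_integral => //.
  - by apply: measurableT_comp => //; case/integrableP: itfb.
  - apply: measurableT_comp => //; apply/measurable_EFinP.
    exact: measurable_funM.
  - by move=> x _ /=; rewrite lee_fin mulr1 normrM ler_piMr.
apply: le_trans.
  apply: (@hoelder _ _ _ (torus R) f (cst 1) 2 2) => //.
  by rewrite [RHS]splitr !div1r.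
rewrite muleC lee_wpmul2r ?Lnorm_ge0//.
rewrite /L1L2_cst fineK//.
by have := Lfun2_cst1; rewrite inE => /andP[_]; rewrite inE/= /finite_norm ge0_fin_numE ?Lnorm_ge0.
Qed.

Lemma Lfun2_sub (f g : R -> R) : f \in Lfun (torus R) 2%:E ->
  g \in Lfun (torus R) 2%:E -> (f \- g)%R \in Lfun (torus R) 2%:E.
Proof.
move=> f2 g2.
have -> : (f \- g)%R = (-1) *: g + f.
  by apply/funext => x; rewrite /= scaleN1r addrC.
by have [_] := @Lfun_submod_closed _ _ R (torus R) 2%:E (lee1n 2); apply.
Qed.

Definition coef_cst : R := (2 * pi)^-1 * L1L2_cst.

Lemma coef_cst_ge0 : 0 <= coef_cst.
Proof. by rewrite /coef_cst mulr_ge0 ?L1L2_cst_ge0// invr_ge0 mulr_ge0// pi_ge0. Qed.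

Lemma Re_fourier_lip (f g : R -> R) n : f \in Lfun (torus R) 2%:E ->
  g \in Lfun (torus R) 2%:E ->
  (`|complex.Re (fourier f n) - complex.Re (fourier g n)|%:E <=
   coef_cst%:E * L2norm (f \- g)%R)%E.
Proof.
move=> f2 g2; have itf := Lfun2_integrable f2; have itg := Lfun2_integrable g2.
have mc := @measurable_cos_lin R n%:~R.
have c1 (x : R) := normr_cos_le1 (n%:~R * x).
rewrite !Re_fourier -mulrBr -RintegralB//; last 2 first.
- exact: torus_integrableM.
- exact: torus_integrableM.
rewrite (_ : \int[torus R]_x _ = \int[torus R]_x ((f \- g)%R x * cos (n%:~R * x))); last first.
  by apply: eq_Rintegral => x _; rewrite /= mulrBl.
have p0 : 0 <= (2 * pi)^-1 :> R by rewrite invr_ge0 mulr_ge0// pi_ge0.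
rewrite normrM (ger0_norm p0) /coef_cst !EFinM -muleA lee_wpmul2l ?lee_fin//.
by apply: normr_pairing_le => //; exact: Lfun2_sub.
Qed.

Lemma Im_fourier_lip (f g : R -> R) n : f \in Lfun (torus R) 2%:E ->
  g \in Lfun (torus R) 2%:E ->
  (`|complex.Im (fourier f n) - complex.Im (fourier g n)|%:E <=
   coef_cst%:E * L2norm (f \- g)%R)%E.
Proof.
move=> f2 g2; have itf := Lfun2_integrable f2; have itg := Lfun2_integrable g2.
have mc := @measurable_sin_lin R n%:~R.
have c1 (x : R) := normr_sin_le1 (n%:~R * x).
rewrite !Im_fourier// -mulrBr -RintegralB//; last 2 first.
- exact: torus_integrableM.
- exact: torus_integrableM.
rewrite (_ : \int[torus R]_x _ = \int[torus R]_x ((f \- g)%R x * sin (n%:~R * x))); last first.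
  by apply: eq_Rintegral => x _; rewrite /= mulrBl.
have p0 : 0 <= (2 * pi)^-1 :> R by rewrite invr_ge0 mulr_ge0// pi_ge0.
rewrite normrM normrN (ger0_norm p0) /coef_cst !EFinM -muleA lee_wpmul2l ?lee_fin//.
by apply: normr_pairing_le => //; exact: Lfun2_sub.
Qed.

Lemma lipschitz_measurable_L20 (f : L20fun R -> R) (K : R) : 0 <= K ->
  (forall u v : L20fun R, (`|f u - f v|%:E <= K%:E * L2norm (u \- v)%R)%E) ->
  measurable_fun [set: L20 R] (f : L20 R -> R).
Proof.
move=> K0 lipf; apply: (measurability _ (RGenOpens.measurableE R)) => //.
move=> _ [_ [a [b ->] <-]].
rewrite setTI; apply: sub_sigma_algebra => u /=.
rewrite in_itv/= => /andP[au ub].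
pose e := Num.min (f u - a) (b - f u).
have e0 : 0 < e by rewrite lt_min !subr_gt0 au.
(* K may be zero, hence the division by K + 1. *)
have K1 : 0 < K + 1 by lra.
exists (e / (K + 1)); first by rewrite divr_gt0.
move=> v vu; have : `|f v - f u| < e.
  rewrite -lte_fin; apply: (le_lt_trans (lipf v u)).
  apply: (@le_lt_trans _ _ ((K + 1)%:E * L2norm (v \- u)%R)%E).
    by rewrite lee_wpmul2r ?Lnorm_ge0// lee_fin lerDl.
  by rewrite -lte_pdivlMl// muleC -EFinM.
rewrite lt_min => /andP[]; rewrite in_itv/= !ltr_norml; lra.
Qed.

Lemma L20_Lfun2 (u : L20fun R) : (u : R -> R) \in Lfun (torus R) 2%:E.
Proof. exact: LfunP. Qed.

Lemma L20_integrable (u : L20fun R) :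
  (torus R).-integrable [set: measurableTypeR R] (EFin \o u).
Proof. exact: Lfun2_integrable (L20_Lfun2 u). Qed.

Lemma measurable_Re_fourier n :
  measurable_fun [set: L20 R] (fun u : L20 R => complex.Re (fourier u n)).
Proof.
apply: (@lipschitz_measurable_L20 (fun u => complex.Re (fourier u n)) coef_cst).
  exact: coef_cst_ge0.
by move=> u v; apply: Re_fourier_lip; exact: L20_Lfun2.
Qed.

Lemma measurable_Im_fourier n :
  measurable_fun [set: L20 R] (fun u : L20 R => complex.Im (fourier u n)).
Proof.
apply: (@lipschitz_measurable_L20 (fun u => complex.Im (fourier u n)) coef_cst).
  exact: coef_cst_ge0.
by move=> u v; apply: Im_fourier_lip; exact: L20_Lfun2.
Qed.

Lemma conj_sym_fourier (u : L20fun R) : conj_sym (fourier u).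
Proof. by move=> n; apply: fourierN; exact: L20_integrable. Qed.

Lemma fourier_L20_0 (u : L20fun R) : fourier u 0 = 0.
Proof.
have hc : \int[torus R]_x (u x * cos (0%:~R * x)) = 0.
  by rewrite -(L20_avg u); apply: eq_Rintegral => x _; rewrite mul0r cos0 mulr1.
have hs : \int[torus R]_x (u x * sin (0%:~R * x)) = 0.
  transitivity (\int[torus R]_x (0 : R)); last by rewrite Rintegral_cst// mul0r.
  by apply: eq_Rintegral => x _; rewrite mul0r sin0 mulr0.
apply: complex_eqP; first by rewrite Re_fourier hc mulr0.
by rewrite Im_fourier ?hs ?mulr0//; exact: L20_integrable.
Qed.

Lemma sqr_normc (z : R[i]) :
  Normc.normc z ^+ 2 = complex.Re z ^+ 2 + complex.Im z ^+ 2.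
Proof. by case: z => a b /=; rewrite sqr_sqrtr// addr_ge0 ?sqr_ge0. Qed.

Lemma sqHnorm_truncP (sigma : R) N (u : L20fun R) :
  sqHnorm sigma (truncP N u) =
  (\sum_(k < N) k.+1%:R `^ (2 * sigma) *
    (complex.Re (fourier u k.+1) ^+ 2 + complex.Im (fourier u k.+1) ^+ 2))%:E.
Proof.
rewrite /sqHnorm (nneseries_split 1 N) => [|k _]; last first.
  by rewrite lee_fin mulr_ge0 ?powR_ge0// sqr_ge0.
have cs := conj_sym_fourier u.
rewrite [X in (_ + X)%E]eseries0 ?adde0 => [|k Nk _]; last first.
  rewrite /truncP fourier_trig_sum// absz_nat (_ : (k <= N)%N = false); last by lia.
  by rewrite sqr_normc/= expr0n/= addr0 mulr0.
rewrite add1n big_add1 big_mkord sumEFin; congr EFin; apply: eq_bigr => k _.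
by rewrite /truncP fourier_trig_sum// absz_nat ltn_ord sqr_normc.
Qed.

End square_integrable.

(** * The time derivative of the truncated norm *)

Section flow_formula.
Context (R : realType).
Local Open Scope complex_scope.

Lemma Lfun2_sqr_integrable (f : R -> R) :
  measurable_fun [set: measurableTypeR R] f ->
  (torus R).-integrable [set: measurableTypeR R] (EFin \o (fun x => f x ^+ 2)) ->
  f \in Lfun (torus R) 2%:E.
Proof.
move=> mf /integrableP[_ itf]; rewrite inE; apply/andP; split; rewrite inE//=.
rewrite /finite_norm unlock poweR_lty//.
move: itf; congr (_ < _)%E; apply: eq_integral => x _ /=.
by rewrite powR_mulrn// normrX.
Qed.

Lemma trig_sum_integrable (c : int -> R[i]) N : conj_sym c ->
  (torus R).-integrable [set: measurableTypeR R] (EFin \o trig_sum c N).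
Proof.
move=> cs; have [[h _] _] := cintegral_trig_poly (index_enum 'I_N.*2.+1)
  (fun k => c (k%:Z - N%:Z)) (fun k => k%:Z - N%:Z).
rewrite (_ : trig_sum c N = @complex.Re R \o (fun x => \sum_(k < N.*2.+1)
    c (k%:Z - N%:Z) * expi (k%:Z - N%:Z) x)) //.
by apply/funext => x; rewrite [RHS]/= -trig_sumE.
Qed.

Lemma trig_sum_sqr_integrable (c : int -> R[i]) N : conj_sym c ->
  (torus R).-integrable [set: measurableTypeR R] (EFin \o (fun x => trig_sum c N x ^+ 2)).
Proof.
move=> cs; have [[h _] _] := cintegral_trig_poly (index_enum ('I_N.*2.+1 * 'I_N.*2.+1)%type)
  (fun p => c (p.1%:Z - N%:Z) * c (p.2%:Z - N%:Z))
  (fun p => p.1%:Z - N%:Z + (p.2%:Z - N%:Z)).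
rewrite (_ : (fun x => trig_sum c N x ^+ 2) = @complex.Re R \o (fun x =>
  \sum_(p : 'I_N.*2.+1 * 'I_N.*2.+1) c (p.1%:Z - N%:Z) * c (p.2%:Z - N%:Z) *
     expi (p.1%:Z - N%:Z + (p.2%:Z - N%:Z)) x))//.
apply/funext => x /=.
transitivity (complex.Re ((trig_sum c N x)%:C ^+ 2)).
  by rewrite !expr2 /= mul0r subr0.
rewrite trig_sumE// expr2 big_distrlr/= pair_bigA/=; congr (complex.Re _).
by apply: eq_bigr => p _; rewrite mulrACA expiD.
Qed.

Lemma trig_sum_Lfun2 (c : int -> R[i]) N : conj_sym c ->
  trig_sum c N \in Lfun (torus R) 2%:E.
Proof.
move=> cs; apply: Lfun2_sqr_integrable; last exact: trig_sum_sqr_integrable.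
by apply/measurable_EFinP; case/integrableP: (trig_sum_integrable N cs).
Qed.

Lemma sum_ord_center (V : nmodType) N (G : nat -> V) :
  \sum_(j < N.*2.+1) G j =
  \sum_(i < N) G (N - i.+1)%N + G N + \sum_(i < N) G (N + i.+1)%N.
Proof.
rewrite -addnn -addnS big_split_ord/= big_ord_recl/= addn0 addrA.
by rewrite -(sum_ord_rev N G).
Qed.

(** Two frequencies adding up to k + 1 > 0 are both positive, or exactly one of them is negative;
    the two mixed cases are mirror images, whence the 2, and frequency 0 drops out because c(0) =
    0. *)
Lemma convolution_trig_sum (c : int -> R[i]) N k : conj_sym c -> c 0 = 0 ->
  (k < N)%N ->
  fourier (fun x => trig_sum c N x ^+ 2) k.+1 =
  \sum_(i < k) c i.+1 * c (k - i)%N +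
  2 * \sum_(j < N | ((k + j).+1 < N)%N) c (k + j).+2 * conjc (c j.+1).
Proof.
move=> cs c0 kN; rewrite fourier_trig_sum_sqr//.
pose G (j : nat) := if (absz (k.+1%:Z - (j%:Z - N%:Z))%R <= N)%N
   then c (j%:Z - N%:Z) * c (k.+1%:Z - (j%:Z - N%:Z)) else 0.
rewrite (sum_ord_center N G).
have -> : G N = 0 by rewrite /G subrr c0 mul0r if_same.
have -> : \sum_(i < N) G (N - i.+1)%N =
    \sum_(j < N | ((k + j).+1 < N)%N) c (k + j).+2 * conjc (c j.+1).
  rewrite [RHS]big_mkcond/=; apply: eq_bigr => i _; have iN := ltn_ord i.
  have e1 : (N - i.+1)%N%:Z - N%:Z = - i.+1%:Z by lia.
  have e2 : k.+1%:Z - - i.+1%:Z = (k + i).+2 by lia.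
  by rewrite /G e1 e2 absz_nat -cs mulrC.
have -> : \sum_(i < N) G (N + i.+1)%N = \sum_(i < N) c i.+1 * c (k%:Z - i%:Z).
  apply: eq_bigr => i _; have iN := ltn_ord i.
  have e1 : (N + i.+1)%N%:Z - N%:Z = i.+1 by lia.
  have e2 : k.+1%:Z - i.+1%:Z = k%:Z - i%:Z by lia.
  by rewrite /G e1 e2 ifT//; lia.
have -> : \sum_(i < N) c i.+1 * c (k%:Z - i%:Z) =
   \sum_(i < k) c i.+1 * c (k - i)%N +
   \sum_(j < N | ((k + j).+1 < N)%N) c (k + j).+2 * conjc (c j.+1).
  pose H (i : nat) := c i.+1 * c (k%:Z - i%:Z).
  rewrite -[LHS]/(\sum_(i < N) H i).
  have eN : N = (k + (N - k.+1).+1)%N by lia.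
  rewrite [in LHS]eN big_split_ord/= big_ord_recl/= addn0 {2}/H subrr c0 mulr0 add0r.
  congr (_ + _).
    apply: eq_bigr => i _; have ik := ltn_ord i.
    by rewrite /H (_ : k%:Z - i%:Z = (k - i)%N)//; lia.
  rewrite (big_ord_widen N (fun j => H (k + (bump 0 j))%N)) ?leq_subr//.
  apply: eq_big => [j|j _]; first by lia.
  rewrite /H /bump add1n addnS (_ : k%:Z - (k + j).+1%:Z = - j.+1%:Z); last by lia.
  by rewrite cs.
by rewrite addr0 mulrDl mul1r addrCA.
Qed.

Definition cubic_im (c : int -> R[i]) (i j : nat) : R :=
  complex.Im (c i.+1 * c j.+1 * conjc (c (i + j).+2)).

Lemma cubic_imC c i j : cubic_im c i j = cubic_im c j i.
Proof. by rewrite /cubic_im addnC (mulrC (c i.+1)). Qed.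

Lemma Im_sum (I : Type) (r : seq I) (P : pred I) (f : I -> R[i]) :
  complex.Im (\sum_(i <- r | P i) f i) = \sum_(i <- r | P i) complex.Im (f i).
Proof.
elim: r => [|i r IH]; first by rewrite !big_nil.
by rewrite !big_cons; case: ifP => _; rewrite ?ImD IH.
Qed.

(** A triple a + b = n occurs with weight p(n) when n is the output frequency. When a or b is the
    output, the cubic product is conjugated, so the imaginary part changes sign and the weights p(a)
    and p(b) are subtracted; symmetry in a and b shares the factor 2 between them. *)
Lemma cubic_resummation (c : int -> R[i]) (p : nat -> R) N :
  conj_sym c -> c 0 = 0 ->
  \sum_(k < N) p k.+1 * complex.Im (conjc (c k.+1) *
     fourier (fun x => trig_sum c N x ^+ 2) k.+1) =
  \sum_(k < N) \sum_(i < k) (p k.+1 - p i.+1 - p (k - i)%N) * cubic_im c i (k - i.+1)%N.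
Proof.
move=> cs c0.
have -> : \sum_(k < N) p k.+1 * complex.Im (conjc (c k.+1) *
     fourier (fun x => trig_sum c N x ^+ 2) k.+1) =
  \sum_(k < N) \sum_(i < k) p k.+1 * cubic_im c i (k - i.+1)%N -
  2 * \sum_(k < N) \sum_(j < N | ((k + j).+1 < N)%N) p k.+1 * cubic_im c k j.
  rewrite mulr_sumr -sumrB; apply: eq_bigr => k _.
  rewrite convolution_trig_sum// mulrDr ImD mulrDr; congr (_ + _).
    rewrite mulr_sumr Im_sum mulr_sumr; apply: eq_bigr => i _; congr (_ * _).
    have ik := ltn_ord i; rewrite /cubic_im.
    rewrite (_ : (k - i.+1).+1 = k - i)%N; last by lia.
    by rewrite (_ : (i + (k - i.+1)).+2 = k.+1)%N ?(mulrC (conjc _))//; lia.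
  have Im2 (z : R[i]) : complex.Im (2 * z) = 2 * complex.Im z.
    by rewrite !mulrDl !mul1r ImD.
  rewrite [conjc _ * _]mulrCA Im2 mulrCA -mulrN; congr (2 * _).
  rewrite [conjc _ * _]mulr_sumr Im_sum mulr_sumr -sumrN.
  apply: eq_bigr => j _; rewrite -mulrN; congr (_ * _); rewrite /cubic_im.
  case: (c k.+1) => a b; case: (c (k + j).+2) => a' b'; case: (c j.+1) => a'' b''.
  by rewrite /=; ring.
have sym : \sum_(k < N) \sum_(j < N | ((k + j).+1 < N)%N) p k.+1 * cubic_im c k j =
    \sum_(k < N) \sum_(j < N | ((k + j).+1 < N)%N) p j.+1 * cubic_im c k j.
  rewrite (exchange_big_dep xpredT)//=; apply: eq_bigr => j _.
  by apply: eq_big => [k|k _]; rewrite 1?addnC// cubic_imC.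
rewrite mulrDl mul1r {2}sym.
rewrite -(sum_triangle (fun i j => p i.+1 * cubic_im c i j)).
rewrite -(sum_triangle (fun i j => p j.+1 * cubic_im c i j)).
rewrite -big_split -sumrB/=; apply: eq_bigr => k _.
rewrite -big_split -sumrB/=; apply: eq_bigr => i _; have ik := ltn_ord i.
by rewrite (_ : (k - i.+1).+1 = k - i)%N; [ring|lia].
Qed.

End flow_formula.

Section time_derivative.
Context (R : realType).
Local Open Scope complex_scope.

Lemma is_derive1_sum (I : Type) (r : seq I) (f : I -> R -> R) (df : I -> R) (x : R) :
  (forall i, is_derive x (1 : R) (f i) (df i)) ->
  is_derive x (1 : R) (fun t => \sum_(i <- r) f i t) (\sum_(i <- r) df i).
Proof.
move=> h; elim: r => [|i r IH].
  rewrite big_nil (_ : (fun _ => _) = cst 0); first exact: is_derive_cst.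
  by apply/funext => t; rewrite big_nil.
rewrite big_cons (_ : (fun _ => _) = f i + (fun t => \sum_(j <- r) f j t)).
  exact: is_deriveD.
by apply/funext => t; rewrite big_cons.
Qed.

Lemma is_derive1_sqr (f : R -> R) (df x : R) : is_derive x (1 : R) f df ->
  is_derive x (1 : R) (fun t => f t ^+ 2) (2 * (f x * df)).
Proof.
move=> h; rewrite (_ : (fun t => f t ^+ 2) = f * f); last first.
  by apply/funext => t; rewrite /= expr2.
by apply: is_derive_eq; rewrite /GRing.scale/=; ring.
Qed.

Lemma is_derive1_scale (a : R) (f : R -> R) (df x : R) : is_derive x (1 : R) f df ->
  is_derive x (1 : R) (fun t => a * f t) (a * df).
Proof. by move=> h; apply: is_derive_eq; rewrite /GRing.scale/=. Qed.

Lemma is_derive1_unique (f : R -> R) (x a b : R) :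
  is_derive x (1 : R) f a -> is_derive x (1 : R) f b -> a = b.
Proof. by move=> ha hb; rewrite -(@derive_val _ _ _ _ _ _ _ ha) (@derive_val _ _ _ _ _ _ _ hb). Qed.

Lemma flow_coef_derive N (Phi : R -> L20 R -> L20 R) (u : L20 R) (k : nat) :
  is_truncated_flow N Phi -> (k < N)%N ->
  let w := fourier (truncP N u) k.+1 in
  exists a : R[i],
    is_cderive (fun t => fourier (Phi t u) k.+1) 0 a /\
    (1 + k.+1%:R) * complex.Re a = k.+1%:R * complex.Im (fourier u k.+1 +
       fourier (fun x => truncP N u x ^+ 2) k.+1) /\
    (1 + k.+1%:R) * complex.Im a = - (k.+1%:R * complex.Re (fourier u k.+1 +
       fourier (fun x => truncP N u x ^+ 2) k.+1)).
Proof.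
move=> flow kN w; have [Phi0 /(_ 0 k.+1%:Z) [a [b [da db eqn]]]] := flow u.
exists a; split => //.
have cs := conj_sym_fourier u.
move: eqn; rewrite Phi0 /ddx.
have -> : fourier (truncP N (fun x => truncP N u x ^+ 2)) k.+1 =
    fourier (fun x => truncP N u x ^+ 2) k.+1.
  rewrite {1}/truncP fourier_trig_sum ?absz_nat ?kN// => n.
  by apply: fourierN; exact: trig_sum_sqr_integrable.
set z := fourier _ _; set v := fourier _ _.
have natC (x : R[i]) : (`|k.+1%:Z|%N)%:R * x = k.+1%:R%:C * x.
  by congr (_ * _); rewrite absz_nat rmorph_nat.
(* The flow provides the derivative of |D_x| u as a separate number; uniqueness of derivatives
   identifies it with n times that of u. *)
have bE : b = k.+1%:R%:C * a.
  case: db da; rewrite /absD => db1 db2 [da1 da2].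
  have Rek (x : R[i]) : complex.Re (k.+1%:R%:C * x) = k.+1%:R * complex.Re x.
    by case: x => x1 x2 /=; rewrite mul0r subr0.
  have Imk (x : R[i]) : complex.Im (k.+1%:R%:C * x) = k.+1%:R * complex.Im x.
    by case: x => x1 x2 /=; rewrite mul0r addr0.
  apply: complex_eqP; rewrite ?Rek ?Imk.
    apply: (is_derive1_unique _ (is_derive1_scale k.+1%:R da1)).
    congr (is_derive _ _ _ _): db1; apply/funext => t.
    by rewrite natC Rek.
  apply: (is_derive1_unique _ (is_derive1_scale k.+1%:R da2)).
  congr (is_derive _ _ _ _): db2; apply/funext => t.
  by rewrite natC Imk.
rewrite bE.
have iC : ('i : R[i]) = 0 +i* 1 by [].
have zC : (k.+1%:Z%:~R : R[i]) = k.+1%:R%:C by rewrite -pmulrn rmorph_nat.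
rewrite zC; case: a {da db bE} => a1 a2; case: z => z1 z2; case: v => v1 v2.
move=> /eqP; rewrite eq_complex/= => /andP[/eqP h1 /eqP h2].
by split; lra.
Qed.

(** The linear part of the equation only rotates each coefficient, Im (conj(z) z) being 0, so the
    nonlinearity alone changes the norm. *)
Lemma F_E (s : R) (Phi : nat -> R -> L20 R -> L20 R) (N : nat) (u : L20 R) :
  is_truncated_flow N (Phi N) ->
  F_ s Phi N u = 2 * \sum_(k < N) phi s k.+1 *
    complex.Im (conjc (fourier u k.+1) * fourier (fun x => truncP N u x ^+ 2) k.+1).
Proof.
move=> flow; rewrite /F_ derive1E.
pose q (k : nat) : R := k.+1%:R `^ (2 * (s + 2^-1)).
have -> : (fun t => fine (sqHnorm (s + 2^-1) (truncP N (Phi N t u)))) =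
  fun t => \sum_(k < N) q k * (complex.Re (fourier (Phi N t u) k.+1) ^+ 2 +
    complex.Im (fourier (Phi N t u) k.+1) ^+ 2).
  by apply/funext => t; rewrite sqHnorm_truncP.
have /choice[a ha] : forall k : 'I_N, exists a : R[i],
    is_cderive (fun t => fourier (Phi N t u) k.+1) 0 a /\
    (1 + k.+1%:R) * complex.Re a = k.+1%:R * complex.Im (fourier u k.+1 +
       fourier (fun x => truncP N u x ^+ 2) k.+1) /\
    (1 + k.+1%:R) * complex.Im a = - (k.+1%:R * complex.Re (fourier u k.+1 +
       fourier (fun x => truncP N u x ^+ 2) k.+1)).
  by move=> k; exact: flow_coef_derive.
have Phi0 : Phi N 0 u = u by have [] := flow u.
have hd : is_derive (0 : R) (1 : R) (fun t => \sum_(k < N) q k *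
   (complex.Re (fourier (Phi N t u) k.+1) ^+ 2 +
    complex.Im (fourier (Phi N t u) k.+1) ^+ 2))
   (\sum_(k < N) q k * (2 * (complex.Re (fourier u k.+1) * complex.Re (a k)) +
       2 * (complex.Im (fourier u k.+1) * complex.Im (a k)))).
  apply: is_derive1_sum => k; apply: is_derive1_scale.
  have [[d1 d2] _] := ha k.
  have := is_deriveD (is_derive1_sqr d1) (is_derive1_sqr d2).
  by rewrite Phi0.
rewrite (@derive_val _ _ _ _ _ _ _ hd) mulr_sumr; apply: eq_bigr => k _; have [_ [h1 h2]] := ha k.
rewrite /phi -/(q k); set n : R := k.+1%:R.
have n1 : 1 + n != 0 by rewrite gt_eqF// ltr_wpDr.
move: h1 h2; rewrite -/n.
set z := fourier _ _; set v := fourier _ _; set A := a k.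
have -> : (n / (1 + n)) = (1 + n)^-1 * n by rewrite mulrC.
move=> h1 h2.
have -> : complex.Re A = (1 + n)^-1 * (n * complex.Im (z + v)) by rewrite -h1 mulKf.
have -> : complex.Im A = (1 + n)^-1 * - (n * complex.Re (z + v)) by rewrite -h2 mulKf.
by case: z {h1 h2} => z1 z2; case: v => v1 v2 /=; ring.
Qed.

End time_derivative.

(** * Law of the Fourier coefficients *)

Section gaussian_law.
Context (R : realType).
Local Open Scope complex_scope.

Lemma le_cvg0 (x y : \bar R) (K : R) (a : (\bar R)^nat) :
  y \is a fin_num -> a @ \oo --> 0%E ->
  (\forall n \near \oo, (x <= y + K%:E * a n)%E) -> (x <= y)%E.
Proof.
move=> yfin a0 h.
have ha : (fun n => y + K%:E * a n)%E @ \oo --> (y + K%:E * 0)%E.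
  have h1 : (fun n => K%:E * a n)%E @ \oo --> (K%:E * 0)%E by exact: cvgeZl.
  have d0 : (y +? (K%:E * 0))%E by rewrite mule0; exact: fin_num_adde_defl.
  exact: (cvgeD d0 (cvg_cst _) h1).
have : (x <= y + K%:E * 0)%E by exact: cvge_ge ha.
by rewrite mule0 adde0.
Qed.

Lemma conj_sym_random_coef (s : R) (h l : nat -> R) :
  conj_sym (random_coef s h l).
Proof.
move=> n; rewrite /random_coef.
have -> : gauss_coef h l (- n) = conjc (gauss_coef h l n).
  case: n => [[|k]|k].
  - by rewrite oppr0 /gauss_coef/= oppr0.
  - by rewrite -NegzE.
  - rewrite NegzE opprK -NegzE /gauss_coef.
    by apply/esym; exact: conjcK.
rewrite abszN rmorphM fmorphV; congr (_ * _^-1).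
by rewrite /= oppr0.
Qed.

(** A Fourier coefficient is Lipschitz for the L2 norm, and that of the partial sums is constant
    once M >= |n|. *)
Lemma fourier_limit (c : int -> R[i]) (f : R -> R) (n : int) :
  conj_sym c -> f \in Lfun (torus R) 2%:E ->
  (fun M => L2norm (f \- trig_sum c M)%R) @ \oo --> 0%E ->
  fourier f n = c n.
Proof.
move=> cs f2 fc.
have coef M : (`|n| <= M)%N -> fourier (trig_sum c M) n = c n.
  by move=> nM; rewrite fourier_trig_sum// nM.
have zero (d : R) : (\forall M \near \oo, (`|d|%:E <=
    0 + (coef_cst R)%:E * L2norm (f \- trig_sum c M)%R)%E) -> d = 0.
  move=> h; apply/eqP; rewrite -normr_le0 -lee_fin.
  by apply: le_cvg0 fc h.
have Re0 : complex.Re (fourier f n) - complex.Re (c n) = 0.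
  apply: zero; exists `|n|%N => // M /= nM; rewrite add0e -(coef _ nM).
  by apply: Re_fourier_lip => //; exact: trig_sum_Lfun2.
have Im0 : complex.Im (fourier f n) - complex.Im (c n) = 0.
  apply: zero; exists `|n|%N => // M /= nM; rewrite add0e -(coef _ nM).
  by apply: Im_fourier_lip => //; exact: trig_sum_Lfun2.
by apply: complex_eqP; apply/eqP; rewrite -subr_eq0 ?Re0 ?Im0.
Qed.

(** Division by the standard deviation recovers, almost surely, the variables of the random series,
    interleaved into one sequence so that a filtration is available. *)
Definition modes (s : R) (k : nat) (u : L20 R) : R :=
  (if odd k then complex.Im (fourier u (k./2.+1))
   else complex.Re (fourier u (k./2.+1))) / cc s k./2.

Lemma measurable_modes s k : measurable_fun [set: L20 R] (modes s k).
Proof.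
rewrite /modes; case: (odd k); apply: measurable_funM => //.
- exact: measurable_Im_fourier.
- exact: measurable_Re_fourier.
Qed.

Lemma probability_ae_eq d (T : measurableType d) (P : probability T R)
    (A B : set T) : measurable A -> measurable B ->
  {ae P, forall w, A w <-> B w} -> P A = P B.
Proof.
move=> mA mB [N [mN PN0 hN]].
have le A' B' : measurable A' -> measurable B' -> (forall w, ~ N w -> A' w -> B' w) ->
    (P A' <= P B')%E.
  move=> mA' mB' h; apply: (@le_trans _ _ (P (B' `|` N))).
    apply: le_measure; rewrite ?inE//; first exact: measurableU.
    by move=> w Aw; case: (pselect (N w)) => Nw; [right|left; exact: h].
  have : (P (B' `|` N) <= P B' + P N)%E by exact: measureU2.
  by rewrite PN0 adde0.
have hNw w : ~ N w -> A w <-> B w.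
  by move=> Nw; apply: contrapT => h; apply: Nw; exact: hN.
apply/eqP; rewrite eq_le; apply/andP; split; apply: le => // w Nw.
  by case: (hNw w Nw).
by case: (hNw w Nw).
Qed.

Section law.
Variables (s : R) (gamma : probability (L20 R) R).
Hypothesis gammaP : is_gamma s gamma.

Let nat_sum (k : nat) : nat + nat := if odd k then inr k./2 else inl k./2.

Let nat_sum_inj : injective nat_sum.
Proof.
move=> i j; rewrite /nat_sum; case oi : (odd i); case oj : (odd j) => // -[] h;
  by rewrite -(odd_double_half i) -(odd_double_half j) oi oj h.
Qed.

(** Almost surely the modes of [X] are the variables [h] and [l], so every event in the modes is
    carried over to the original probability space. There independence is stated over nat + nat;
    [nat_sum] interleaves the two families. *)
Lemma modes_law :
  (forall n (B : nat -> set R), (forall i, measurable (B i)) ->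
    gamma (\bigcap_(i in `I_n) (modes s i @^-1` B i)) =
    (\prod_(i < n) gamma (modes s i @^-1` B i))%E) /\
  (forall k (B : set R), measurable B ->
    gamma (modes s k @^-1` B) = normal_prob 0 1 B).
Proof.
have [d [Om [P [h [l [X [indep law lim gammaE]]]]]]] := gammaP.
pose Z k : {RV P >-> R} := family2 h l (nat_sum k).
have ZX : {ae P, forall w, forall k, modes s k (X w) = Z k w}.
  apply: filterS lim => w hw k.
  have := @fourier_limit _ (X w) (k./2.+1) (conj_sym_random_coef s _ _) (L20_Lfun2 _) hw.
  rewrite /modes => ->.
  have p0 : k./2.+1%:R `^ (s + 2^-1) != 0 :> R by rewrite gt_eqF// powR_gt0.
  have q0 : (Num.sqrt 2 : R) != 0 by rewrite gt_eqF// sqrtr_gt0.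
  have pC (x : R) : x != 0 -> (x%:C)^-1 = (x^-1)%:C :> R[i] by move=> ?; rewrite fmorphV.
  rewrite /random_coef absz_nat pC// /Z /nat_sum /cc /=.
  by case: (odd k); rewrite /= ; field; rewrite p0.
have mmodes k B : measurable B -> measurable (modes s k @^-1` B).
  by move=> mB; rewrite -[_ @^-1` _]setTI; exact: measurable_modes.
have mZ k B : measurable B -> measurable (Z k @^-1` B).
  by move=> mB; rewrite -[_ @^-1` _]setTI; exact: measurable_funPT.
have gammaX A : measurable A -> gamma A = P (X @^-1` A).
  by move=> mA; rewrite gammaE.
have one k B : measurable B -> gamma (modes s k @^-1` B) = P (Z k @^-1` B).
  move=> mB; rewrite gammaX; last exact: mmodes.
  apply: probability_ae_eq; last first.
  - by apply: filterS ZX => w hw; rewrite /= hw.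
  - exact: mZ.
  - by rewrite -[_ @^-1` _]setTI; apply: measurable_funPT => //; exact: mmodes.
split; last first.
  move=> k B mB; rewrite one// /Z /nat_sum; case: (odd k) => /=.
    by have [_ <-] := law k./2 B mB.
  by have [<- _] := law k./2 B mB.
move=> n B mB.
have mcap : measurable (\bigcap_(i in `I_n) (modes s i @^-1` B i)).
  by apply: fin_bigcap_measurable => [|i _]; [exact: finite_II|exact: mmodes].
rewrite gammaX//.
have -> : P (X @^-1` (\bigcap_(i in `I_n) (modes s i @^-1` B i))) =
    P (\bigcap_(i in `I_n) (Z i @^-1` B i)).
  apply: probability_ae_eq.
  - by rewrite -[_ @^-1` _]setTI; exact: measurable_funPT.
  - by apply: fin_bigcap_measurable => [|i _]; [exact: finite_II|exact: mZ].
  - apply: filterS ZX => w hw; split => hB i /= ni; have := hB i ni => /=; by rewrite hw.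
pose J := [seq nat_sum i | i <- iota 0 n].
pose B' (i : nat + nat) := match i with inl k => B k.*2 | inr k => B k.*2.+1 end.
have B'E i : B' (nat_sum i) = B i.
  by rewrite /B' /nat_sum -[in RHS](odd_double_half i); case: (odd i).
have uJ : uniq J by rewrite map_inj_uniq// iota_uniq.
have mB' i : measurable (B' i) by case: i => k; exact: mB.
have := indep J B' uJ mB'.
have iotaE : iota 0 n = index_iota 0 n by rewrite /index_iota subn0.
rewrite {2}/J big_map iotaE big_mkord => hI.
under eq_bigr => i _ do rewrite one//.
transitivity (P (\bigcap_(i in [set` J]) (family2 h l i @^-1` B' i))).
  congr (P _); apply/seteqP; split => w hw.
    by move=> i /= /mapP[k]; rewrite mem_iota/= add0n => kn ->; rewrite B'E; exact: hw.
  move=> i /= ni; rewrite -(B'E i); apply: hw => /=.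
  by apply/mapP; exists i => //; rewrite mem_iota.
by rewrite hI; apply: eq_bigr => i _; rewrite B'E.
Qed.


End law.
End gaussian_law.

(** * From moments to L^p norms *)

Section Lnorm_of_moments.
Context d (T : measurableType d) (R : realType).

(** Where |x| <= c the left-hand side is at most c^p; elsewhere |x| / c > 1 and the exponent may be
    raised to 2m. *)
Lemma powR_le_even_pow (c x p : R) m : 0 < c -> 0 <= p -> p <= m.*2%:R ->
  `|x| `^ p <= c `^ p * (1 + (c ^+ m.*2)^-1 * x ^+ m.*2).
Proof.
move=> c0 p0 pm; have e0 : 0 <= (c ^+ m.*2)^-1 * x ^+ m.*2.
  by rewrite mulr_ge0 ?exprn_double_ge0// invr_ge0 exprn_double_ge0.
have [xc|cx] := leP `|x| c.
  apply: (@le_trans _ _ (c `^ p)).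
    by apply: ge0_ler_powR; rewrite ?nnegrE// ltW.
  by rewrite ler_peMr ?powR_ge0// lerDl.
have xE : `|x| = c * (`|x| / c) by rewrite mulrCA divff ?mulr1// gt_eqF.
rewrite {1}xE powRM ?divr_ge0 ?(ltW c0)// ler_wpM2l ?powR_ge0//.
apply: (@le_trans _ _ ((`|x| / c) `^ m.*2%:R)).
  by apply: ler_powR => //; rewrite ler_pdivlMr// mul1r ltW.
rewrite powR_mulrn ?divr_ge0 ?(ltW c0)// expr_div_n mulrC.
rewrite -[leLHS]add0r lerD//; rewrite -!mul2n !exprM real_normK ?num_real//.
Qed.

(** With p < m <= 2p and c = [Num.sqrt A * m%:R], the moment of order 2m is at most c^(2m), so the
    integral of |f|^p is at most 2 c^p. The root 2^(1/p) is at most 2, and 2 c <= 4 [Num.sqrt A]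
    p. *)
Lemma Lnorm_le_moments (mu : {measure set T -> \bar R}) (f : T -> R) (A p : R) :
  measurable_fun [set: T] f -> (mu [set: T] <= 1)%E -> 0 < A ->
  (forall m, (0 < m)%N ->
    (\int[mu]_w (f w ^+ m.*2)%:E <= ((A * m%:R ^+ 2) ^+ m)%:E)%E) ->
  1 <= p -> ('N[mu]_(p%:E)[EFin \o f] <= (4 * Num.sqrt A * p)%:E)%E.
Proof.
move=> mf mu1 A0 mom p1; have p0 : 0 < p by lra.
pose m := (Num.truncn p).+1.
have pm : p < m%:R by rewrite truncnS_gt.
have mp : m%:R <= 2 * p.
  rewrite /m -natr1; have : (Num.truncn p)%:R <= p by rewrite truncn_le// ltW.
  by move=> ?; lra.
have sA : 0 < Num.sqrt A by rewrite sqrtr_gt0.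
pose c := Num.sqrt A * m%:R.
have c0 : 0 < c by rewrite mulr_gt0// ltr0n.
have cE : c ^+ m.*2 = (A * m%:R ^+ 2) ^+ m.
  by rewrite -mul2n exprM /c (exprMn 2) sqr_sqrtr// ltW.
have mexp k : measurable_fun [set: T] (fun w => (f w ^+ k)%:E).
  by apply/measurable_EFinP; exact: measurable_funX.
have int_le : (\int[mu]_w ((`|f w| `^ p)%R)%:E <= ((2 * c `^ p)%R)%:E)%E.
  apply: (@le_trans _ _ (\int[mu]_w ((c `^ p)%:E * (1%:E + ((c ^+ m.*2)^-1)%:E * (f w ^+ m.*2)%:E)))%E).
    apply: ge0_le_integral => //.
    - have mnf : measurable_fun [set: T] (fun w => `|f w|) by exact: measurableT_comp.
      by apply/measurable_EFinP; exact: (measurableT_comp (measurable_powR p) mnf).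
    - apply/measurable_EFinP; apply: measurable_funM => //; apply: measurable_funD => //.
      by apply: measurable_funM => //; exact: measurable_funX.
    - move=> w _; rewrite lee_fin.
      apply: powR_le_even_pow => //; first exact: ltW.
      by rewrite -mul2n natrM (le_trans (ltW pm))// ler_peMl ?ler1n.
  have ci0 : 0 <= (c ^+ m.*2)^-1 by rewrite invr_ge0 exprn_double_ge0.
  have e0 w : (0 <= ((c ^+ m.*2)^-1)%:E * (f w ^+ m.*2)%:E)%E.
    by rewrite -EFinM lee_fin mulr_ge0// exprn_double_ge0.
  rewrite ge0_integralZl_EFin ?powR_ge0//; last 2 first.
  - by move=> w _; rewrite adde_ge0.
  - apply/measurable_EFinP; apply: measurable_funD => //.
    by apply: measurable_funM => //; exact: measurable_funX.
  rewrite ge0_integralD//; last first.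
    by apply/measurable_EFinP; apply: measurable_funM => //; exact: measurable_funX.
  rewrite integral_cst// mul1e ge0_integralZl_EFin//; last first.
    by move=> w _; rewrite lee_fin exprn_double_ge0.
  rewrite (mulrC 2) EFinM lee_wpmul2l ?lee_fin ?powR_ge0//.
  rewrite (_ : 2%:E = 1 + 1)%E; last by rewrite -EFinD.
  apply: leeD => //; apply: (@le_trans _ _ (((c ^+ m.*2)^-1)%:E * (c ^+ m.*2)%:E)%E).
    by rewrite lee_wpmul2l ?lee_fin// cE; exact: mom.
  by rewrite -EFinM mulVf// gt_eqF// exprn_gt0.
rewrite unlock/=; apply: (@le_trans _ _ ((2 * c `^ p)%:E `^ p^-1)%E).
  apply: gt0_ler_poweR; rewrite ?invr_ge0 ?(ltW p0)//.
  - rewrite in_itv/= leey andbT; apply: integral_ge0 => w _.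
    by rewrite lee_fin powR_ge0.
  - by rewrite in_itv/= leey andbT lee_fin mulr_ge0// powR_ge0.
rewrite poweR_EFin lee_fin powRM ?powR_ge0// -powRrM mulfV ?gt_eqF//.
rewrite powRr1 ?(ltW c0)//.
apply: (@le_trans _ _ (2 * c)).
  by rewrite ler_wpM2r ?(ltW c0)// ler1_powR ?ler1n// invf_le1.
rewrite /c [leRHS](_ : _ = 2 * (Num.sqrt A * (2 * p))); last by ring.
by rewrite ler_wpM2l// ler_wpM2l// ltW.
Qed.

End Lnorm_of_moments.

Section moments_of_limit.
Context d (T : measurableType d) (R : realType).

(* L2 convergence does not pass the moments of order 2m to the limit; their
   truncations are Lipschitz, hence continuous for the L2 norm. *)
Definition truncated_pow (L : R) (n : nat) (x : R) : R := Num.min `|x| L ^+ n.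

Lemma truncated_pow_ge0 L n x : 0 <= L -> 0 <= truncated_pow L n x.
Proof. by move=> L0; rewrite exprn_ge0// le_min normr_ge0. Qed.

Lemma truncated_pow_le L n x : 0 <= L -> truncated_pow L n.*2 x <= x ^+ n.*2.
Proof.
move=> L0; have -> : x ^+ n.*2 = `|x| ^+ n.*2.
  by rewrite -mul2n !exprM real_normK ?num_real.
by rewrite lerXn2r ?nnegrE ?le_min ?normr_ge0// ge_min lexx.
Qed.

(** Truncation of |x| at L is 1-Lipschitz, and the n-th power has Lipschitz constant n L^(n-1) on
    [0, L]. *)
Lemma truncated_pow_lipschitz (L x y : R) n : 0 <= L ->
  truncated_pow L n x <= truncated_pow L n y + (n%:R * L ^+ n.-1) * `|y - x|.
Proof.
move=> L0; rewrite /truncated_pow.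
have mm (z : R) : (0 <= Num.min `|z| L) && (Num.min `|z| L <= L).
  by rewrite le_min normr_ge0 L0 ge_min lexx orbT.
have /andP[a0 aL] := mm x; have /andP[b0 bL] := mm y.
have ab : `|Num.min `|x| L - Num.min `|y| L| <= `|y - x|.
  have h1 : `|x| - `|y| <= `|y - x| by rewrite distrC lerB_dist.
  have h2 : `|y| - `|x| <= `|y - x| by exact: lerB_dist.
  have h0 := normr_ge0 (y - x).
  by rewrite ler_norml /Num.min; case: ltP => h3; case: ltP => h4; apply/andP; split; lra.
move: a0 aL b0 bL ab; set a := Num.min _ _; set b := Num.min _ _ => a0 aL b0 bL ab.
rewrite -lerBlDl subrXX; apply: le_trans (ler_norm _) _.
rewrite normrM mulrC; apply: ler_pM => //; apply: le_trans (ler_norm_sum _ _ _) _.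
rewrite mulr_natl -[X in _ *+ X]card_ord -sumr_const; apply: ler_sum => i _.
have -> : L ^+ n.-1 = L ^+ (n.-1 - i) * L ^+ i.
  by rewrite -exprD subnK//; have := ltn_ord i; lia.
rewrite normrM !normrX !ger0_norm//.
by apply: ler_pM; rewrite ?exprn_ge0// lerXn2r// nnegrE.
Qed.

(** At a fixed truncation level the error is a constant times the L1, hence the L2, distance of
    [f N] from [F], which tends to 0. The level is removed by monotone convergence. *)
Lemma integral_moment_limit (P : probability T R) (E : set T) (f : nat -> T -> R)
    (F : T -> R) (B : R) m :
  measurable E -> (forall N, (0 < N)%N -> measurable_fun [set: T] (f N)) ->
  measurable_fun [set: T] F ->
  (fun N => 'N[P]_(2%:E)[EFin \o (f N \- F)%R]%E) @ \oo --> 0%E ->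
  (forall N, (0 < N)%N -> (\int[P]_(w in E) (f N w ^+ m.*2)%:E <= B%:E)%E) ->
  (\int[P]_(w in E) (F w ^+ m.*2)%:E <= B%:E)%E.
Proof.
move=> mE mf mF fF fB.
have mtr (L : R) (g : T -> R) : measurable_fun [set: T] g ->
    measurable_fun E (fun w => (truncated_pow L m.*2 (g w))%:E).
  move=> mg; apply: measurable_funTS; apply/measurable_EFinP.
  apply: measurable_funX; apply: measurable_minr => //.
  exact: measurableT_comp.
have trunc (L : nat) :
    (\int[P]_(w in E) (truncated_pow L%:R m.*2 (F w))%:E <= B%:E)%E.
  have L0 : 0 <= L%:R :> R by [].
  pose K : R := (m.*2)%:R * L%:R ^+ m.*2.-1.
  have K0 : 0 <= K by rewrite mulr_ge0// exprn_ge0.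
  have hB : \forall N \near \oo, (\int[P]_(w in E) (truncated_pow L%:R m.*2 (F w))%:E <=
      B%:E + K%:E * 'N[P]_(2%:E)[EFin \o (f N \- F)%R])%E.
    exists 1%N => // N /= N0.
    have mfN := mf N N0.
    have mD : measurable_fun [set: T] (fun w => `|f N w - F w|).
      by apply: measurableT_comp => //; exact: measurable_funB.
    apply: (@le_trans _ _ (\int[P]_(w in E) ((truncated_pow L%:R m.*2 (f N w))%:E +
        K%:E * `|f N w - F w|%:E))%E).
      apply: ge0_le_integral => //.
      - by move=> w _; rewrite lee_fin truncated_pow_ge0.
      - exact: mtr.
      - apply: emeasurable_funD; first exact: mtr.
        apply: measurable_funTS; apply/measurable_EFinP; exact: measurable_funM.
      - move=> w _; rewrite -EFinM -EFinD lee_fin; exact: truncated_pow_lipschitz.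
    rewrite ge0_integralD//; last 4 first.
    - by move=> w _; rewrite lee_fin truncated_pow_ge0.
    - exact: mtr.
    - by move=> w _; rewrite -EFinM lee_fin mulr_ge0.
    - by apply: measurable_funTS; apply/measurable_EFinP; exact: measurable_funM.
    apply: leeD.
      apply: le_trans (fB N N0); apply: ge0_le_integral => //.
      - by move=> w _; rewrite lee_fin truncated_pow_ge0.
      - exact: mtr.
      - by apply: measurable_funTS; exact: measurable_expr_double.
      - by move=> w _; rewrite lee_fin truncated_pow_le.
    rewrite ge0_integralZl_EFin//; last first.
      by apply: measurable_funTS; exact/measurable_EFinP.
    rewrite lee_wpmul2l ?lee_fin//.
    apply: (@le_trans _ _ (\int[P]_w `|f N w - F w|%:E)%E).
      by apply: ge0_subset_integral => //; exact/measurable_EFinP.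
    apply: (@le_trans _ _ ('N[P]_1[EFin \o ((f N \- F) \* cst 1%R)%R])%E).
      rewrite Lnorm1 (_ : (\int[P]_w _ = \int[P]_w `|(EFin \o ((f N \- F) \* cst 1%R)%R) w|)%E)//.
      by apply: eq_integral => w _ /=; rewrite mulr1.
    apply: le_trans.
      apply: (@hoelder _ _ _ P (f N \- F)%R (cst 1) 2 2) => //.
        exact: measurable_funB.
      by rewrite [RHS]splitr !div1r.
    rewrite -[leRHS]mule1 lee_wpmul2l ?Lnorm_ge0//.
    by rewrite Lnorm_cst1 [X in (X `^ _)%E](@probability_setT _ _ _ P) poweR_EFin powR1.
  by apply: le_cvg0 fF hB.
have nd w : E w -> nondecreasing_seq (fun L : nat => (truncated_pow L%:R m.*2 (F w))%:E).
  move=> _ L L' LL'; rewrite lee_fin; apply: lerXn2r.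
  - by rewrite nnegrE le_min normr_ge0/=.
  - by rewrite nnegrE le_min normr_ge0/=.
  - by rewrite le_min ge_min lexx/= ge_min ler_nat LL' orbT.
have := @cvg_monotone_convergence _ _ _ P E mE
  (fun L w => (truncated_pow L%:R m.*2 (F w))%:E) (fun L => mtr L%:R F mF)
  (fun L w _ => truncated_pow_ge0 _ _ (ler0n R L)) nd.
have -> : (\int[P]_(w in E) limn (fun L : nat => (truncated_pow L%:R m.*2 (F w))%:E) =
   \int[P]_(w in E) (F w ^+ m.*2)%:E)%E.
  apply: eq_integral => w _; apply/cvg_lim => //; apply: cvg_near_cst.
  exists (Num.truncn `|F w|).+1 => // L /= hL.
  have FL : `|F w| <= L%:R by rewrite (le_trans (ltW (truncnS_gt _)))// ler_nat.
  rewrite /truncated_pow (min_idPl FL).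
  by rewrite -mul2n !exprM real_normK ?num_real.
by move=> h; apply: cvge_le h; exact: nearW.
Qed.

End moments_of_limit.

(** * The moments of F_N and of its limit *)

Section modes_of_functions.
Context (R : realType) (s : R).
Local Open Scope complex_scope.

Lemma fourier_modes (u : L20 R) k :
  fourier u k.+1 = (cc s k * modes s k.*2 u) +i* (cc s k * modes s k.*2.+1 u).
Proof.
have c0 : cc s k != 0 by rewrite gt_eqF// cc_gt0.
rewrite /modes /= odd_double/= doubleK uphalf_double.
by rewrite !(mulrC (cc s k)) !mulfVK//; case: (fourier _ _).
Qed.

Lemma Im_mul3_conj (c c' c'' a b a' b' a'' b'' : R) :
  complex.Im (((c * a) +i* (c * b)) * ((c' * a') +i* (c' * b')) *
    conjc ((c'' * a'') +i* (c'' * b''))) =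
  c * c' * c'' * (a'' * (a * b' + b * a') - b'' * (a * a' - b * b')).
Proof. by rewrite /=; ring. Qed.

Lemma F_cubic (Phi : nat -> R -> L20 R -> L20 R) N u :
  is_truncated_flow N (Phi N) ->
  F_ s Phi N u = cubic (modes s) (Psi s) (cc s) N u.
Proof.
move=> flow; rewrite (F_E s u flow) /truncP.
rewrite cubic_resummation; [|exact: conj_sym_fourier|exact: fourier_L20_0].
rewrite mulr_sumr /cubic; apply: eq_bigr => k _.
rewrite /quadI /quadJ !mulr_sumr -sumrB mulr_sumr; apply: eq_bigr => i _.
have ik := ltn_ord i; set j := (k - i.+1)%N.
have kj : (k - i = j.+1)%N by rewrite /j; lia.
have ijk : (i + j).+2 = k.+1 by rewrite /j; lia.
rewrite /cubic_im ijk !fourier_modes kj /Psi /psi addSn addnS ijk Im_mul3_conj.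
move: (phi s k.+1) (phi s i.+1) (phi s j.+1) (cc s i) (cc s j) (cc s k) => p q q' c c' c''.
by move: (modes s i.*2 u) (modes s i.*2.+1 u) (modes s j.*2 u) (modes s j.*2.+1 u)
  (modes s k.*2 u) (modes s k.*2.+1 u) => a b a' b' a'' b''; ring.
Qed.

(** Only the H^(1/2) part of the energy is kept; dividing by its factor 4 pi gives rho^2 = r^2 / (4
    pi). *)
Lemma energy_modes (r : R) (u : L20 R) : 0 <= r -> (energy u <= r%:E)%E ->
  forall n, \sum_(i < n) i.+1%:R * (cc s i *
     Num.sqrt (modes s i.*2 u ^+ 2 + modes s i.*2.+1 u ^+ 2)) ^+ 2 <=
    Num.sqrt (r ^+ 2 / (4 * pi)) ^+ 2.
Proof.
move=> r0 Er n; have p4 : 0 < 4 * pi :> R by rewrite mulr_gt0// pi_gt0.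
rewrite sqr_sqrtr ?divr_ge0 ?sqr_ge0 ?(ltW p4)// ler_pdivlMr// mulrC.
have S0 : (0 <= sqHnorm 2^-1 u)%E.
  apply: nneseries_ge0 => k _ _; rewrite lee_fin mulr_ge0 ?powR_ge0 ?sqr_ge0//.
have X0 : (0 <= L2norm u ^+ 2 + (4 * pi)%:E * sqHnorm 2^-1 u)%E.
  apply: adde_ge0; first by apply: expe_ge0; exact: Lnorm_ge0.
  by apply: mule_ge0 => //; rewrite lee_fin ltW.
have le_r2 : (L2norm u ^+ 2 + (4 * pi)%:E * sqHnorm 2^-1 u <= (r ^+ 2)%:E)%E.
  have := Er; rewrite /energy => h.
  have : ((L2norm u ^+ 2 + (4 * pi)%:E * sqHnorm 2^-1 u) `^ 2^-1 `^ 2 <= r%:E `^ 2)%E.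
    by apply: gt0_ler_poweR => //; rewrite in_itv/= leey andbT ?poweR_ge0 ?lee_fin.
  by rewrite -poweRrM mulVf// poweRe1// poweR_EFin powR_mulrn.
have sum_le : ((\sum_(i < n) i.+1%:R * (cc s i *
     Num.sqrt (modes s i.*2 u ^+ 2 + modes s i.*2.+1 u ^+ 2)) ^+ 2)%:E <= sqHnorm 2^-1 u)%E.
  apply: (@le_trans _ _ (\sum_(1 <= k < n.+1) (k%:R `^ (2 * 2^-1) *
      Normc.normc (fourier u k%:Z) ^+ 2)%:E)%E); last first.
    by apply: nneseries_lim_ge => k _ _; rewrite lee_fin mulr_ge0 ?powR_ge0 ?sqr_ge0.
  rewrite big_add1 big_mkord sumEFin lee_fin; apply: ler_sum => i _.
  have sq (a b c : R) : (a * Num.sqrt (b ^+ 2 + c ^+ 2)) ^+ 2 = (a * b) ^+ 2 + (a * c) ^+ 2.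
    by rewrite (exprMn 2) sqr_sqrtr ?addr_ge0 ?sqr_ge0//; ring.
  by rewrite mulfV// powRr1// sqr_normc fourier_modes sq.
rewrite -lee_fin EFinM; apply: le_trans (lee_wpmul2l _ sum_le) _.
  by rewrite lee_fin ltW.
apply: le_trans le_r2; rewrite leeDr//; apply: expe_ge0; exact: Lnorm_ge0.
Qed.

End modes_of_functions.

Lemma ge0_integral_mrestr d (T : measurableType d) (R : realType)
    (mu : {measure set T -> \bar R}) (D : set T) (mD : measurable D) (f : T -> \bar R) :
  measurable_fun [set: T] f -> (forall x, 0 <= f x)%E ->
  (\int[mrestr mu mD]_x f x = \int[mu]_(x in D) f x)%E.
Proof.
move=> mf f0.
rewrite (@ge0_negligible_integral _ _ _ (mrestr mu mD) setT (~` D))//; last 2 first.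
- exact: measurableC.
- by rewrite -[LHS]/(mu (~` D `&` D)) setICl measure0.
rewrite setTD setCK; apply: eq_measure_integral => A mA AD.
by rewrite -[LHS]/(mu (A `&` D)) setIidl.
Qed.

Section moments_of_F.
Context (R : realType) (s r : R).
Hypotheses (s1 : 1 < s) (r0 : 0 < r).

Definition sum_ee_cst : R := ee_cst s * (1 + (2 * s - 2)^-1).
Definition low : R := 4 * low_cst s * Num.sqrt (r ^+ 2 / (4 * pi)).
(** The constant of [integral_cubic_le] with Z = [sum_ee_cst], finite because s > 1, and A = 1/2 as
    in [sqr_cc_gg]. *)
Definition moment_cst : R := 4 * (2 * (8 * low) ^+ 2 + 33 * cubic_cst sum_ee_cst 2^-1).

Lemma sum_ee_cst_gt0 : 0 < sum_ee_cst.
Proof.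
have inv_gt0 : 0 < (2 * s - 2)^-1 by rewrite invr_gt0; have := s1; lra.
by rewrite mulr_gt0 ?ee_cst_gt0//; lra.
Qed.

Lemma moment_cst_gt0 : 0 < moment_cst.
Proof.
have : 0 < cubic_cst sum_ee_cst 2^-1 by apply: cubic_cst_gt0 => //; exact: sum_ee_cst_gt0.
by rewrite /moment_cst; have := sqr_ge0 (8 * low); lra.
Qed.

Lemma low_ge0 : 0 <= low.
Proof. by rewrite mulr_ge0 ?sqrtr_ge0// mulr_ge0// ltW// low_cst_gt0. Qed.

Lemma integral_F_le (gamma : probability (L20 R) R) (Phi : nat -> R -> L20 R -> L20 R)
    N m :
  is_gamma s gamma -> is_truncated_flow N (Phi N) -> (0 < m)%N ->
  (\int[gamma]_(u in [set u : L20 R | (energy u <= r%:E)%E]) (F_ s Phi N u ^+ m.*2)%:E <=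
    ((moment_cst * m%:R ^+ 2) ^+ m)%:E)%E.
Proof.
move=> hg flow m0; have [indep law] := modes_law hg.
have -> : F_ s Phi N = cubic (modes s) (Psi s) (cc s) N.
  by apply/funext => u; exact: F_cubic.
have h20 : 0 < 2^-1 :> R by rewrite invr_gt0.
apply: (integral_cubic_le (measurable_modes s) indep law (Psi_sym s) (ee_gt0 s)
  (gg_gt0 s) sum_ee_cst_gt0 h20 (sum_ee s1) (Psi_le s1) (sqr_cc_gg s) N m0
  (measurable_energy_le r) low_ge0).
move=> M u uE; apply: (normr_cubic_le s1 (sqrtr_ge0 _)).
by apply: energy_modes => //; exact: ltW.
Qed.

End moments_of_F.

Theorem proposition4p1 (R : realType) (s r : R) (hs : 1 < s) (hr : 0 < r) :
  exists2 C : R, 0 < C &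
  forall (gamma : probability (L20 R) R) (Phi : nat -> R -> L20 R -> L20 R),
    is_gamma s gamma ->
    (forall N : nat, (0 < N)%N -> is_truncated_flow N (Phi N)) ->
    (forall (N : nat) (p : R), (0 < N)%N -> 1 <= p ->
       ('N[tilde_gamma gamma r]_(p%:E)[EFin \o F_ s Phi N] <= (C * p)%:E)%E) /\
    (forall F : L20 R -> R, F \in Lfun gamma 2%:E ->
       (fun N => 'N[gamma]_(2%:E)[EFin \o (F_ s Phi N \- F)%R]%E) @ \oo --> 0%E ->
       forall p : R, 1 <= p ->
       ('N[tilde_gamma gamma r]_(p%:E)[EFin \o F] <= (C * p)%:E)%E).
Proof.
have A0 := moment_cst_gt0 r hs; set A := moment_cst s r in A0.
exists (4 * Num.sqrt A); first by rewrite mulr_gt0// sqrtr_gt0.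
move=> gamma Phi hg flow.
have mF N : (0 < N)%N -> measurable_fun [set: L20 R] (F_ s Phi N).
  move=> N0; rewrite (_ : F_ s Phi N = cubic (modes s) (Psi s) (cc s) N).
    by apply: measurable_cubic; exact: measurable_modes.
  by apply/funext => u; apply: F_cubic; exact: flow.
have mom N m : (0 < N)%N -> (0 < m)%N ->
    (\int[gamma]_(u in [set u : L20 R | (energy u <= r%:E)%E]) (F_ s Phi N u ^+ m.*2)%:E
      <= ((A * m%:R ^+ 2) ^+ m)%:E)%E.
  by move=> N0 m0; apply: integral_F_le => //; exact: flow.
have tilde_le1 : (tilde_gamma gamma r [set: L20 R] <= 1)%E.
  rewrite -[leLHS]/(gamma ([set: L20 R] `&` [set u : L20 R | (energy u <= r%:E)%E])).
  by rewrite setTI; apply: probability_le1; exact: measurable_energy_le.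
(* Finite N and the limit are treated alike from here: each only has to supply measurability and the
   even moments on the energy ball. *)
have tilde_moments (f : L20 R -> R) : measurable_fun [set: L20 R] f ->
    (forall m, (0 < m)%N ->
     (\int[gamma]_(u in [set u : L20 R | (energy u <= r%:E)%E]) (f u ^+ m.*2)%:E
      <= ((A * m%:R ^+ 2) ^+ m)%:E)%E) ->
    forall p : R, 1 <= p ->
      ('N[tilde_gamma gamma r]_(p%:E)[EFin \o f] <= (4 * Num.sqrt A * p)%:E)%E.
  move=> mf hf p p1; apply: Lnorm_le_moments => // m m0.
  rewrite ge0_integral_mrestr; first exact: hf.
    exact: measurable_expr_double.
  by move=> u; rewrite lee_fin exprn_double_ge0.
split=> [N p N0|F F2 FN]; apply: tilde_moments.
- exact: mF.
- by move=> m; exact: mom.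
- by move: F2; rewrite inE => /andP[]; rewrite inE.
- move=> m m0; apply: (integral_moment_limit _ mF _ FN).
  + exact: measurable_energy_le.
  + by move: F2; rewrite inE => /andP[]; rewrite inE.
  + by move=> N N0; exact: mom.
Qed.
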